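(* Let $\eta$ be a smooth compactly supported spacetime cutoff and let $w$ be a sign-safe truncation of the circulation $\Gamma$. Then $$\begin{aligned} \frac12\frac{d}{dt}\int\eta^2w^2\,d\nu_\Gamma+\nu\int\eta^2|\nabla w|^2\,d\nu_\Gamma={}&\int\eta\,\eta_t\,w^2\,d\nu_\Gamma-2\nu\int\eta\,w\,\nabla\eta\cdot\nabla w\,d\nu_\Gamma\\ &+\int\eta\,w^2\,b\cdot\nabla\eta\,d\nu_\Gamma-\int U\eta^2w^2\,d\nu_\Gamma . \end{aligned}$$ For nonsmooth convex truncations, equality is replaced by the corresponding favorable inequality.
   Context: Let $u=u^r(r,z,t)e_r+u^\theta(r,z,t)e_\theta+u^z(r,z,t)e_z$ be a smooth axisymmetric solution of the three-dimensional incompressible Navier--Stokes equations with viscosity $\nu>0$, in cylindrical coordinates, so that $\partial_ru^r+u^r/r+\partial_zu^z=0$. Write $\Gamma=ru^\theta$ (the circulation), $b=(u^r,u^z)$, $U=u^r/r$, $\nabla=(\partial_r,\partial_z)$, and $d\nu_\Gamma=r^{-1}\,dr\,dz$. The circulation satisfies $$\partial_t\Gamma+b\cdot\nabla\Gamma=\nu\Big(\partial_r^2-\frac1r\partial_r+\partial_z^2\Big)\Gamma$$ and vanishes on the axis $r=0$. Here $w$ is a convex Lipschitz truncation of $\Gamma$, for example $(\Gamma-k)_+$ or $(-\Gamma-k)_+$; on the set where $w$ is active, the chain rule gives the same diffusion equation in the standard weak-subsolution sense. ''Sign-safe'' refers to the truncation level containing the axis value $\Gamma(0,z,t)=0$,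 so that $w$ vanishes on the axis.
   Formalization: Equality is stated only for truncations that are locally affine where nonzero, such as (±Γ−k)_+; it fails for smooth strictly convex ones (extra term with φ''). The inequality is stated for convex Lipschitz truncations with w ≥ 0; it fails for max(Γ,−1). *)

(* Defs.v *)
From HB Require Import structures.
From mathcomp Require Import all_boot all_order all_algebra.
From mathcomp Require Import all_classical all_reals all_analysis.

Set Implicit Arguments.
Unset Strict Implicit.
Unset Printing Implicit Defensive.
Import Order.TTheory GRing.Theory Num.Theory.
Import numFieldNormedType.Exports.

Local Open Scope classical_set_scope.
Local Open Scope ring_scope.

Section Smoothness.
Context {R : realType} {V : normedModType R}.

(* [A] is meant to be open and [V] finite-dimensional; iterated derivatives in
   all directions amount to iterated partial derivatives. *)
Fixpoint Ck_on (k : nat) (A : set V) (f : V -> R) : Prop :=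
  (forall x, A x -> {for x, continuous f}) /\
  if k is k'.+1 then
    forall v : V, (forall x, A x -> derivable f x v) /\ Ck_on k' A ('D_v f)
  else True.

Definition smooth_on (A : set V) (f : V -> R) := forall k, Ck_on k A f.

End Smoothness.

Section NavierStokes.
Context {R : realType}.

Definition partial (i : 'I_3) (f : 'rV[R]_3 -> R) : 'rV[R]_3 -> R :=
  'D_(delta_mx 0 i) f.

(* Incompressible Navier-Stokes in Cartesian coordinates on R^3, for times in
   the open set [J]. *)
Definition smooth_NS_solution (nu : R) (J : set R)
    (u : 'rV[R]_3 -> R -> 'rV[R]_3) (p : 'rV[R]_3 -> R -> R) : Prop :=
  let Q : set ('rV[R]_3 * R) := [set y | J y.2] in
  [/\ forall i, smooth_on Q (fun y => u y.1 y.2 0 i),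
      smooth_on Q (fun y => p y.1 y.2),
      forall x t, J t ->
        \sum_(j < 3) partial j (fun y => u y t 0 j) x = 0
    & forall x t (i : 'I_3), J t ->
        derive1 (fun s => u x s 0 i) t
        + \sum_(j < 3) u x t 0 j * partial j (fun y => u y t 0 i) x
        = - partial i (p ^~ t) x
          + nu * \sum_(j < 3) partial j (partial j (fun y => u y t 0 i)) x ].

Definition rho (x : 'rV[R]_3) : R := Num.sqrt (x 0 0 ^+ 2 + x 0 1 ^+ 2).

(* On the axis [rho x = 0] the convention [a / 0 = 0] gives
   [e_r x = e_theta x = 0], so that [axisym_field] below takes there the value
   [uz *: e_z], as any smooth axisymmetric field does. *)
Definition e_r (x : 'rV[R]_3) : 'rV[R]_3 :=
  (x 0 0 / rho x) *: delta_mx 0 0 + (x 0 1 / rho x) *: delta_mx 0 1.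
Definition e_theta (x : 'rV[R]_3) : 'rV[R]_3 :=
  - (x 0 1 / rho x) *: delta_mx 0 0 + (x 0 0 / rho x) *: delta_mx 0 1.
Definition e_z : 'rV[R]_3 := delta_mx 0 2.

(* The arguments of [ur], [uth], [uz] are r, z, t, in this order. *)
Definition axisym_field (ur uth uz : R -> R -> R -> R)
    (x : 'rV[R]_3) (t : R) : 'rV[R]_3 :=
  ur (rho x) (x 0 2) t *: e_r x + uth (rho x) (x 0 2) t *: e_theta x
  + uz (rho x) (x 0 2) t *: e_z.

End NavierStokes.

Section MeridianHalfPlane.
Context {R : realType}.
Implicit Types (f eta w : R -> R -> R -> R) (r z t : R).

Definition d_r f r z t : R := derive1 (fun s => f s z t) r.
Definition d_z f r z t : R := derive1 (fun s => f r s t) z.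
Definition d_t f r z t : R := derive1 (fun s => f r z s) t.

Definition circulation (uth : R -> R -> R -> R) r z t : R := r * uth r z t.

Definition half_plane : set (R * R) := [set y | 0 < y.1].

(* Integration against r^-1 dr dz over {r > 0}. *)
Definition nuG_integral (g : R -> R -> R) : R :=
  \int[(lebesgue_measure \x lebesgue_measure)%E]_(y in half_plane)
    (g y.1 y.2 / y.1).

Definition nuG_integrable (g : R -> R -> R) : Prop :=
  (lebesgue_measure \x lebesgue_measure)%E.-integrable half_plane
    (fun y : R * R => (g y.1 y.2 / y.1)%:E).

(* Smooth up to r = 0, but not necessarily even in r nor zero on the axis;
   only the values for r >= 0 are relevant. *)
Definition smooth_cutoff eta : Prop :=
  let h (y : R * R * R) := eta y.1.1 y.1.2 y.2 in
  smooth_on setT h /\ compact (closure [set y | h y != 0]).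

(* The condition [phi 0 = 0] makes [w = phi Gamma] vanish on the axis. *)
Definition sign_safe_truncation (phi : R -> R) : Prop :=
  [/\ convex_function (setT : set (convex_lmodType R^o)) phi,
      lipschitz phi & phi 0 = 0].

(* The case in which the chain rule gives, where [phi Gamma != 0], the same
   diffusion equation for [phi Gamma] as for [Gamma]. It covers
   [phi s = Num.max (s - k) 0] and [phi s = Num.max (- s - k) 0] for
   [0 <= k]. *)
Definition affine_where_active (phi : R -> R) : Prop :=
  forall s, phi s != 0 ->
    exists c : R, \forall y \near s, phi y = phi s + c * (y - s).

(* Classical partial derivatives of [w = phi Gamma] may fail to exist on a
   null set of the half-plane, where they have a default value. *)
Definition energy_density eta w t r z : R := eta r z t ^+ 2 * w r z t ^+ 2.

Definition dissipation_density eta w t r z : R :=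
  eta r z t ^+ 2 * (d_r w r z t ^+ 2 + d_z w r z t ^+ 2).

Definition cutoff_time_density eta w t r z : R :=
  eta r z t * d_t eta r z t * w r z t ^+ 2.

Definition cutoff_diffusion_density eta w t r z : R :=
  eta r z t * w r z t *
  (d_r eta r z t * d_r w r z t + d_z eta r z t * d_z w r z t).

Definition cutoff_transport_density (ur uz : R -> R -> R -> R) eta w t r z : R :=
  eta r z t * w r z t ^+ 2 *
  (ur r z t * d_r eta r z t + uz r z t * d_z eta r z t).

Definition radial_density (ur : R -> R -> R -> R) eta w t r z : R :=
  (ur r z t / r) * eta r z t ^+ 2 * w r z t ^+ 2.

End MeridianHalfPlane.

(* Main.v *)
Require Import Defs.
From HB Require Import structures.
From mathcomp Require Import all_boot all_order all_algebra.
From mathcomp Require Import all_classical all_reals all_analysis.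
From mathcomp Require Import measurable_realfun ring lra.
Import Order.TTheory GRing.Theory Num.Theory.
Import numFieldNormedType.Exports.

Local Open Scope classical_set_scope.
Local Open Scope ring_scope.

(** The half square [phi^2 / 2] is replaced by a [C^2] function [K_h] whose
    second derivative is the second difference quotient of [phi^2 / 2]. Testing
    the equation of [Gam] with [eta^2 K_h'(Gam) / r] is then an instance of the
    divergence theorem, without boundary term at [r = 0] because there
    [Gam = O(r^2)].
    By the discrete product rule, [K_h''] tends to [phi'^2] outside the kinks of
    [phi], up to the term [phi(s) (phi(s + h) - 2 phi(s) + phi(s - h)) / h^2],
    which is nonnegative if [phi >= 0] and, for small [h], is [0] if
    [phi s = 0] or [phi] is affine near [s]: hence the inequality in general and
    the equality for a [phi] that is affine where active. The
    kinks of a convex function are countably many, and almost everywhere on the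
    level set of [Gam] at a kink all the derivatives of [Gam] occurring in its
    equation vanish, so that dominated convergence applies as [h] tends to [0].
    The equation of [Gam] is that of the angular momentum [x u_y - y u_x] in
    Cartesian coordinates, the angular derivative of the pressure being constant
    on each circle, hence zero. *)

(** * Derivatives of real functions *)

(** Two difficulties shape the proof. The weight [1/r] is singular on the axis, while the values of
    [ur] and [uth] at [r = 0] do not enter [axisym_field]. The meridian functions are therefore
    replaced by the Cartesian velocity components at the points [(r, 0, z)]: these are smooth for
    all real [r], and the first two vanish at [r = 0]. Orders of vanishing at the axis result, and
    order one is exactly what the weight costs. The other difficulty is that [w] is merely Lipschitz
    and that level sets of [Gam] at a kink may have positive measure. Second differences suit the
    regularization because their product rule is an exact algebraic identity, in which the kinks
    contribute a separate term. The defect of the energy balance is the limit of the integrals of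
    this term, so that equality and inequality are read off from a single limit. At a kink
    [derive1 phi] has the default value 0, and with this convention [d_r w = phi'(Gam) Gam_r] holds
    at every point with [r > 0], not only almost everywhere. *)

Section RealDerivative.
Context {R : realType}.
Implicit Types (f g : R -> R) (x l : R).

(** Multiplying the quotient by [h] includes [h = 0] and removes the punctured filter, so that later
    arguments are plain inequalities in absolute values. *)
Lemma is_derive_epsP f x l :
  is_derive x 1 f l <->
  (forall e : R, 0 < e -> exists2 d : R, 0 < d &
     forall h : R, `|h| < d -> `|f (h + x) - f x - l * h| <= e * `|h|).
Proof.
split => [[df dfl] e e0|H].
  have cf : h^-1 *: (f (h *: 1 + x) - f x) @[h --> 0^'] --> l.
    by rewrite -dfl; exact: df.
  move/cvgrPdist_le : cf => /(_ e e0); rewrite near_withinE.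
  move=> /nbhs_ballP[d/= d0 Hd]; exists d => // h hd.
  have [->|h0] := eqVneq h 0.
    by rewrite add0r subrr mulr0 subr0 normr0 mulr0.
  have := Hd h; rewrite /ball/= sub0r normrN => /(_ hd h0).
  rewrite -(ler_pM2r (_ : 0 < `|h|)) ?normr_gt0// -normrM.
  rewrite mulrBl distrC /GRing.scale/= mulr1; congr (`|_ - _| <= _).
  by rewrite mulrAC mulVf// mul1r.
have cf : h^-1 *: (f (h *: 1 + x) - f x) @[h --> 0^'] --> l.
  apply/cvgrPdist_le => e e0; rewrite near_withinE.
  have [d d0 Hd] := H e e0.
  apply/nbhs_ballP; exists d => //= h; rewrite /ball/= sub0r normrN => hd h0.
  have := Hd h hd; rewrite -(ler_pM2r (_ : 0 < `|h|^-1)) ?invr_gt0 ?normr_gt0//.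
  rewrite -mulrA mulfV ?normr_eq0// mulr1 -normfV -normrM; apply: le_trans.
  by rewrite distrC /GRing.scale/= mulr1 mulrBl -(mulrA l) mulfV// mulr1 mulrC.
split; first by apply/cvg_ex; exists l.
exact: cvg_lim cf.
Qed.

(** The limit of a divergent quotient is the default point, which is 0 in [R]. *)
Lemma derive1_nderivable f x : ~ derivable f x 1 -> derive1 f x = 0.
Proof.
by move=> nd; rewrite derive1E /derive (dvgP nd).
Qed.

(** This is the bracketing needed by the intermediate value theorem: an increment equal to [2 c] up
    to an error [|c|] has the sign of [c] and at least its size. *)
Lemma min_max_midpoint (a b c : R) : `|b - a - 2 * c| <= `|c| ->
  Num.min a b <= c + a <= Num.max a b.
Proof.
rewrite ler_norml ge_min le_max; have [c0|c0] := ger0P c => /andP[? ?];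
  apply/andP; split; apply/orP; [left|right|right|left]; lra.
Qed.

Lemma distr_right (x y k : R) : x <= y <= k + x -> `|y - x| <= `|k|.
Proof. by move=> /andP[? ?]; rewrite !ger0_norm; lra. Qed.

Lemma distr_left (x y k : R) : k + x <= y <= x -> `|y - x| <= `|k|.
Proof. by move=> /andP[? ?]; rewrite !ler0_norm; lra. Qed.

(* No inverse function is needed: near [g x] every value is taken by [g] at a
   point whose distance to [x] is controlled, by the intermediate value
   theorem. *)
Lemma is_derive_outer f g x (c d : R) :
  {near x, continuous g} -> is_derive x 1 g c -> c != 0 ->
  is_derive x 1 (f \o g) d -> is_derive (g x) 1 f (d / c).
Proof.
move=> cg /is_derive_epsP dg c0 /is_derive_epsP dfg.
have c0' : 0 < `|c| by rewrite normr_gt0.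
apply/is_derive_epsP => e e0.
have c20 : 0 < `|c| / 2 by rewrite divr_gt0.
have e20 : 0 < e * `|c| / 4 by rewrite divr_gt0// mulr_gt0.
have D0 : 0 < `|d| + 1 by have := normr_ge0 d; lra.
(* Tolerance for [g]: the first bound brackets the value to be attained and gives
   [|k'| <= 2 |h| / |c|], the second brings the error of [g], multiplied by [d / c], below
   [e |h| / 2]. *)
have e40 : 0 < Num.min (`|c| / 2) (e * `|c|^2 / (4 * (`|d| + 1))).
  rewrite lt_min c20/= divr_gt0// ?mulr_gt0// ?exprn_gt0//.
have [d1 d10 H1] := dg _ e40.
have [d2 d20 H2] := dfg _ e20.
have [d3 /= d30 H3] : exists2 r : R, 0 < r & forall y : R, `|y - x| < r -> {for y, continuous g}.
  have /nbhs_ballP[r/= r0 Hr] := cg.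
  by exists r => // y yx; apply: Hr; rewrite /ball/= distrC.
pose m := Num.min d1 (Num.min d2 d3).
have m0 : 0 < m by rewrite !lt_min d10 d20 d30.
exists (m * `|c| / 4) => [|h hm]; first by rewrite divr_gt0// mulr_gt0.
(* Twice the step at which the linear part of [g] grows by [h]: the surplus absorbs the
   linearization error, so [g x + h] lies between [g x] and [g (k + x)]. *)
pose k := 2 * h / c.
have km : `|k| < m.
  rewrite /k normrM normfV normrM ltr_pdivrMr// normr_nat.
  by have := mulr_gt0 m0 c0'; lra.
have kx : forall k' : R, `|k'| <= `|k| -> [/\ `|k'| < d1, `|k'| < d2 & `|k'| < d3].
  move=> k' kk'; have := le_lt_trans kk' km.
  by rewrite !lt_min => /and3P[].
have hk : h = c * k / 2 by rewrite /k; field.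
clearbody k.
have cont : forall a b : R, a <= b -> (forall y : R, a <= y <= b -> `|y - x| <= `|k|) ->
   {within `[a, b], continuous g}.
  move=> a b ab Hy; apply: continuous_in_subspaceT => y.
  rewrite inE/= in_itv/= => /Hy /kx[_ _]; exact: H3.
have gk : `|g (k + x) - g x - c * k| <= `|c| / 2 * `|k|.
  have [k1 _ _] := kx _ (lexx _).
  apply: le_trans (H1 _ k1) _; rewrite ler_wpM2r//.
  by rewrite ge_min lexx.
have ivt : exists2 k' : R, `|k'| <= `|k| & g (k' + x) = h + g x.
  have gkb : (h + g x) \in `[Num.min (g x) (g (k + x)), Num.max (g x) (g (k + x))].
    rewrite in_itv/= hk; apply: min_max_midpoint.
    by rewrite !normrM normfV normr_nat mulrCA divff// mulr1 mulrAC.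
  have [k0|k0] := leP 0 k.
    have [|||y] := @IVT R g x (k + x) (h + g x).
    - by rewrite lerDr.
    - apply: cont => [|y]; first by rewrite lerDr.
      exact: distr_right.
    - by move: gkb; rewrite in_itv.
    rewrite in_itv/= => yk gy; exists (y - x); last by rewrite subrK.
    exact: distr_right.
  have [|||y] := @IVT R g (k + x) x (h + g x).
  - by rewrite gerDr ltW.
  - apply: cont => [|y]; first by rewrite gerDr ltW.
    exact: distr_left.
  - by move: gkb; rewrite in_itv/= minC maxC.
  rewrite in_itv/= => yk gy; exists (y - x); last by rewrite subrK.
  exact: distr_left.
case: ivt => k' kk' gk'.
have [k1 k2 _] := kx _ kk'.
have := H2 _ k2; rewrite /= gk'.
have := H1 _ k1; rewrite gk' addrK => A B.
have A1 : `|h - c * k'| <= `|c| / 2 * `|k'|.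
  by apply: le_trans A _; rewrite ler_wpM2r// ge_min lexx.
have A2 : `|h - c * k'| <= e * `|c|^2 / (4 * (`|d| + 1)) * `|k'|.
  by apply: le_trans A _; rewrite ler_wpM2r// ge_min lexx orbT.
have kh : `|k'| <= 2 * `|h| / `|c|.
  rewrite ler_pdivlMr//.
  have : `|c * k'| <= `|h - c * k'| + `|h|.
    by rewrite -[X in `|X| <= _](subKr h) (le_trans (ler_normB _ _))// addrC.
  by rewrite normrM; move: A1; clear; lra.
(* The error of [f \o g] at [k'] plus the error of [g] at [k'], since [g (k' + x) = h + g x]. *)
have -> : f (h + g x) - f (g x) - d / c * h =
   (f (h + g x) - f (g x) - d * k') - d / c * (h - c * k').
  by field.
apply: le_trans (ler_normB _ _) _.
have E1 : e * `|c| / 4 * `|k'| <= e * `|h| / 2.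
  have : e * `|c| / 4 * `|k'| <= e * `|c| / 4 * (2 * `|h| / `|c|).
    by rewrite ler_pM2l.
  have -> : e * `|c| / 4 * (2 * `|h| / `|c|) = e * `|h| / 2 by field; rewrite gt_eqF.
  by [].
have E2 : `|d / c * (h - c * k')| <= e * `|h| / 2.
  rewrite normrM normrM normfV.
  have : `|d| / `|c| * `|h - c * k'| <=
     (`|d| + 1) / `|c| * (e * `|c|^2 / (4 * (`|d| + 1)) * (2 * `|h| / `|c|)).
    apply: ler_pM => //.
    - by rewrite ler_pM2r ?invr_gt0// lerDl.
    - apply: le_trans A2 _; rewrite ler_pM2l// divr_gt0// ?mulr_gt0// exprn_gt0//.
  have -> : (`|d| + 1) / `|c| * (e * `|c| ^+ 2 / (4 * (`|d| + 1)) * (2 * `|h| / `|c|)) =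
   e * `|h| / 2 by field; rewrite !gt_eqF.
  by [].
move: B E1 E2; clear; lra.
Qed.

End RealDerivative.

(** * Kinks of convex functions *)

Section ConvexFunction.
Context {R : realType}.
Variable phi : R -> R.
Hypothesis phi_convex :
  convex_function (setT : set (convex_lmodType R^o)) phi.

(** Convexity with denominators cleared: [y] has the barycentric weights [(z - y) / (z - x)] and
    [(y - x) / (z - x)]. *)
Lemma convex_chord x y z : x < y -> y < z ->
  (z - x) * phi y <= (z - y) * phi x + (y - x) * phi z.
Proof.
move=> xy yz; have zx : 0 < z - x by lra.
have t0 : 0 <= (z - y) / (z - x) by rewrite divr_ge0//; lra.
have t1 : (z - y) / (z - x) <= 1 by rewrite ler_pdivrMr//; lra.
have := phi_convex (Itv01 t0 t1) x z (in_setT _) (in_setT _).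
rewrite convRE/= [X in phi X](_ : _ = (z - y) / (z - x) * x +
  (1 - (z - y) / (z - x)) * z)// [X in phi X](_ : _ = y); last first.
  by field; rewrite gt_eqF.
rewrite [unstable.onem _](_ : _ = 1 - (z - y) / (z - x))//.
rewrite -(ler_pM2l zx); congr (_ <= _).
by field; rewrite gt_eqF.
Qed.

Definition slope s y := (phi y - phi s) / (y - s).

Lemma slope_le s x y : x <= y -> x != s -> y != s -> slope s x <= slope s y.
Proof.
rewrite le_eqVlt => /predU1P[->//|xy]; rewrite /slope.
case: (ltgtP x s) => // xs _; case: (ltgtP y s) => // ys _.
- have sx : 0 < s - x by lra.
  have sy : 0 < s - y by lra.
  rewrite -[x - s]opprB -[y - s]opprB !invrN !mulrN lerN2.
  rewrite ler_pdivrMr// mulrAC ler_pdivlMr//.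
  by have := convex_chord x y s xy ys; lra.
- have sx : 0 < s - x by lra.
  have sy : 0 < y - s by lra.
  rewrite -[x - s]opprB invrN mulrN -mulNr.
  rewrite ler_pdivrMr// mulrAC ler_pdivlMr//.
  by have := convex_chord x s y xs ys; lra.
- by lra.
- have sx : 0 < x - s by lra.
  have sy : 0 < y - s by lra.
  rewrite ler_pdivrMr// mulrAC ler_pdivlMr//.
  by have := convex_chord s x y xs xy; lra.
Qed.

(** The slopes to the left of [s] lie below those to the right. If their supremum and infimum
    agreed, the common value would be the derivative; so there is a gap, and a line through
    [(s, phi s)] whose slope is a rational in the gap touches the graph only there. *)
Lemma kink_strict_subgradient s : ~ derivable phi s 1 ->
  exists c : rat, forall y, y != s -> phi s + ratr c * (y - s) < phi y.
Proof.
move=> nd.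
pose A := [set slope s y | y in [set y | y < s]].
pose B := [set slope s y | y in [set y | s < y]].
have A0 : A !=set0 by exists (slope s (s - 1)), (s - 1) => //=; lra.
have B0 : B !=set0 by exists (slope s (s + 1)), (s + 1) => //=; lra.
have AB : forall a b, A a -> B b -> a <= b.
  move=> _ _ [x /= xs <-] [y /= ys <-]; apply: slope_le.
  - lra.
  - by rewrite lt_eqF.
  - by rewrite gt_eqF.
have hA : has_sup A.
  by split => //; case: B0 => b Bb; exists b => a Aa; exact: AB.
have hB : has_inf B.
  by split => //; case: A0 => a Aa; exists a => b Bb; exact: AB.
have le_m : sup A <= inf B.
  apply: lb_le_inf => // b Bb; apply: ge_sup => // a Aa; exact: AB.
move: le_m; rewrite le_eqVlt => /predU1P[E|lt_m].
  exfalso; apply: nd.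
  suff /is_derive_epsP : (forall e : R, 0 < e -> exists2 d : R, 0 < d &
     forall h : R, `|h| < d -> `|phi (h + s) - phi s - sup A * h| <= e * `|h|).
    by case.
  move=> e e0.
  have [_ [y1 /= y1s <-] H1] := inf_adherent e0 hB.
  have [_ [y0 /= y0s <-] H0] := sup_adherent e0 hA.
  exists (Num.min (y1 - s) (s - y0)); first by rewrite lt_min; apply/andP; split; lra.
  move=> h; rewrite lt_min => /andP[h1 h0].
  have [->|hn0] := eqVneq h 0.
    by rewrite add0r subrr mulr0 subr0 normr0 mulr0.
  have -> : phi (h + s) - phi s - sup A * h = (slope s (h + s) - sup A) * h.
    by rewrite /slope addrK; field.
  rewrite normrM ler_wpM2r// ler_distlC.
  have hs : h + s != s by rewrite -subr_eq0 addrK.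
  move: h1 h0; case: (ltgtP h 0) hn0 => // hp _.
  - rewrite ltr0_norm// => h1 h0.
    have : slope s y0 <= slope s (h + s).
      by apply: slope_le => //; [lra | rewrite lt_eqF].
    have : slope s (h + s) <= sup A by apply: ub_le_sup; [exact: hA.2|exists (h + s) => //=; lra].
    by move=> ? ?; apply/andP; split; lra.
  - rewrite gtr0_norm// => h1 h0.
    have : slope s (h + s) <= slope s y1.
      by apply: slope_le => //; [lra | rewrite gt_eqF].
    have : inf B <= slope s (h + s) by apply: ge_inf; [exact: hB.2|exists (h + s) => //=; lra].
    by move=> ? ?; apply/andP; split; lra.
have [c] := rat_in_itvoo lt_m.
rewrite in_itv/= => /andP[c1 c2]; exists c => y ys.
have -> : phi y = phi s + slope s y * (y - s).
  by rewrite /slope divfK ?subr_eq0// addrC subrK.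
rewrite ltrD2l; move: ys; case: (ltgtP y s) => // ys _.
  rewrite ltr_nM2r ?subr_lt0//; apply: le_lt_trans c1.
  by apply: ub_le_sup; [exact: hA.2|exists y].
rewrite ltr_pM2r ?subr_gt0//; apply: lt_le_trans c2 _.
by apply: ge_inf; [exact: hB.2|exists y].
Qed.

(* A slope of strict support determines the point of support. *)
Lemma countable_kinks : countable [set s | ~ derivable phi s 1].
Proof.
have /choice[c Hc] : forall s, exists c : rat, ~ derivable phi s 1 ->
    forall y, y != s -> phi s + ratr c * (y - s) < phi y.
  move=> s; have [d|nd] := pselect (derivable phi s 1); first by exists 0.
  by have [c ?] := kink_strict_subgradient s nd; exists c.
apply/countable_injP; exists (pickle \o c) => s s'; rewrite !inE/= => Ds Ds'.
move=> /(pcan_inj pickleK) cs; apply/eqP/negP => /negP ss'.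
have := Hc s Ds s'; rewrite eq_sym => /(_ ss').
have := Hc s' Ds' s ss'; rewrite cs -opprB mulrN; move: (_ * _) => u.
by clear; lra.
Qed.

End ConvexFunction.

(** * Differentiation rules for real functions of one variable *)

Section DeriveRules.
Context {R : realType}.
Implicit Types (f g : R -> R) (x a b : R).

(** These rules are stated for explicit abstractions and with products in place of scalings, so that
    they compose as terms and the resulting values are closed by [ring] or [field]. *)
Lemma derD f g x a b : is_derive x 1 f a -> is_derive x 1 g b ->
  is_derive x 1 (fun y : R => f y + g y) (a + b).
Proof. exact: is_deriveD. Qed.

Lemma derB f g x a b : is_derive x 1 f a -> is_derive x 1 g b ->
  is_derive x 1 (fun y : R => f y - g y) (a - b).
Proof. exact: is_deriveB. Qed.

Lemma derM f g x a b : is_derive x 1 f a -> is_derive x 1 g b ->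
  is_derive x 1 (fun y : R => f y * g y) (a * g x + f x * b).
Proof.
move=> df dg; apply: is_derive_eq (is_deriveM df dg) _.
by rewrite /GRing.scale/= addrC (mulrC (g x)).
Qed.

Lemma der_cst x a : is_derive x 1 (fun _ : R => a) 0.
Proof. exact: is_derive_cst. Qed.

Lemma der_id x : is_derive x 1 (fun y : R => y) 1.
Proof. exact: is_derive_id. Qed.

Lemma der_comp f g x a b : is_derive (g x) 1 f a -> is_derive x 1 g b ->
  is_derive x 1 (fun y : R => f (g y)) (a * b).
Proof.
move=> df dg; apply: is_derive_eq (is_derive1_comp df dg) _.
by rewrite /GRing.scale/= mulrC.
Qed.

Lemma der_sqr f x a : is_derive x 1 f a ->
  is_derive x 1 (fun y : R => f y ^+ 2) (2 * f x * a).
Proof.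
move=> df; have := derM _ _ _ _ _ df df.
by rewrite (_ : a * f x + f x * a = 2 * f x * a)//; ring.
Qed.

Lemma is_derive_continuous f x a : is_derive x 1 f a -> {for x, continuous f}.
Proof. by move=> [df _]; exact/differentiable_continuous/derivable1_diffP. Qed.

End DeriveRules.

(** * Primitives on the whole line *)

Section Primitive.
Context {R : realType}.
Implicit Types (f F : R -> R).

Lemma is_derive_local f g (x l d : R) : 0 < d ->
  (forall y, `|y - x| < d -> f y = g y) -> is_derive x 1 g l -> is_derive x 1 f l.
Proof.
move=> d0 fg /is_derive_epsP H; apply/is_derive_epsP => e /H[d' d'0 Hd'].
exists (Num.min d d'); first by rewrite lt_min d0.
move=> h; rewrite lt_min => /andP[hd hd'].
by rewrite !fg ?addrK ?subrr ?normr0//; exact: Hd'.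
Qed.

Lemma continuous_integrable_itv f (a b : R) : continuous f ->
  lebesgue_measure.-integrable `[a, b] (EFin \o f).
Proof.
move=> cf; apply: continuous_compact_integrable; first exact: segment_compact.
exact: continuous_subspaceT.
Qed.

(** The fundamental theorem works from a base point to the left of the argument. The base point
    [- (|x| + 1)] moves with [x]; subtracting the value at 0 makes the result independent of it. *)
Lemma continuous_primitive f : continuous f ->
  exists F, forall x : R, is_derive x 1 F (f x).
Proof.
move=> cf.
pose I a x := \int[lebesgue_measure]_(t in `[- a, x]) f t.
have indep a b x : b <= a -> - b <= x -> - b <= 0 ->
    I a x - I a 0 = I b x - I b 0.
  move=> ab bx b0.
  have E y : - b <= y -> I a y = I a (- b) + I b y.
    move=> bty; have := @Rintegral_itvB R f (BLeft (- a)) (BRight y) (- b).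
    rewrite /I; move=> /(_ (continuous_integrable_itv _ _ _ cf)).
    rewrite !bnd_simp lerN2 => /(_ ab bty).
    rewrite Rintegral_itv_obnd_cbnd; last first.
      apply: integrableS (continuous_integrable_itv _ (- b) y cf) => //.
      exact: subset_itv_oc_cc.
    by move=> <-; rewrite addrC subrK.
  by rewrite E// (E 0)// opprD addrACA subrr add0r.
pose F (x : R) : R := I (`|x| + 1) x - I (`|x| + 1) 0.
exists F => x.
(* If [|y - x| < 1], then [|y| + 1 <= |x| + 2], so one base point serves a whole neighbourhood of
   [x]. *)
apply: (@is_derive_local _ (fun y : R => I (`|x| + 2) y - I (`|x| + 2) 0) x (f x) 1) => //.
  move=> y yx; symmetry; apply: indep.
  - have : `|y| <= `|x| + `|y - x|.
      by rewrite -[X in `|X| <= _](subrK x) addrC (le_trans (ler_normD _ _))// addrC.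
    by lra.
  - by have := lerNnormlW (lexx `|y|); lra.
  - by have := normr_ge0 y; lra.
have xa := lerNnormlW (lexx `|x|).
have [||||dF F'] := @continuous_FTC1 R f (BLeft (- (`|x| + 2))) x (x + 1).
- by rewrite ltrDl.
- exact: continuous_integrable_itv.
- by rewrite /= lte_fin; lra.
- exact: cf.
have HF : is_derive x 1 (I (`|x| + 2)) (f x).
  by split; [exact: dF|rewrite -derive1E].
have := is_deriveB HF (is_derive_cst (I (`|x| + 2) 0) x 1).
by rewrite subr0.
Qed.

End Primitive.

(** * Second differences and their limits *)

Section SecondDifference.
Context {R : realType}.
Implicit Types (f F : R -> R).

Definition second_diff F (h s : R) : R := F (s + h) - 2 * F s + F (s - h).

Lemma is_derive_second_diff F f (h s : R) : (forall x : R, is_derive x 1 F (f x)) ->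
  is_derive s 1 (second_diff F h) (second_diff f h s).
Proof.
move=> dF; rewrite /second_diff.
have shift (k : R) : is_derive s 1 (fun x : R => F (x + k)) (f (s + k)).
  have := der_comp _ (fun x => x + k) _ _ _ (dF (s + k)) (derD _ _ _ _ _ (der_id s) (der_cst s k)).
  by rewrite addr0 mulr1.
apply: derD (shift (- h)); apply: derB (shift h) _.
Qed.

(* The function [a |-> F (s + a) - 2 F s + F (s - a) - c a^2] vanishes at 0 and
   its derivative is the symmetric difference of [f], corrected by [2 c a]. *)
Lemma second_diff_approx F f (s c h e : R) : (forall x : R, is_derive x 1 F (f x)) ->
  0 < h ->
  (forall a : R, 0 < a < h -> `|f (s + a) - f (s - a) - 2 * c * a| <= e * a) ->
  0 <= e ->
  `|second_diff F h s / h ^+ 2 - c| <= e.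
Proof.
move=> dF h0 H e0.
pose G (a : R) : R := F (s + a) + F (s - a) - c * a ^+ 2.
have dG (a : R) : is_derive a 1 G (f (s + a) - f (s - a) - 2 * c * a).
  have A : is_derive a 1 (fun a : R => F (s + a)) (f (s + a)).
    have := der_comp _ (fun x => s + x) _ _ _ (dF (s + a)) (derD _ _ _ _ _ (der_cst a s) (der_id a)).
    by rewrite add0r mulr1.
  have B : is_derive a 1 (fun a : R => F (s - a)) (- f (s - a)).
    have := der_comp _ (fun x => s - x) _ _ _ (dF (s - a)) (derB _ _ _ _ _ (der_cst a s) (der_id a)).
    by rewrite sub0r mulrN1.
  have C : is_derive a 1 (fun a : R => c * a ^+ 2) (2 * c * a).
    have := derM _ _ _ _ _ (der_cst a c) (der_sqr _ _ _ (der_id a)).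
    by rewrite mul0r add0r mulr1 mulrCA mulrA.
  apply: derB C; exact: derD.
have [a /[!in_itv]/= a0h E] := MVT h0 (fun x _ => dG x)
   (continuous_subspaceT (fun x => is_derive_continuous _ _ _ (dG x))).
have -> : second_diff F h s / h ^+ 2 - c = (G h - G 0) / h ^+ 2.
  by rewrite /G /second_diff addr0 subr0; field; rewrite gt_eqF.
have h20 : 0 < h ^+ 2 by rewrite exprn_gt0.
rewrite E subr0 normrM normfV normrM (gtr0_norm h0) (gtr0_norm h20) ler_pdivrMr//.
have /andP[a0 ah] := a0h; rewrite expr2 mulrA ler_pM2r//.
by rewrite (le_trans (H _ a0h))// ler_wpM2l// ltW.
Qed.

End SecondDifference.

Section SecondDifferenceLimit.
Context {R : realType}.

Lemma cvg_at_right0P (F : R -> R) (c : R) :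
  F h @[h --> 0^'+] --> c <->
  (forall e : R, 0 < e -> exists2 d : R, 0 < d &
     forall h : R, 0 < h < d -> `|F h - c| <= e).
Proof.
split => [/cvgrPdist_le H e e0|H].
  have := H e e0; rewrite near_withinE => /nbhs_ballP[d /= d0 Hd].
  exists d => // h /andP[h0 hd]; rewrite distrC; apply: Hd => //=.
  by rewrite /ball/= sub0r normrN gtr0_norm.
apply/cvgrPdist_le => e e0; rewrite near_withinE.
have [d d0 Hd] := H e e0; apply/nbhs_ballP; exists d => //= h.
rewrite /ball/= sub0r normrN => hd h0; rewrite distrC; apply: Hd.
by rewrite h0/= (le_lt_trans (ler_norm h)).
Qed.

Lemma cvg_at_right0_seq (F : R -> R) (c : R) :
  F h @[h --> 0^'+] --> c -> F n.+1%:R^-1 @[n --> \oo] --> c.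
Proof.
move=> /cvg_at_rightP; apply; split; first by move=> n; rewrite invr_gt0.
exact: cvg_harmonic.
Qed.

(** Differentiability of [f] at the single point [s] controls the symmetric difference: errors [e/2]
    at [a] and at [- a] add up to the [e a] of [second_diff_approx]. *)
Lemma cvg_second_diff (F f : R -> R) (s c : R) :
  (forall x : R, is_derive x 1 F (f x)) -> is_derive s 1 f c ->
  second_diff F h s / h ^+ 2 @[h --> 0^'+] --> c.
Proof.
move=> dF /is_derive_epsP df; apply/cvg_at_right0P => e e0.
have e20 : 0 < e / 2 by rewrite divr_gt0.
have [d d0 Hd] := df _ e20; exists d => // h /andP[h0 hd].
apply: second_diff_approx dF h0 _ (ltW e0) => a /andP[a0 ah].
have A : `|a| < d by rewrite gtr0_norm// (lt_trans ah).
have B : `|- a| < d by rewrite normrN.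
have := Hd _ A; have := Hd _ B; rewrite normrN (gtr0_norm a0) (addrC a) (addrC (- a)).
rewrite !ler_norml => /andP[? ?] /andP[? ?].
by apply/andP; split; lra.
Qed.

Lemma second_diff_le (F f : R -> R) (s l h : R) :
  (forall x : R, is_derive x 1 F (f x)) -> 0 < h -> 0 <= l ->
  (forall a : R, 0 < a < h -> `|f (s + a) - f (s - a)| <= l * a) ->
  `|second_diff F h s / h ^+ 2| <= l.
Proof.
move=> dF h0 l0 H; rewrite -[X in `|X|]subr0.
apply: (second_diff_approx F f) => // a ah.
by rewrite mulr0 mul0r subr0 H.
Qed.

Lemma second_diff_affine (F : R -> R) (s h c : R) : 0 < h ->
  (forall y : R, s - h <= y <= s + h -> is_derive y 1 F c) ->
  second_diff F h s = 0.
Proof.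
move=> h0 dF.
have H a b : s - h <= a -> a <= b -> b <= s + h -> F b - F a = c * (b - a).
  move=> sa ab bs; have [||y _] := @MVT_segment R F (cst c) a b ab.
  - by move=> y; rewrite in_itv/= => /andP[? ?]; apply: dF; apply/andP; split; lra.
  - apply: continuous_in_subspaceT => y; rewrite inE/= in_itv/= => /andP[? ?].
    by apply: is_derive_continuous; apply: dF; apply/andP; split; lra.
  - by [].
have A : F s - F (s - h) = c * (s - (s - h)) by apply: H; lra.
have B : F (s + h) - F s = c * (s + h - s) by apply: H; lra.
by rewrite /second_diff; lra.
Qed.

End SecondDifferenceLimit.

(** * Regularized half squares of truncations *)

Section Truncation.
Context {R : realType}.
Variables (phi : R -> R) (L : R).
Hypotheses (L_gt0 : 0 < L) (phi_lip : forall x y : R, `|phi x - phi y| <= L * `|x - y|)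
  (phi0 : phi 0 = 0).
Implicit Types (h s d x y : R).

Lemma truncation_le s : `|phi s| <= L * `|s|.
Proof. by have := phi_lip s 0; rewrite phi0 !subr0. Qed.

Lemma truncation_continuous : continuous phi.
Proof.
move=> s; apply/cvgrPdist_le => e e0; apply/nbhs_ballP.
exists (e / L) => /=; first by rewrite divr_gt0.
move=> y; rewrite /ball/= => /ltW; rewrite ler_pdivlMr// mulrC.
exact: le_trans.
Qed.

Lemma truncation_derive_le s d : is_derive s 1 phi d -> `|d| <= L.
Proof.
move=> /is_derive_epsP H; apply/ler_addgt0Pr => e e0.
have [r r0 Hr] := H _ e0.
have r2 : 0 < r / 2 by rewrite divr_gt0.
have /Hr : `|r / 2| < r by rewrite gtr0_norm//; lra.
have := phi_lip (r / 2 + s) s; rewrite addrK => A B.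
rewrite -(ler_pM2r (_ : 0 < `|r / 2|)); last by rewrite normr_gt0 gt_eqF.
rewrite -normrM mulrDl.
have -> : d * (r / 2) = (phi (r / 2 + s) - phi s) -
   (phi (r / 2 + s) - phi s - d * (r / 2)) by ring.
by rewrite (le_trans (ler_normB _ _))// lerD.
Qed.

(** [phi'] is the pointwise limit of difference quotients multiplied by the indicator of the
    complement of a countable set; at the kinks this limit is 0, the default value of [derive1]. *)
Lemma measurable_derive_truncation :
  countable [set s | ~ derivable phi s 1] -> measurable_fun setT (derive1 phi).
Proof.
move=> cD; have mD : measurable [set s : R | ~ derivable phi s 1].
  by apply: countable_measurable.
have mphi : measurable_fun setT phi.
  by apply: continuous_measurable_fun; exact: truncation_continuous.
pose q (n : nat) (s : R) : R := \1_(~` [set s | ~ derivable phi s 1]) s *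
   ((phi (n.+1%:R^-1 + s) - phi s) / n.+1%:R^-1).
apply: (@measurable_fun_cvg _ _ _ setT q) => //.
- move=> n; apply: measurable_funM.
    by apply: measurable_indic; exact: measurableC.
  apply: measurable_funM => //.
  apply: measurable_funB => //; apply: measurableT_comp => //.
  exact: measurable_funD.
- move=> s _; have [d|nd] := pselect (derivable phi s 1); last first.
    rewrite derive1_nderivable//; under eq_fun do rewrite /q indicE memNset ?mul0r//=.
    exact: cvg_cst.
  have H : is_derive s 1 phi (derive1 phi s) by split => //; rewrite -derive1E.
  under eq_fun do rewrite /q indicE mem_set ?mul1r//=.
  apply: (@cvg_at_right0_seq _ (fun h => (phi (h + s) - phi s) / h)).
  apply/cvg_at_right0P => e e0; have [r r0 Hr] := (iffLR (is_derive_epsP _ _ _) H) e e0.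
  exists r => // h /andP[h0 hr].
  have := Hr h; rewrite gtr0_norm// => /(_ hr).
  rewrite -[X in _ -> `|X| <= _](mulfK (lt0r_neq0 h0)) mulrBl divfK ?gt_eqF//.
  by rewrite normrM normfV (gtr0_norm h0) ler_pdivrMr.
Qed.

Definition half_sqr (s : R) : R := phi s ^+ 2 / 2.

Definition diff_quot (h s : R) : R := (phi (s + h) - phi s) / h.

(** [diff_quot h (s - h)] is the backward quotient at [s]; the mean of both squares is what makes
    the discrete product rule exact. *)
Definition quot_part (h s : R) : R := (diff_quot h s ^+ 2 + diff_quot h (s - h) ^+ 2) / 2.

Definition kink_part (h s : R) : R := phi s * (second_diff phi h s / h ^+ 2).

(* Discrete form of [(phi^2 / 2)'' = phi'^2 + phi phi'']. *)
Lemma second_diff_half_sqr h s : h != 0 ->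
  second_diff half_sqr h s / h ^+ 2 = quot_part h s + kink_part h s.
Proof.
move=> h0; rewrite /quot_part /kink_part /diff_quot /second_diff /half_sqr subrK.
by field.
Qed.

Lemma diff_quot_le h s : h != 0 -> `|diff_quot h s| <= L.
Proof.
move=> h0; rewrite /diff_quot normrM normfV ler_pdivrMr ?normr_gt0//.
by have := phi_lip (s + h) s; rewrite (addrC s) addrK.
Qed.

Lemma quot_part_ge0 h s : 0 <= quot_part h s.
Proof. by rewrite /quot_part divr_ge0// addr_ge0 ?sqr_ge0. Qed.

Lemma quot_part_le h s : h != 0 -> quot_part h s <= L ^+ 2.
Proof.
move=> h0; have A x : diff_quot h x ^+ 2 <= L ^+ 2.
  by rewrite -real_normK ?num_real// lerXn2r ?nnegrE ?(ltW L_gt0)// diff_quot_le.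
by have := A s; have := A (s - h); rewrite /quot_part; lra.
Qed.

Lemma cvg_diff_quot s d : is_derive s 1 phi d ->
  diff_quot h s @[h --> 0^'+] --> d /\ diff_quot h (s - h) @[h --> 0^'+] --> d.
Proof.
move=> /is_derive_epsP H.
(* The sign [u] treats the forward and the backward quotient at once. *)
suff A (u : R) : `|u| = 1 -> (phi (u * h + s) - phi s) / (u * h) @[h --> 0^'+] --> d.
  split.
    rewrite (_ : (fun h => _) = fun h => (phi (1 * h + s) - phi s) / (1 * h)).
      exact: A (normr1 _).
    by apply/funext => h; rewrite /diff_quot mul1r (addrC s).
  rewrite (_ : (fun h => _) = fun h => (phi (-1 * h + s) - phi s) / (-1 * h)).
    exact: A (normrN1 _).
  apply/funext => h; rewrite /diff_quot mulN1r subrK (addrC (- h)).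
  by rewrite invrN mulrN -mulNr opprB.
move=> u1; apply/cvg_at_right0P => e e0; have [r r0 Hr] := H e e0.
exists r => // h /andP[h0 hr].
have uh : `|u * h| = h by rewrite normrM u1 mul1r gtr0_norm.
have uh0 : u * h != 0 by rewrite -normr_eq0 uh gt_eqF.
have := Hr (u * h); rewrite uh => /(_ hr).
rewrite -[X in _ -> `|X| <= _](mulfK uh0) mulrBl divfK//.
by rewrite normrM normfV uh ler_pdivrMr.
Qed.

Lemma cvg_quot_part s d : is_derive s 1 phi d ->
  quot_part h s @[h --> 0^'+] --> d ^+ 2.
Proof.
move=> /cvg_diff_quot[A B].
have := cvgM (cvgD (cvgM A A) (cvgM B B)) (cvg_cst (2^-1 : R)).
rewrite (_ : (d * d + d * d) * 2^-1 = d ^+ 2); last by field.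
exact.
Qed.

Hypothesis phi_convex : convex_function (setT : set (convex_lmodType R^o)) phi.

Lemma second_diff_convex_ge0 h s : 0 < h -> 0 <= second_diff phi h s.
Proof.
move=> h0; have := convex_chord phi phi_convex (s - h) s (s + h).
have -> : s - h < s by lra.
have -> : s < s + h by lra.
move=> /(_ isT isT) H; rewrite -(ler_pM2l h0) /second_diff; lra.
Qed.

Lemma kink_part_ge0 h s : 0 < h -> (forall x, 0 <= phi x) -> 0 <= kink_part h s.
Proof.
move=> h0 p0; rewrite /kink_part mulr_ge0// divr_ge0 ?sqr_ge0//.
exact: second_diff_convex_ge0.
Qed.

(** The affine pieces near different points could a priori have different slopes. But [derive1 phi]
    is locally constant on the interval, so it has derivative 0 there and is constant by the mean
    value theorem. *)
Lemma affine_second_diff0 h s : affine_where_active phi -> 0 < h ->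
  (forall y : R, `|y - s| <= h -> phi y != 0) -> second_diff phi h s = 0.
Proof.
move=> aff h0 act.
have loc y : phi y != 0 -> exists c : R, exists2 r : R, 0 < r &
    forall x, `|x - y| < r -> is_derive x 1 phi c.
  move=> /aff[c /nbhs_ballP[r /= r0 Hr]]; exists c, r => // x xy.
  apply: (@is_derive_local _ _ (fun z => phi y + c * (z - y)) x c (r - `|x - y|)).
  - by rewrite subr_gt0.
  - move=> z zx; apply: Hr; rewrite /ball/= distrC.
    have : `|z - y| <= `|z - x| + `|x - y| by exact: ler_distD.
    by lra.
  - have := derD _ _ _ _ _ (der_cst x (phi y))
      (derM _ _ _ _ _ (der_cst x c) (derB _ _ _ _ _ (der_id x) (der_cst x y))).
    by rewrite mul0r add0r subr0 mulr1 add0r.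
have dphi (y : R) : `|y - s| <= h -> is_derive y 1 phi (derive1 phi y) /\
    is_derive y 1 (derive1 phi) 0.
  move=> /act/loc[c [r r0 H]]; split.
    have := H y; rewrite subrr normr0 => /(_ r0) [d dE].
    by split => //; rewrite derive1E.
  apply: (@is_derive_local _ _ (fun=> c) y 0 r) => // x xy.
  by have [_ <-] := H _ xy; rewrite derive1E.
apply: (@second_diff_affine _ _ _ _ (derive1 phi s)) => // y ysh.
have ys : `|y - s| <= h by rewrite ler_distlC; apply/andP; split; lra.
have [dy _] := dphi y ys.
suff -> : derive1 phi s = derive1 phi y by [].
have [ys'|ys'] := leP y s.
  have [||z _] := @MVT_segment R (derive1 phi) (cst 0) y s ys'.
  - move=> x; rewrite in_itv/= => /andP[A B]; apply: (dphi x _).2.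
    by rewrite ler_distlC; apply/andP; split; lra.
  - apply: continuous_in_subspaceT => x; rewrite inE/= in_itv/= => /andP[A B].
    apply: is_derive_continuous; apply: (dphi x _).2.
    by rewrite ler_distlC; apply/andP; split; lra.
  by rewrite mul0r => /eqP; rewrite subr_eq0 => /eqP.
have [||z _] := @MVT_segment R (derive1 phi) (cst 0) s y (ltW ys').
- move=> x; rewrite in_itv/= => /andP[A B]; apply: (dphi x _).2.
  by rewrite ler_distlC; apply/andP; split; lra.
- apply: continuous_in_subspaceT => x; rewrite inE/= in_itv/= => /andP[A B].
  apply: is_derive_continuous; apply: (dphi x _).2.
  by rewrite ler_distlC; apply/andP; split; lra.
by rewrite mul0r => /eqP; rewrite subr_eq0 => /eqP.
Qed.

Lemma second_diff_lip h s : 0 < h -> `|second_diff phi h s| <= 2 * L * h.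
Proof.
move=> h0; have A := phi_lip (s + h) s; have B := phi_lip (s - h) s.
move: A B; rewrite addrAC subrr add0r addrAC subrr add0r normrN (gtr0_norm h0).
rewrite /second_diff !ler_norml => /andP[? ?] /andP[? ?].
by apply/andP; split; lra.
Qed.

(** If [|phi s| <= L h], one factor [h] comes from [phi s] and the other from the second difference,
    which is at most [2 L h]. Otherwise [phi] has no zero within distance [h] of [s], and the second
    difference is 0. *)
Lemma kink_part_le h s : affine_where_active phi -> 0 < h ->
  `|kink_part h s| <= 2 * L ^+ 2.
Proof.
move=> aff h0; have [H|H] := leP `|phi s| (L * h).
  rewrite /kink_part normrM normrM normfV (gtr0_norm (exprn_gt0 2 h0)).
  rewrite mulrA ler_pdivrMr ?exprn_gt0//.
  rewrite (_ : 2 * L ^+ 2 * h ^+ 2 = (L * h) * (2 * L * h)); last by ring.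
  by apply: ler_pM => //; exact: second_diff_lip.
rewrite /kink_part affine_second_diff0//.
  by rewrite mul0r mulr0 normr0 mulr_ge0// sqr_ge0.
move=> y ys; apply/eqP => py; have := phi_lip y s; rewrite py sub0r normrN.
have : L * `|y - s| <= L * h by rewrite ler_pM2l.
lra.
Qed.

Lemma cvg_kink_part s : affine_where_active phi ->
  kink_part h s @[h --> 0^'+] --> 0.
Proof.
move=> aff; apply/cvg_at_right0P => e e0.
have [p0|p0] := eqVneq (phi s) 0.
  by exists 1 => // h _; rewrite /kink_part p0 mul0r subrr normr0 ltW.
have d0 : 0 < `|phi s| / L by rewrite divr_gt0// normr_gt0.
(* Below this threshold the Lipschitz bound keeps [phi] away from 0 within distance [h] of [s]. *)
exists (`|phi s| / L) => // h /andP[h0]; rewrite ltr_pdivlMr// mulrC => hd.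
rewrite /kink_part affine_second_diff0//; first by rewrite mul0r mulr0 subrr normr0 ltW.
move=> y ys; apply/eqP => py; have := phi_lip y s; rewrite py sub0r normrN.
have : L * `|y - s| <= L * h by rewrite ler_pM2l.
lra.
Qed.

Lemma half_sqr_continuous : continuous half_sqr.
Proof.
move=> s; rewrite /half_sqr; apply: cvgM; last exact: cvg_cst.
by apply: cvgM; exact: truncation_continuous.
Qed.

Lemma is_derive_half_sqr s d : is_derive s 1 phi d ->
  is_derive s 1 half_sqr (phi s * d).
Proof.
move=> dphi; have := derM _ _ _ _ _ (der_sqr _ _ _ dphi) (der_cst s (2^-1 : R)).
by rewrite mulr0 addr0 (_ : 2 * phi s * d * 2^-1 = phi s * d)//; field.
Qed.

(** This holds even if [phi] has a kink at 0, because [phi 0 = 0] makes the half square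
    quadratically small. *)
Lemma is_derive_half_sqr0 : is_derive (0 : R) 1 half_sqr 0.
Proof.
apply/is_derive_epsP => e e0; have L20 : 0 < L ^+ 2 by rewrite exprn_gt0.
exists (e / L ^+ 2); first by rewrite divr_gt0.
move=> h; rewrite ltr_pdivlMr// => hd.
rewrite /half_sqr addr0 phi0 expr0n/= mul0r mul0r !subr0.
have H : `|phi h| ^+ 2 <= (L * `|h|) ^+ 2.
  by rewrite lerXn2r ?nnegrE ?mulr_ge0 ?(ltW L_gt0)// truncation_le.
rewrite ger0_norm ?divr_ge0 ?sqr_ge0//.
have : `|h| * L ^+ 2 * `|h| <= e * `|h| by rewrite ler_wpM2r// ltW.
by move: H; rewrite real_normK ?num_real// exprMn; have := sqr_ge0 (phi h); lra.
Qed.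

Lemma half_sqr_lip M x y : `|x| <= M -> `|y| <= M ->
  `|half_sqr x - half_sqr y| <= L ^+ 2 * M * `|x - y|.
Proof.
move=> xM yM; rewrite /half_sqr.
have -> : phi x ^+ 2 / 2 - phi y ^+ 2 / 2 = (phi x + phi y) / 2 * (phi x - phi y).
  by field.
rewrite normrM (_ : L ^+ 2 * M * `|x - y| = L * M * (L * `|x - y|)); last by ring.
apply: ler_pM => //; rewrite normrM normfV normr_nat ler_pdivrMr//.
have A : L * `|x| <= L * M by rewrite ler_pM2l.
have B : L * `|y| <= L * M by rewrite ler_pM2l.
have := ler_normD (phi x) (phi y); have := truncation_le x; have := truncation_le y.
lra.
Qed.

Lemma le_of_derive_le (F f : R -> R) (C s : R) :
  (forall x, is_derive x 1 F (f x)) -> F 0 = 0 ->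
  (forall x, `|x| <= `|s| -> `|f x| <= C) -> `|F s| <= C * `|s|.
Proof.
move=> dF F0 fC.
have cF x y : {within `[x, y], continuous F}.
  by apply: continuous_subspaceT => z; apply: is_derive_continuous.
have [s0|s0] := leP 0 s.
  have [z] := MVT_segment s0 (fun x _ => dF x) (cF 0 s).
  rewrite in_itv/= => zs; rewrite F0 !subr0 => ->; rewrite normrM ler_wpM2r// fC//.
  by rewrite !ger0_norm//; lra.
have [z] := MVT_segment (ltW s0) (fun x _ => dF x) (cF s 0).
rewrite in_itv/= => zs; rewrite F0 !sub0r => /(congr1 Num.norm).
rewrite normrN normrM normrN => ->; rewrite ler_wpM2r// fC//.
by rewrite (ltr0_norm s0) ler0_norm; lra.
Qed.

(** [G h] is the second difference quotient of a second primitive of [half_sqr], minus its first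
    order Taylor polynomial at 0. This correction makes [G h] and [G1 h] vanish at 0, hence their
    compositions with the circulation on the axis; it disappears as [h] tends to 0. The bounds on
    [G] and [G1] are uniform in [h], as dominated convergence requires; those on the second
    derivative serve for one [h] at a time. *)
Lemma regularized_half_sqr M : 0 <= M -> exists G G1 : R -> R -> R,
  [/\ forall h s, is_derive s 1 (G h) (G1 h s),
      forall h s, is_derive s 1 (G1 h) (second_diff half_sqr h s / h ^+ 2)
    & forall h, G h 0 = 0 /\ G1 h 0 = 0] /\
  [/\ exists C, forall h s, 0 < h <= 1 -> `|s| <= M ->
        `|G1 h s| <= C /\ `|G h s| <= C * `|s|,
      forall h, 0 < h -> exists C, forall s, `|s| <= M ->
        `|second_diff half_sqr h s / h ^+ 2| <= C /\ `|G1 h s| <= C * `|s|,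
      forall s, G h s @[h --> 0^'+] --> half_sqr s
    & forall s d, is_derive s 1 phi d -> G1 h s @[h --> 0^'+] --> phi s * d].
Proof.
move=> M0.
have [P dP] := continuous_primitive _ half_sqr_continuous.
have [PP dPP] : exists PP, forall x, is_derive x 1 PP (P x).
  by apply: continuous_primitive => x; apply: is_derive_continuous.
pose G1 (h s : R) : R := (second_diff P h s - second_diff P h 0) / h ^+ 2.
pose G (h s : R) : R := (second_diff PP h s - second_diff PP h 0 -
   second_diff P h 0 * s) / h ^+ 2.
have dG h s : is_derive s 1 (G h) (G1 h s).
  have := derM _ _ _ _ _ (derB _ _ _ _ _ (derB _ _ _ _ _ (is_derive_second_diff PP P h s dPP)
    (der_cst s (second_diff PP h 0))) (derM _ _ _ _ _ (der_cst s (second_diff P h 0))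
    (der_id s))) (der_cst s (h ^+ 2)^-1).
  by rewrite mul0r add0r mulr1 mulr0 addr0 subr0.
have dG1 h s : is_derive s 1 (G1 h) (second_diff half_sqr h s / h ^+ 2).
  have := derM _ _ _ _ _ (derB _ _ _ _ _ (is_derive_second_diff P half_sqr h s dP)
    (der_cst s (second_diff P h 0))) (der_cst s (h ^+ 2)^-1).
  by rewrite mulr0 addr0 subr0.
have G0 h : G h 0 = 0 by rewrite /G subrr mulr0 subr0 mul0r.
have G10 h : G1 h 0 = 0 by rewrite /G1 subrr mul0r.
(* As [h <= 1], the points [s + a] and [s - a] stay in [[- (M + 1), M + 1]], where [half_sqr] has
   Lipschitz constant [L^2 (M + 1)]; their distance [2 a] gives the factor 2. *)
have bnd h s : 0 < h <= 1 -> `|s| <= M ->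
    `|second_diff P h s / h ^+ 2| <= 2 * (L ^+ 2 * (M + 1)).
  move=> /andP[h0 h1] sM; apply: (second_diff_le _ half_sqr) => //.
    by rewrite mulr_ge0// mulr_ge0 ?sqr_ge0//; lra.
  move=> a /andP[a0 ah].
  have A : `|s + a| <= M + 1.
    by rewrite (le_trans (ler_normD _ _))// (gtr0_norm a0); lra.
  have B : `|s - a| <= M + 1.
    by rewrite (le_trans (ler_normB _ _))// (gtr0_norm a0); lra.
  apply: le_trans (half_sqr_lip _ _ _ A B) _.
  have -> : s + a - (s - a) = 2 * a by ring.
  by rewrite normrM normr_nat (gtr0_norm a0) mulrCA mulrA.
have bndG1 h s : 0 < h <= 1 -> `|s| <= M -> `|G1 h s| <= 4 * (L ^+ 2 * (M + 1)).
  move=> hh sM; rewrite /G1 mulrBl (le_trans (ler_normB _ _))//.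
  have := bnd h s hh sM; have := bnd h 0 hh; rewrite normr0 => /(_ M0).
  lra.
exists G, G1; split; first by [].
split.
- exists (4 * (L ^+ 2 * (M + 1))) => h s hh sM; split; first exact: bndG1.
  apply: (le_of_derive_le _ (G1 h)) => // x xs; apply: bndG1 => //.
  exact: le_trans sM.
(* The first term bounds [quot_part]. In [kink_part] the factor [phi s] is at most [L M], and the
   second difference over [h^2] at most [2 L / h]. *)
- move=> h h0; exists (L ^+ 2 + L * M * (2 * L / h)) => s sM.
  have H x : `|x| <= M ->
      `|second_diff half_sqr h x / h ^+ 2| <= L ^+ 2 + L * M * (2 * L / h).
    move=> xM; rewrite second_diff_half_sqr ?gt_eqF//.
    rewrite (le_trans (ler_normD _ _))// lerD//.
      by rewrite ger0_norm ?quot_part_ge0// quot_part_le// gt_eqF.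
    rewrite /kink_part normrM; apply: ler_pM => //.
      by apply: le_trans (truncation_le _) _; rewrite ler_pM2l.
    rewrite normrM normfV (gtr0_norm (exprn_gt0 2 h0)) ler_pdivrMr ?exprn_gt0//.
    rewrite expr2 mulrA divfK ?gt_eqF//; exact: second_diff_lip.
  split; first exact: H.
  apply: (le_of_derive_le _ _ _ _ (dG1 h)) => // x xs; apply: H.
  exact: le_trans sM.
- move=> s.
  rewrite (_ : (fun h => G h s) = (fun h : R => second_diff PP h s / h ^+ 2 -
    second_diff PP h 0 / h ^+ 2 - second_diff P h 0 / h ^+ 2 * s)); last first.
    by apply/funext => h; rewrite /G !mulrBl; congr (_ - _); exact: mulrAC.
  (* The limit of the subtracted Taylor polynomial: [half_sqr] and its derivative both vanish at
     0. *)
  rewrite (_ : half_sqr s = half_sqr s - half_sqr 0 - 0 * s); last first.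
    by rewrite /half_sqr phi0 expr0n/= mul0r subr0 mul0r subr0.
  apply: cvgB.
    by apply: cvgB; apply: (cvg_second_diff _ P).
  apply: cvgM; last exact: cvg_cst.
  exact: (cvg_second_diff _ half_sqr _ _ _ is_derive_half_sqr0).
- move=> s d ds.
  rewrite (_ : (fun h => G1 h s) = (fun h : R => second_diff P h s / h ^+ 2 -
    second_diff P h 0 / h ^+ 2)); last first.
    by apply/funext => h; rewrite /G1 mulrBl.
  rewrite -[phi s * d]subr0; apply: cvgB.
    exact: (cvg_second_diff _ half_sqr _ _ _ (is_derive_half_sqr _ _ ds)).
  exact: (cvg_second_diff _ half_sqr _ _ _ is_derive_half_sqr0).
Qed.

End Truncation.

(** * The measure of the meridian half-plane *)

Section PlaneMeasure.
Context {R : realType}.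

Local Notation leb := (@lebesgue_measure R).
Local Notation leb2 := (leb \x leb)%E.

(** An open set is the union of the rational squares contained in it. Squares that are not contained
    in [U] are replaced by the empty set, so that the union runs over a countable type. *)
Lemma open_plane_measurable (U : set (R * R)) : open U -> measurable U.
Proof.
move=> oU.
pose box (q : rat * rat * rat) : set (R * R) :=
  (ball (ratr q.1.1 : R) (ratr q.2)) `*` (ball (ratr q.1.2 : R) (ratr q.2)).
have -> : U = \bigcup_(q in setT)
    (if pselect (box q `<=` U) then box q else set0).
  apply/seteqP; split => [[x y] Uxy|p [q _]]; last first.
    by case: pselect => // H; exact: H.
  have [e /= e0 He] : exists2 e : R, 0 < e & ball (x, y) e `<=` U.
    by apply/nbhs_ballP; exact: open_nbhs_nbhs.
  have e20 : 0 < e / 2 by rewrite divr_gt0.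
  have [d] := rat_in_itvoo e20.
  rewrite in_itv/= => /andP[d0 de].
  have xd : x - ratr d < x + ratr d by lra.
  have yd : y - ratr d < y + ratr d by lra.
  have [a] := rat_in_itvoo xd; have [b] := rat_in_itvoo yd.
  rewrite !in_itv/= => /andP[b1 b2] /andP[a1 a2].
  have ha : `|x - ratr a| < ratr d by rewrite ltr_distl; apply/andP; split; lra.
  have hb : `|y - ratr b| < ratr d by rewrite ltr_distl; apply/andP; split; lra.
  have sub : box (a, b, d) `<=` U.
    move=> [x' y'] [/= hx hy]; apply: He; split; rewrite /ball/=.
      have := ler_distD (ratr a) x x'; move: hx ha; rewrite /ball/=; lra.
    have := ler_distD (ratr b) y y'; move: hy hb; rewrite /ball/=; lra.
  exists (a, b, d) => //; case: pselect => [s|//].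
  by rewrite /box /ball/=; split; rewrite /= distrC.
apply: countable_bigcupT_measurable; first exact: countableP.
move=> q; case: pselect => [s|s]; last exact: measurable0.
exact: (measurableX (measurable_ball _ _) (measurable_ball _ _)).
Qed.

Lemma continuous_plane_measurable (f : R * R -> R) : continuous f ->
  measurable_fun setT f.
Proof.
move=> /continuousP cf; apply: (measurability _ (RGenOpens.measurableE R)).
move=> _ [_ [a [b ->] <-]]; rewrite setTI; apply: open_plane_measurable.
exact/cf/interval_open.
Qed.

Lemma measurable_half_plane : measurable (@half_plane R).
Proof.
rewrite (_ : half_plane = `]0, +oo[%classic `*` setT); first exact: measurableX.
by apply/seteqP; split => [y|y []] /=; rewrite in_itv/= andbT.
Qed.

Lemma negligible_xsections (A : set (R * R)) : measurable A ->
  (forall x : R, leb (xsection A x) = 0%E) -> leb2 A = 0%E.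
Proof.
move=> mA H; rewrite /product_measure1/=.
by rewrite integral0_eq// => x _; exact: H.
Qed.

(** The product measure is defined by sections at fixed [x]; its uniqueness identifies it with the
    one defined by the other sections. *)
Lemma negligible_ysections (A : set (R * R)) : measurable A ->
  (forall y : R, leb (ysection A y) = 0%E) -> leb2 A = 0%E.
Proof.
move=> mA H.
rewrite (@product_measure_unique _ _ _ _ _ _ _ (leb \x^ leb)%E)//; last first.
  by move=> B1 B2 mB1 mB2; exact: product_measure2E.
transitivity (\int[leb]_y leb (ysection A y))%E; first by [].
by rewrite integral0_eq// => x _; exact: H.
Qed.

Definition box (A : R) : set (R * R) := `[0, A] `*` `[- A, A].

Lemma measurable_box A : measurable (box A).
Proof. exact: measurableX. Qed.

Lemma box_lty A : (leb2 (box A) < +oo)%E.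
Proof.
rewrite product_measure1E//= !lebesgue_measure_itv/=.
by case: ifP => _; case: ifP => _; rewrite ?mule0 ?mul0e// -?EFinB -?EFinM ltry.
Qed.

(** The bound concerns [f / r], the density with respect to [dr dz], so that [C] times the indicator
    of the box is an integrable majorant, common to all functions sharing [A] and [C]. *)
Definition dominated (A C : R) (f : R -> R -> R) :=
  forall r z, 0 < r -> `|f r z / r| <= C /\ (f r z != 0 -> box A (r, z)).

Definition hp_measurable (f : R -> R -> R) :=
  measurable_fun (@half_plane R) (fun y => f y.1 y.2).

Lemma dominated_integrable_bound A C :
  leb2.-integrable (@half_plane R) (fun y => (C * \1_(box A) y)%:E).
Proof.
under eq_fun do rewrite EFinM.
apply: integrableZl; first exact: measurable_half_plane.
apply/integrableP; split.
  apply/measurable_EFinP; apply: measurable_indic; exact: measurable_box.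
under eq_integral do rewrite gee0_abs ?lee_fin//.
rewrite integral_indic; [|exact: measurable_half_plane|exact: measurable_box].
apply: le_lt_trans (box_lty A); apply: le_measure; rewrite ?inE.
- by apply: measurableI; [exact: measurable_box|exact: measurable_half_plane].
- exact: measurable_box.
- exact: subIsetl.
Qed.

Lemma dominated_le A C f (y : R * R) : half_plane y -> dominated A C f ->
  `|f y.1 y.2 / y.1| <= C * \1_(box A) y.
Proof.
move=> hy H; have [A1 A2] := H y.1 y.2 hy.
have [->|f0] := eqVneq (f y.1 y.2) 0.
  rewrite mul0r normr0 mulr_ge0// ?indicE ?ler0n//.
  by have [+ _] := H y.1 y.2 hy; exact: le_trans.
by rewrite indicE mem_set ?mulr1//; move/A2 : f0; case: (y).
Qed.

Lemma hp_measurable_div f : hp_measurable f ->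
  measurable_fun (@half_plane R) (fun y => f y.1 y.2 / y.1).
Proof.
move=> mf; apply: measurable_funM => //.
apply: (measurable_comp (F := [set r : R | 0 < r])) => //.
- by rewrite (_ : mkset _ = `]0, +oo[%classic)//; apply/seteqP; split => r/=; rewrite in_itv/= andbT.
- by move=> _ [y hy <-].
- apply: open_continuous_measurable_fun; first exact: open_gt.
  by move=> r /[!inE]/= r0; apply: inv_continuous; rewrite gt_eqF.
- exact: measurable_funTS measurable_fst.
Qed.

Lemma dominated_integrable A C f : hp_measurable f -> dominated A C f ->
  nuG_integrable f.
Proof.
move=> mf H; apply: le_integrable (dominated_integrable_bound A C).
- exact: measurable_half_plane.
- by apply/measurable_EFinP; exact: hp_measurable_div.
- move=> y hy; rewrite lee_fin [leRHS]ger0_norm; first exact: dominated_le.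
  exact: le_trans (dominated_le _ _ _ _ hy H).
Qed.

Lemma dominated_cvg A C (f_ : nat -> R -> R -> R) f (N : set (R * R)) :
  (forall n, hp_measurable (f_ n)) -> hp_measurable f ->
  (forall n, dominated A C (f_ n)) ->
  measurable N -> leb2 N = 0%E ->
  (forall r z, 0 < r -> ~ N (r, z) -> f_ n r z @[n --> \oo] --> f r z) ->
  nuG_integral (f_ n) @[n --> \oo] --> nuG_integral f.
Proof.
move=> mf_ mf df_ mN N0 cf.
have mE g : hp_measurable g ->
    measurable_fun (@half_plane R) (fun y : R * R => (g y.1 y.2 / y.1)%:E).
  by move=> mg; apply/measurable_EFinP; exact: hp_measurable_div.
have [|||||] := @dominated_convergence _ _ R leb2 _ measurable_half_plane
  (fun n (y : R * R) => (f_ n y.1 y.2 / y.1)%:E)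
  (fun y : R * R => (f y.1 y.2 / y.1)%:E)
  (fun y => (C * \1_(box A) y)%:E).
- by move=> n; exact: mE.
- exact: mE.
- exists N; split => // y /= Hy; apply: contrapT => Ny; apply: Hy => hy.
  apply: cvg_EFin; first exact: nearW.
  apply: cvgM; last exact: cvg_cst.
  by apply: cf => //; rewrite -surjective_pairing.
- exact: dominated_integrable_bound.
- by apply: nearW => y n hy; rewrite lee_fin; exact: dominated_le.
move=> intf _ H; apply: fine_cvg.
rewrite /nuG_integral /Rintegral fineK//; apply: integrable_fin_num intf.
exact: measurable_half_plane.
Qed.

Implicit Types (f g : R -> R -> R) (a : R).

Lemma nuG_integralD f g : nuG_integrable f -> nuG_integrable g ->
  nuG_integral (fun r z => f r z + g r z) = nuG_integral f + nuG_integral g.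
Proof.
move=> intf intg; rewrite /nuG_integral -RintegralD//; last exact: measurable_half_plane.
by apply: eq_Rintegral => y _; rewrite mulrDl.
Qed.

Lemma nuG_integralZ a f : nuG_integrable f ->
  nuG_integral (fun r z => a * f r z) = a * nuG_integral f.
Proof.
move=> intf; rewrite /nuG_integral -RintegralZl//; last exact: measurable_half_plane.
by apply: eq_Rintegral => y _; rewrite mulrA.
Qed.

Lemma nuG_integrableD f g : nuG_integrable f -> nuG_integrable g ->
  nuG_integrable (fun r z => f r z + g r z).
Proof.
move=> intf intg; have := @integrableD _ _ R leb2 _ measurable_half_plane _ _ intf intg.
apply: eq_integrable; first exact: measurable_half_plane.
by move=> y _ /=; rewrite -EFinD mulrDl.
Qed.

Lemma nuG_integrableZ a f : nuG_integrable f ->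
  nuG_integrable (fun r z => a * f r z).
Proof.
move=> intf; have := (@integrableZl _ _ R leb2) _ measurable_half_plane a _ intf.
apply: eq_integrable; first exact: measurable_half_plane.
by move=> y _ /=; rewrite -EFinM mulrA.
Qed.

Lemma nuG_integral_ge0 f : (forall r z, 0 < r -> 0 <= f r z) ->
  0 <= nuG_integral f.
Proof.
move=> f0; apply: Rintegral_ge0 => y hy.
by rewrite divr_ge0 ?f0//; exact: ltW.
Qed.

Lemma eq_nuG_integral f g : (forall r z, 0 < r -> f r z = g r z) ->
  nuG_integral f = nuG_integral g.
Proof. by move=> fg; apply: eq_Rintegral => y /[!inE] hy; rewrite fg. Qed.

Lemma eq_nuG_integrable f g : (forall r z, 0 < r -> f r z = g r z) ->
  nuG_integrable f -> nuG_integrable g.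
Proof.
move=> fg; apply: eq_integrable; first exact: measurable_half_plane.
by move=> y /[!inE] hy; rewrite fg.
Qed.

End PlaneMeasure.

(** * Transversal level sets and the divergence theorem *)

Section TransversalLevelSets.
Context {R : realType}.

Local Notation leb := (@lebesgue_measure R).
Local Notation leb2 := (leb \x leb)%E.

(* Points of a level set where the derivative does not vanish are isolated. *)
Lemma countable_transversal_level (f : R -> R) (c : R) :
  countable [set x : R | f x = c /\ exists2 d : R, is_derive x 1 f d & d != 0].
Proof.
have /choice[q Hq] : forall x : R, exists q : rat * rat,
    (f x = c /\ exists2 d : R, is_derive x 1 f d & d != 0) ->
    ratr q.1 < x < ratr q.2 /\
    forall y : R, ratr q.1 < y < ratr q.2 -> f y = c -> y = x.
  move=> x; have [[fx [d df d0]]|nS] := pselect (f x = c /\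
    exists2 d : R, is_derive x 1 f d & d != 0); last by exists (0, 0).
  have d20 : 0 < `|d| / 2 by rewrite divr_gt0// normr_gt0.
  have [r r0 Hr] := (iffLR (is_derive_epsP _ _ _) df) _ d20.
  have xr : x - r < x by lra.
  have rx : x < x + r by lra.
  have [a] := rat_in_itvoo xr; have [b] := rat_in_itvoo rx.
  rewrite !in_itv/= => /andP[b1 b2] /andP[a1 a2].
  exists (a, b) => _ /=; rewrite a2 b1; split => // y /andP[ya yb] fy.
  have := Hr (y - x); rewrite subrK fy fx subrr sub0r normrN.
  have -> : `|y - x| < r by rewrite ltr_distl; apply/andP; split; lra.
  move=> /(_ isT); rewrite normrM => H.
  apply/eqP; rewrite -subr_eq0 -normr_le0.
  have d0' : 0 < `|d| by rewrite normr_gt0.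
  by rewrite -(ler_pM2l d0') mulr0; lra.
apply/countable_injP; exists (pickle \o q) => x y; rewrite !inE => Sx Sy.
move=> /(pcan_inj pickleK) qxy.
have [xq _] := Hq _ Sx; have [_ uy] := Hq _ Sy.
by apply: uy Sx.1; rewrite -qxy.
Qed.

Lemma countable_transversal (f : R -> R) (X : set R) : countable X ->
  countable [set x : R | X (f x) /\ exists2 d : R, is_derive x 1 f d & d != 0].
Proof.
move=> cX.
apply: (sub_countable _ (bigcup_countable (F := fun c => [set x : R | f x = c /\
  exists2 d : R, is_derive x 1 f d & d != 0]) cX _)).
  by apply: subset_card_le => x [Xfx Hx]; exists (f x).
by move=> c _; exact: countable_transversal_level.
Qed.

Implicit Types (X : set R) (f g : R -> R -> R) (r z : R).

(** In use [g] is a partial derivative of [f], so that a line in that direction crosses each level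
    of [f] in this set at isolated points. *)
Definition transversal (X : set R) (f g : R -> R -> R) : set (R * R) :=
  [set y | [/\ half_plane y, X (f y.1 y.2) & g y.1 y.2 != 0]].

Lemma measurable_transversal X f g : countable X -> hp_measurable f ->
  hp_measurable g -> measurable (transversal X f g).
Proof.
move=> cX mf mg.
have mX : measurable X by exact: countable_measurable.
have A := mf measurable_half_plane X mX.
have B := mg measurable_half_plane _ (measurableC (measurable_set1 (0 : R))).
rewrite (_ : transversal _ _ _ = (half_plane `&` (fun y => f y.1 y.2) @^-1` X) `&`
  (half_plane `&` (fun y => g y.1 y.2) @^-1` (~` [set 0]))); first exact: measurableI.
apply/seteqP; split => [y [hy Xy /eqP g0]|y [[hy Xy] [_ /eqP g0]]] //.
Qed.

(** By Fubini: every line of constant [z] meets the set in countably many points. *)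
Lemma transversal_r_null X f g : countable X -> hp_measurable f ->
  hp_measurable g ->
  (forall r z, 0 < r -> is_derive r 1 (f^~ z) (g r z)) ->
  leb2 (transversal X f g) = 0%E.
Proof.
move=> cX mf mg df; apply: negligible_ysections.
  exact: measurable_transversal.
move=> z; apply: countable_lebesgue_measure0.
apply: sub_countable (countable_transversal (f^~ z) X cX).
apply: subset_card_le => r; rewrite /ysection/= inE => -[/= hr Xf g0].
by split => //; exists (g r z) => //; exact: df.
Qed.

Lemma transversal_z_null X f g : countable X -> hp_measurable f ->
  hp_measurable g ->
  (forall r z, 0 < r -> is_derive z 1 (f r) (g r z)) ->
  leb2 (transversal X f g) = 0%E.
Proof.
move=> cX mf mg df; apply: negligible_xsections.
  exact: measurable_transversal.
move=> r; apply: countable_lebesgue_measure0.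
apply: sub_countable (countable_transversal (f r) X cX).
apply: subset_card_le => z; rewrite /xsection/= inE => -[/= hr Xf g0].
by split => //; exists (g r z) => //; exact: df.
Qed.

End TransversalLevelSets.

(** * Vanishing integrals of derivatives *)

Section DivergenceTheorem.
Context {R : realType}.

Local Notation leb := (@lebesgue_measure R).
Local Notation leb2 := (leb \x leb)%E.
Implicit Types (r z x : R).

Lemma integral_derive_compact (F f : R -> R) (K : R) :
  (forall x, is_derive x 1 F (f x)) -> continuous f ->
  (forall x, K < `|x| -> F x = 0) ->
  (\int[leb]_x (f x)%:E)%E = 0%E.
Proof.
move=> dF cf F0.
(* [K] may be negative; this [a] is positive and exceeds [K], so [F] vanishes at both endpoints. *)
pose a := Num.max K 0 + 1.
have a0 : 0 < a by rewrite /a ltr_wpDl// le_max lexx orbT.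
have Ka : K < a by rewrite /a ltr_pwDr// le_max lexx.
have f0 x : K < `|x| -> f x = 0.
  move=> Kx; have [_ <-] : is_derive x 1 F 0; last by have [_ ->] := dF x.
  apply: (@is_derive_local _ _ (fun=> 0) x 0 (`|x| - K)).
  - by rewrite subr_gt0.
  - move=> y yx; apply: F0.
    have := ler_distD y x 0; rewrite !subr0 distrC; lra.
have -> : (\int[leb]_x (f x)%:E)%E = (\int[leb]_(x in `[(- a)%R, a]) (f x)%:E)%E.
  rewrite [RHS]integral_mkcond; apply: eq_integral => x _.
  rewrite patchE; case: ifPn => // /negP xa.
  rewrite f0//; apply: contrapT => /negP; rewrite -leNgt => xK; apply: xa.
  rewrite inE/= in_itv/= -ler_norml; lra.
rewrite (@continuous_FTC2 _ f F).
- by rewrite !F0 ?subee// ?normrN gtr0_norm.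
- lra.
- exact: continuous_subspaceT.
- split.
  + by move=> x _; have [] := dF x.
  + exact/cvg_at_right_filter/(is_derive_continuous _ _ _ (dF _)).
  + exact/cvg_at_left_filter/(is_derive_continuous _ _ _ (dF _)).
- by move=> x _; rewrite derive1E; have [_ ->] := dF x.
Qed.

Lemma nuG_integral_fubini f : nuG_integrable f ->
  (nuG_integral f)%:E = (\int[leb]_x \int[leb]_y
     (if (0 < x)%R then f x y / x else 0)%:E)%E /\
  (nuG_integral f)%:E = (\int[leb]_y \int[leb]_x
     (if (0 < x)%R then f x y / x else 0)%:E)%E.
Proof.
move=> intf.
pose g (y : R * R) : R := if 0 < y.1 then f y.1 y.2 / y.1 else 0.
have gE : (fun y : R * R => (g y)%:E) =
    (fun y : R * R => (f y.1 y.2 / y.1)%:E) \_ half_plane.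
  apply/funext => y; rewrite patchE /g; case: ifPn => [y0|/negP y0].
    by rewrite mem_set.
  by rewrite memNset.
have intg : leb2.-integrable setT (fun y : R * R => (g y)%:E).
  by rewrite gE; exact: (iffLR (@integrable_mkcond _ _ R leb2 _ _ measurable_half_plane) intf).
have E : (nuG_integral f)%:E = (\int[leb2]_y (g y)%:E)%E.
  rewrite /nuG_integral /Rintegral fineK; last first.
    by apply: integrable_fin_num intf; exact: measurable_half_plane.
  by rewrite integral_mkcond -gE.
split; rewrite E.
  by rewrite -(@integral12_prod_meas1 _ _ _ _ _ leb leb (fun y : R * R => (g y)%:E)).
by rewrite -(@integral21_prod_meas1 _ _ _ _ _ leb leb (fun y : R * R => (g y)%:E)).
Qed.

(** The factor [r] cancels the weight, which leaves on each line of constant [r] the integral of a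
    derivative with compact support. *)
Lemma nuG_integral_dz (B dB : R -> R -> R) (A C : R) :
  hp_measurable (fun r z => r * dB r z) ->
  dominated A C (fun r z => r * dB r z) ->
  (forall r z, 0 < r -> is_derive z 1 (B r) (dB r z)) ->
  (forall r, 0 < r -> continuous (dB r)) ->
  (forall r z, 0 < r -> A < `|z| -> B r z = 0) ->
  nuG_integral (fun r z => r * dB r z) = 0.
Proof.
move=> mB domB dBE cB B0; apply: EFin_inj.
rewrite (nuG_integral_fubini _ (dominated_integrable _ _ _ mB domB)).1.
apply: integral0_eq => r _ /=; have [r0|r0] := ltP 0 r; last by rewrite integral0_eq.
rewrite -[RHS](@integral_derive_compact (B r) (dB r) A) => [|z||z]; first last.
- exact: B0.
- exact: cB.
- exact: dBE.
by apply: eq_integral => z _; rewrite mulrAC divff ?mul1r// gt_eqF.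
Qed.

(** [B] and [dB] are extended by 0 to [r <= 0]. The bound [D r^2] makes the extension of [B]
    differentiable at 0 with derivative 0, and [D r] makes the derivative continuous there; thus the
    axis becomes an interior point and leaves no boundary term. *)
Lemma nuG_integral_dr (B dB : R -> R -> R) (A C D : R) :
  hp_measurable (fun r z => r * dB r z) ->
  dominated A C (fun r z => r * dB r z) ->
  (forall r z, 0 < r -> is_derive r 1 (B^~ z) (dB r z)) ->
  (forall r z, 0 < r -> {for r, continuous (dB^~ z)}) ->
  (forall r z, 0 < r -> A < r -> B r z = 0) ->
  (forall r z, 0 < r -> `|B r z| <= D * r ^+ 2 /\ `|dB r z| <= D * r) ->
  nuG_integral (fun r z => r * dB r z) = 0.
Proof.
move=> mB domB dBE cB B0 bB; apply: EFin_inj.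
rewrite (nuG_integral_fubini _ (dominated_integrable _ _ _ mB domB)).2.
apply: integral0_eq => z _ /=.
pose F r : R := if 0 < r then B r z else 0.
pose f r : R := if 0 < r then dB r z else 0.
have D0 : 0 <= D.
  by have [_] := bB 1 0 ltr01; rewrite mulr1; exact: le_trans.
have bF r : `|F r| <= D * `|r| ^+ 2.
  rewrite /F; case: ifPn => r0; first by rewrite (gtr0_norm r0) (bB _ _ r0).1.
  by rewrite normr0 mulr_ge0// exprn_ge0.
have bf r : `|f r| <= D * `|r|.
  rewrite /f; case: ifPn => r0; first by rewrite (gtr0_norm r0) (bB _ _ r0).2.
  by rewrite normr0 mulr_ge0.
rewrite -[RHS](@integral_derive_compact F f (Num.max A 0)).
- by apply: eq_integral => r _; rewrite /f; case: ifPn => // r0; rewrite mulrAC divff ?mul1r// gt_eqF.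
- move=> r; rewrite /f; have [r0|r0|r0] := ltgtP 0 r.
  + apply: (@is_derive_local _ _ (B^~ z) r _ r) => //; last exact: dBE.
    by move=> y; rewrite ltr_distl => /andP[? ?]; rewrite /F ifT//; lra.
  + apply: (@is_derive_local _ _ (fun=> 0) r _ (- r)).
      by rewrite oppr_gt0.
    by move=> y; rewrite ltr_distl => /andP[? ?]; rewrite /F ifF//; lra.
  + apply/is_derive_epsP => e e0; exists (e / (D + 1)).
      by rewrite divr_gt0//; lra.
    move=> h; rewrite ltr_pdivlMr; last by lra.
    rewrite -r0 addr0 /F ltxx !subr0 mul0r subr0 => hd.
    apply: le_trans (bF h) _; rewrite expr2 mulrA ler_wpM2r//.
    by have := normr_ge0 h; nra.
- move=> r; have [r0|r0|r0] := ltgtP 0 r.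
  + rewrite /continuous_at {2}/f r0.
    have := cB r z r0; apply: cvg_trans; apply: near_eq_cvg.
    by near=> y; rewrite /f ifT//; near: y; exact: lt_nbhsr.
  + rewrite /continuous_at {2}/f ltNge (ltW r0)/=.
    apply: cvg_near_cst; near=> y; rewrite /f ifF//; apply/negbTE; rewrite -leNgt.
    by apply: ltW; near: y; exact: lt_nbhsl.
  + rewrite /continuous_at {2}/f r0 ltxx; apply/cvgrPdist_le => e e0.
    apply/nbhs_ballP; exists (e / (D + 1)) => /=; first by rewrite divr_gt0//; lra.
    move=> y; rewrite /ball/= -r0 sub0r normrN ltr_pdivlMr; last by lra.
    rewrite sub0r normrN => yd; apply: le_trans (bf y) _.
    by have := normr_ge0 y; nra.
- move=> r; rewrite gt_max /F => /andP[Ar r0]; case: ifPn => // r1.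
  by apply: B0 => //; rewrite -(gtr0_norm r1).
Unshelve. all: by end_near. Qed.

End DivergenceTheorem.

(** * Continuity, measurability and orders of vanishing at the axis *)

Section Calculus.
Context {R : realType}.
Implicit Types (f g : R -> R -> R) (r z : R) (phi : R -> R).

Definition continuous2 f := continuous (fun y : R * R => f y.1 y.2).

Lemma continuous2_cst (a : R) : continuous2 (fun _ _ => a).
Proof. move=> y; exact: cvg_cst. Qed.

Lemma continuous2_fst : continuous2 (fun r _ => r).
Proof. move=> y; exact: cvg_fst. Qed.

Lemma continuous2D f g : continuous2 f -> continuous2 g ->
  continuous2 (fun r z => f r z + g r z).
Proof. move=> cf cg y; exact: cvgD (cf y) (cg y). Qed.

Lemma continuous2B f g : continuous2 f -> continuous2 g ->
  continuous2 (fun r z => f r z - g r z).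
Proof. move=> cf cg y; exact: cvgB (cf y) (cg y). Qed.

Lemma continuous2M f g : continuous2 f -> continuous2 g ->
  continuous2 (fun r z => f r z * g r z).
Proof. move=> cf cg y; exact: cvgM (cf y) (cg y). Qed.

Lemma continuous2_comp phi f : continuous phi -> continuous2 f ->
  continuous2 (fun r z => phi (f r z)).
Proof.
move=> cphi cf y; apply: (@continuous_comp _ _ _ (fun y : R * R => f y.1 y.2) phi);
  [exact: cf|exact: cphi].
Qed.

Lemma continuous2_r f z : continuous2 f -> continuous (f^~ z).
Proof.
move=> cf r; apply: (@continuous_comp _ _ _ (fun x : R => (x, z))
  (fun y : R * R => f y.1 y.2)); last exact: cf.
exact: (@cvg_pair _ _ _ (nbhs r) (nbhs r) (nbhs z) _ _ _ id (fun=> z) cvg_id (cvg_cst z)).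
Qed.

Lemma continuous2_z f r : continuous2 f -> continuous (f r).
Proof.
move=> cf z; apply: (@continuous_comp _ _ _ (fun x : R => (r, x))
  (fun y : R * R => f y.1 y.2)); last exact: cf.
exact: (@cvg_pair _ _ _ (nbhs z) (nbhs r) (nbhs z) _ _ _ (fun=> r) id (cvg_cst r) cvg_id).
Qed.

Lemma hp_measurable_continuous f : continuous2 f -> hp_measurable f.
Proof.
move=> cf; apply: measurable_funTS; exact: continuous_plane_measurable.
Qed.

Lemma hp_measurableD f g : hp_measurable f -> hp_measurable g ->
  hp_measurable (fun r z => f r z + g r z).
Proof. exact: measurable_funD. Qed.

Lemma hp_measurableB f g : hp_measurable f -> hp_measurable g ->
  hp_measurable (fun r z => f r z - g r z).
Proof. exact: measurable_funB. Qed.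

Lemma hp_measurableM f g : hp_measurable f -> hp_measurable g ->
  hp_measurable (fun r z => f r z * g r z).
Proof. exact: measurable_funM. Qed.

Lemma hp_measurable_comp phi f : measurable_fun setT phi -> hp_measurable f ->
  hp_measurable (fun r z => phi (f r z)).
Proof. by move=> mphi mf; exact: measurableT_comp. Qed.

Lemma eq_hp_measurable f g : (forall r z, 0 < r -> f r z = g r z) ->
  hp_measurable f -> hp_measurable g.
Proof.
by move=> fg; apply: eq_measurable_fun => y /[!inE] hy; rewrite fg.
Qed.

Variable A : R.

(** The constant is uniform in the index: [I] is [unit] for a single function and [nat] for a
    sequence that is to be dominated. *)
Definition bigO (I : Type) (n : nat) (f : I -> R -> R -> R) :=
  exists2 C : R, 0 <= C & forall i r z, 0 < r -> box A (r, z) ->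
    `|f i r z| <= C * r ^+ n.

Lemma bigOM I n m (f g : I -> R -> R -> R) : bigO I n f -> bigO I m g ->
  bigO I (n + m) (fun i r z => f i r z * g i r z).
Proof.
move=> [C C0 Hf] [D D0 Hg]; exists (C * D); first exact: mulr_ge0.
move=> i r z r0 bx; rewrite normrM exprD mulrACA; apply: ler_pM => //; [exact: Hf|exact: Hg].
Qed.

(** On the box [r <= A], so the surplus powers of [r] go into the constant; [A] may be negative,
    whence the maximum with 0. *)
Lemma bigOW I n m (f : I -> R -> R -> R) : (m <= n)%N -> bigO I n f -> bigO I m f.
Proof.
move=> mn [C C0 Hf]; have A1 : 0 <= Num.max A 0 by rewrite le_max lexx orbT.
exists (C * Num.max A 0 ^+ (n - m)); first by rewrite mulr_ge0// exprn_ge0.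
move=> i r z r0 bx; apply: le_trans (Hf i r z r0 bx) _.
rewrite -{1}(subnK mn) exprD mulrA ler_wpM2r ?exprn_ge0 ?(ltW r0)// ler_wpM2l//.
rewrite lerXn2r ?nnegrE ?(ltW r0)//.
by move: bx => [/=]; rewrite in_itv/= le_max => /andP[_ ->].
Qed.

Lemma bigOD I n (f g : I -> R -> R -> R) : bigO I n f -> bigO I n g ->
  bigO I n (fun i r z => f i r z + g i r z).
Proof.
move=> [C C0 Hf] [D D0 Hg]; exists (C + D); first exact: addr_ge0.
move=> i r z r0 bx; rewrite (le_trans (ler_normD _ _))// mulrDl lerD//; [exact: Hf|exact: Hg].
Qed.

Lemma bigOB I n (f g : I -> R -> R -> R) : bigO I n f -> bigO I n g ->
  bigO I n (fun i r z => f i r z - g i r z).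
Proof.
move=> [C C0 Hf] [D D0 Hg]; exists (C + D); first exact: addr_ge0.
move=> i r z r0 bx; rewrite (le_trans (ler_normB _ _))// mulrDl lerD//; [exact: Hf|exact: Hg].
Qed.

Lemma bigO_cst I (a : R) : bigO I 0 (fun _ _ _ => a).
Proof. by exists `|a| => // i r z _ _; rewrite expr0 mulr1. Qed.

Lemma bigO_r I : bigO I 1 (fun _ r _ => r).
Proof. by exists 1 => // i r z r0 _; rewrite expr1 mul1r gtr0_norm. Qed.

Lemma bigO_div I n (f : I -> R -> R -> R) : bigO I n.+1 f ->
  bigO I n (fun i r z => f i r z / r).
Proof.
move=> [C C0 Hf]; exists C => // i r z r0 bx.
by rewrite normrM normfV (gtr0_norm r0) ler_pdivrMr// -mulrA -exprSr Hf.
Qed.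

Lemma bigO_continuous I f : continuous2 f -> bigO I 0 (fun _ => f).
Proof.
move=> cf; have cbox : compact (box A) by apply: compact_setX; exact: segment_compact.
have [bx0|bx0] := eqVneq (box A) set0.
  by exists 0 => // i r z _; rewrite bx0.
have cF : {within box A, continuous (fun y : R * R => `|f y.1 y.2|)}.
  apply: continuous_subspaceT => y; apply: cvg_norm; exact: cf.
have [y _ Hy] := compact_EVT_max (iffLR (set0P _) bx0) cbox cF.
exists `|f y.1 y.2| => // i r z _ bx; rewrite expr0 mulr1.
by have := Hy (r, z); apply; rewrite inE.
Qed.

(** Mean value theorem on the segment from the axis to the point, which stays in the box, where [fr]
    is bounded. *)
Lemma bigO_vanish I f fr : continuous2 fr ->
  (forall r z, is_derive r 1 (f^~ z) (fr r z)) -> (forall z, f 0 z = 0) ->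
  bigO I 1 (fun _ => f).
Proof.
move=> /(bigO_continuous unit)[C C0 HC] df f0; exists C => // i r z r0 bx.
have cont : {within `[0, r], continuous (f^~ z)}.
  by apply: continuous_subspaceT => x; exact: is_derive_continuous.
have [x /[!in_itv]/= xr] := MVT r0 (fun x _ => df x z) cont.
rewrite f0 !subr0 => ->; rewrite normrM expr1 (gtr0_norm r0) ler_wpM2r ?(ltW r0)//.
have := HC tt x z; rewrite expr0 mulr1; apply.
  by case/andP: xr.
move: bx => [/=]; rewrite in_itv/= => /andP[_ rA] hz; split => //=.
by rewrite in_itv/=; case/andP: xr => x0 xr'; rewrite (ltW x0)/= (le_trans _ rA)// ltW.
Qed.

(** Order one is what compensates the weight [1/r]. *)
Lemma bigO_dominated I (f : I -> R -> R -> R) : bigO I 1 f ->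
  (forall i r z, 0 < r -> f i r z != 0 -> box A (r, z)) ->
  exists C, forall i, dominated A C (f i).
Proof.
move=> [C C0 Hf] supp; exists C => i r z r0; split; last exact: supp.
have [->|f0] := eqVneq (f i r z) 0; first by rewrite mul0r normr0.
rewrite normrM normfV (gtr0_norm r0) ler_pdivrMr// -{2}[r]expr1 Hf//.
exact: supp f0.
Qed.

End Calculus.

(** * The regularized identity *)

Lemma derV {R : realType} (x : R) : x != 0 -> is_derive x 1 (fun y : R => y^-1) (- x ^- 2).
Proof.
move=> x0; apply: is_derive_eq (is_deriveV x0 (der_id x)) _.
by rewrite /GRing.scale/= mulr1.
Qed.

Ltac continuous2_tac := lazymatch goal with
  | |- continuous2 (fun r z => @?f r z - @?g r z) =>
      apply (continuous2B f g); continuous2_tac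
  | |- continuous2 (fun r z => @?f r z + @?g r z) =>
      apply (continuous2D f g); continuous2_tac
  | |- continuous2 (fun r z => @?f r z * @?g r z) =>
      apply (continuous2M f g); continuous2_tac
  | |- continuous2 (fun r z => @?f r z ^+ 2) =>
      apply (continuous2M f f); continuous2_tac
  | |- _ => first [eassumption | exact continuous2_fst | exact (continuous2_cst _) | idtac]
  end.

(* The fields of a meridian flow at a fixed time: [a], [c] are the radial and
   axial velocities, [r b] is the circulation and [e] the cutoff. *)
Record meridian_flow {R : realType} (nu A : R)
    (b br bz brr bzz bt a ar c cz e er ez : R -> R -> R) : Prop := MeridianFlow {
  mf_cont : [/\ [/\ continuous2 b, continuous2 br, continuous2 bz,
       continuous2 brr & continuous2 bzz],
     [/\ continuous2 bt, continuous2 a, continuous2 ar, continuous2 c &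
       continuous2 cz] & [/\ continuous2 e, continuous2 er & continuous2 ez]];
  mf_b_r : forall r z : R, is_derive r 1 (b^~ z) (br r z);
  mf_b_z : forall r z : R, is_derive z 1 (b r) (bz r z);
  mf_br_r : forall r z : R, is_derive r 1 (br^~ z) (brr r z);
  mf_bz_z : forall r z : R, is_derive z 1 (bz r) (bzz r z);
  mf_a_r : forall r z : R, is_derive r 1 (a^~ z) (ar r z);
  mf_c_z : forall r z : R, is_derive z 1 (c r) (cz r z);
  mf_e_r : forall r z : R, is_derive r 1 (e^~ z) (er r z);
  mf_e_z : forall r z : R, is_derive z 1 (e r) (ez r z);
  mf_b0 : forall z : R, b 0 z = 0;
  mf_a0 : forall z : R, a 0 z = 0;
  mf_supp : forall r z : R, 0 < r -> e r z != 0 -> box A (r, z);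
  mf_div : forall r z : R, 0 < r -> ar r z + a r z / r + cz r z = 0;
  mf_pde : forall r z : R, 0 < r ->
    r * bt r z + a r z * (b r z + r * br r z) + c r z * (r * bz r z) =
    nu * (2 * br r z + r * brr r z - (b r z + r * br r z) / r + r * bzz r z) }.

Arguments mf_cont {R nu A b br bz brr bzz bt a ar c cz e er ez} _.
Arguments mf_b_r {R nu A b br bz brr bzz bt a ar c cz e er ez} _.
Arguments mf_b_z {R nu A b br bz brr bzz bt a ar c cz e er ez} _.
Arguments mf_br_r {R nu A b br bz brr bzz bt a ar c cz e er ez} _.
Arguments mf_bz_z {R nu A b br bz brr bzz bt a ar c cz e er ez} _.
Arguments mf_a_r {R nu A b br bz brr bzz bt a ar c cz e er ez} _.
Arguments mf_c_z {R nu A b br bz brr bzz bt a ar c cz e er ez} _.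
Arguments mf_e_r {R nu A b br bz brr bzz bt a ar c cz e er ez} _.
Arguments mf_e_z {R nu A b br bz brr bzz bt a ar c cz e er ez} _.
Arguments mf_b0 {R nu A b br bz brr bzz bt a ar c cz e er ez} _.
Arguments mf_a0 {R nu A b br bz brr bzz bt a ar c cz e er ez} _.
Arguments mf_supp {R nu A b br bz brr bzz bt a ar c cz e er ez} _.
Arguments mf_div {R nu A b br bz brr bzz bt a ar c cz e er ez} _.
Arguments mf_pde {R nu A b br bz brr bzz bt a ar c cz e er ez} _.

Section RegularizedIdentity.
Context {R : realType} {nu A : R} {b br bz brr bzz bt a ar c cz e er ez : R -> R -> R}.
Hypothesis flow : meridian_flow nu A b br bz brr bzz bt a ar c cz e er ez.
Implicit Types (r z : R).

Definition Gam r z : R := r * b r z.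
Definition Gam_r r z : R := b r z + r * br r z.
Definition Gam_z r z : R := r * bz r z.
Definition Gam_rr r z : R := 2 * br r z + r * brr r z.
Definition Gam_zz r z : R := r * bzz r z.
Definition Gam_t r z : R := r * bt r z.

Lemma is_derive_Gam_r r z : is_derive r 1 (Gam^~ z) (Gam_r r z).
Proof.
have := derM _ _ _ _ _ (der_id r) (mf_b_r flow r z).
by rewrite mul1r.
Qed.

Lemma is_derive_Gam_z r z : is_derive z 1 (Gam r) (Gam_z r z).
Proof.
have := derM _ _ _ _ _ (der_cst z r) (mf_b_z flow r z).
by rewrite mul0r add0r.
Qed.

Lemma is_derive_Gam_rr r z : is_derive r 1 (Gam_r^~ z) (Gam_rr r z).
Proof.
have := derD _ _ _ _ _ (mf_b_r flow r z) (derM _ _ _ _ _ (der_id r) (mf_br_r flow r z)).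
by rewrite mul1r addrA /Gam_rr mulr_natl mulr2n.
Qed.

Lemma is_derive_Gam_zz r z : is_derive z 1 (Gam_z r) (Gam_zz r z).
Proof.
have := derM _ _ _ _ _ (der_cst z r) (mf_bz_z flow r z).
by rewrite mul0r add0r.
Qed.

Lemma continuous2_Gam : [/\ continuous2 Gam, continuous2 Gam_r, continuous2 Gam_z &
  [/\ continuous2 Gam_rr, continuous2 Gam_zz & continuous2 Gam_t]].
Proof.
have [[cb cbr cbz cbrr cbzz] [cbt _ _ _ _] _] := mf_cont flow.
have cr := @continuous2_fst R.
split; [| | |split].
- by rewrite /Gam; continuous2_tac.
- by rewrite /Gam_r; continuous2_tac.
- by rewrite /Gam_z; continuous2_tac.
- by rewrite /Gam_rr; continuous2_tac.
- by rewrite /Gam_zz; continuous2_tac.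
- by rewrite /Gam_t; continuous2_tac.
Qed.

Section BigO.
Variable I : Type.

Lemma bigO_Gam : bigO A I 2 (fun=> Gam).
Proof.
have [[_ cbr _ _ _] _ _] := mf_cont flow.
apply: (bigOM A I 1 1); first exact: bigO_r.
exact: bigO_vanish cbr (mf_b_r flow) (mf_b0 flow).
Qed.

Lemma bigO_a : bigO A I 1 (fun=> a).
Proof.
have [_ [_ _ car _ _] _] := mf_cont flow.
exact: bigO_vanish car (mf_a_r flow) (mf_a0 flow).
Qed.

Lemma bigO_Gam_r : bigO A I 1 (fun=> Gam_r).
Proof.
have [[_ cbr _ _ _] _ _] := mf_cont flow.
apply: bigOD; first exact: bigO_vanish cbr (mf_b_r flow) (mf_b0 flow).
by apply: (bigOM A I 1 0); [exact: bigO_r|exact: bigO_continuous].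
Qed.

Lemma bigO_Gam_z : bigO A I 1 (fun=> Gam_z).
Proof.
have [[_ _ cbz _ _] _ _] := mf_cont flow.
by apply: (bigOM A I 1 0); [exact: bigO_r|exact: bigO_continuous].
Qed.

Lemma bigO_Gam_t : bigO A I 1 (fun=> Gam_t).
Proof.
have [_ [cbt _ _ _ _] _] := mf_cont flow.
by apply: (bigOM A I 1 0); [exact: bigO_r|exact: bigO_continuous].
Qed.

(** A function vanishing linearly at 0 inherits the order 2 of [Gam]; this is how sign-safety acts
    at the axis. *)
Lemma bigO_comp_Gam (M : R) (K : I -> R -> R) (C : R) :
  (forall r z, 0 < r -> box A (r, z) -> `|Gam r z| <= M) ->
  (forall i s, `|s| <= M -> `|K i s| <= C * `|s|) ->
  bigO A I 2 (fun i r z => K i (Gam r z)).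
Proof.
move=> GM KC; have [D D0 HD] := bigO_Gam.
exists (`|C| * D); first exact: mulr_ge0.
move=> i r z r0 bx; apply: le_trans (KC i _ (GM r z r0 bx)) _.
rewrite -mulrA; apply: le_trans (_ : `|C| * `|Gam r z| <= _).
  by rewrite ler_wpM2r// ler_norm.
by rewrite ler_wpM2l// HD.
Qed.

Lemma bigO0_comp_Gam (M : R) (K : I -> R -> R) (C : R) :
  (forall r z, 0 < r -> box A (r, z) -> `|Gam r z| <= M) ->
  (forall i s, `|s| <= M -> `|K i s| <= C) ->
  bigO A I 0 (fun i r z => K i (Gam r z)).
Proof.
move=> GM KC; exists `|C| => // i r z r0 bx; rewrite expr0 mulr1.
by apply: le_trans (KC i _ (GM r z r0 bx)) _; rewrite ler_norm.
Qed.

End BigO.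

Lemma Gam_bounded : exists2 M : R, 0 <= M &
  forall r z, 0 < r -> box A (r, z) -> `|Gam r z| <= M.
Proof.
have [cG _ _ _] := continuous2_Gam.
have [M M0 HM] := bigO_continuous A unit Gam cG; exists M => // r z r0 bx.
by have := HM tt r z r0 bx; rewrite expr0 mulr1.
Qed.

(* Divergence theorem for the field
   [(eta^2 / r) (K(Gam) (a, c) - nu K'(Gam) grad Gam)]. *)
Lemma regularized_identity (K K1 k : R -> R) (M C : R) :
  (forall r z, 0 < r -> box A (r, z) -> `|Gam r z| <= M) ->
  (forall s : R, is_derive s 1 K (K1 s)) ->
  (forall s : R, is_derive s 1 K1 (k s)) -> continuous k ->
  (forall s : R, `|s| <= M ->
     [/\ `|K s| <= C * `|s|, `|K1 s| <= C * `|s| & `|k s| <= C]) ->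
  nuG_integral (fun r z =>
    2 * e r z * (er r z * a r z + ez r z * c r z) * K (Gam r z)
    - 2 * nu * (e r z * K1 (Gam r z) * (er r z * Gam_r r z + ez r z * Gam_z r z))
    - 2 * e r z ^+ 2 * K (Gam r z) * (a r z / r)
    - e r z ^+ 2 * K1 (Gam r z) * Gam_t r z
    - nu * (e r z ^+ 2 * k (Gam r z) * (Gam_r r z ^+ 2 + Gam_z r z ^+ 2))) = 0.
Proof.
move=> GM dK dK1 ck bnd.
have [[cb cbr cbz cbrr cbzz] [cbt ca car cc ccz] [ce cer cez]] := mf_cont flow.
have [cG cGr cGz [cGrr cGzz cGt]] := continuous2_Gam.
have cK : continuous2 (fun r z => K (Gam r z)).
  by apply: continuous2_comp cG => s; exact: is_derive_continuous.
have cK1 : continuous2 (fun r z => K1 (Gam r z)).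
  by apply: continuous2_comp cG => s; exact: is_derive_continuous.
have ckG : continuous2 (fun r z => k (Gam r z)) by exact: continuous2_comp.
(* [S] and [T] are the two components of the field without the factor [e^2 / r]; [P] and [Q] include
   [e^2]. *)
pose S r z := K (Gam r z) * a r z - nu * (K1 (Gam r z) * Gam_r r z).
pose dS r z := K1 (Gam r z) * Gam_r r z * a r z + K (Gam r z) * ar r z -
  nu * (k (Gam r z) * Gam_r r z * Gam_r r z + K1 (Gam r z) * Gam_rr r z).
pose T r z := K (Gam r z) * c r z - nu * (K1 (Gam r z) * Gam_z r z).
pose dT r z := K1 (Gam r z) * Gam_z r z * c r z + K (Gam r z) * cz r z -
  nu * (k (Gam r z) * Gam_z r z * Gam_z r z + K1 (Gam r z) * Gam_zz r z).
pose P r z := e r z ^+ 2 * S r z.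
pose dP r z := 2 * e r z * er r z * S r z + e r z ^+ 2 * dS r z.
pose Q r z := e r z ^+ 2 * T r z.
pose dQ r z := 2 * e r z * ez r z * T r z + e r z ^+ 2 * dT r z.
have ce2 : continuous2 (fun r z => e r z ^+ 2) by continuous2_tac.
have cS : continuous2 S by rewrite /S; continuous2_tac.
have cT : continuous2 T by rewrite /T; continuous2_tac.
have cdS : continuous2 dS by rewrite /dS; continuous2_tac.
have cdT : continuous2 dT by rewrite /dT; continuous2_tac.
have cP : continuous2 P by rewrite /P; continuous2_tac.
have cdP : continuous2 dP by rewrite /dP; continuous2_tac.
have cdQ : continuous2 dQ by rewrite /dQ; continuous2_tac.
have dPE r z : is_derive r 1 (P^~ z) (dP r z).
  apply: derM; first exact: der_sqr (mf_e_r flow r z).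
  apply: derB.
    by apply: derM; [apply: der_comp; exact: is_derive_Gam_r|exact: (mf_a_r flow)].
  have := derM _ _ _ _ _ (der_cst r nu) (derM _ _ _ _ _
    (der_comp _ (Gam^~ z) _ _ _ (dK1 _) (is_derive_Gam_r r z)) (is_derive_Gam_rr r z)).
  by rewrite mul0r add0r.
have dQE r z : is_derive z 1 (Q r) (dQ r z).
  apply: derM; first exact: der_sqr (mf_e_z flow r z).
  apply: derB.
    by apply: derM; [apply: der_comp; exact: is_derive_Gam_z|exact: (mf_c_z flow)].
  have := derM _ _ _ _ _ (der_cst z nu) (derM _ _ _ _ _
    (der_comp _ (Gam r) _ _ _ (dK1 _) (is_derive_Gam_z r z)) (is_derive_Gam_zz r z)).
  by rewrite mul0r add0r.
have e0 r z : 0 < r -> ~ box A (r, z) -> e r z = 0.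
  by move=> r0 nb; apply/eqP; apply: contra_notT nb; exact: (mf_supp flow).
have O0 f : continuous2 f -> bigO A unit 0 (fun=> f) by exact: bigO_continuous.
have OK : bigO A unit 2 (fun _ r z => K (Gam r z)).
  by apply: (bigO_comp_Gam _ M (fun=> K) C) => // _ s /bnd[].
have OK1 : bigO A unit 2 (fun _ r z => K1 (Gam r z)).
  by apply: (bigO_comp_Gam _ M (fun=> K1) C) => // _ s /bnd[].
have Ok : bigO A unit 0 (fun _ r z => k (Gam r z)) by exact: O0.
have OS : bigO A unit 3 (fun=> S).
  apply: bigOB; first by apply: (bigOM A unit 2 1) => //; exact: bigO_a.
  apply: (bigOM A unit 0 3); first exact: bigO_cst.
  by apply: (bigOM A unit 2 1) => //; exact: bigO_Gam_r.
have OdS : bigO A unit 2 (fun=> dS).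
  apply: bigOB.
    apply: bigOD; last by apply: (bigOM A unit 2 0) => //; exact: O0.
    apply: (bigOW _ _ 4) => //.
    apply: (bigOM A unit 3 1); last exact: bigO_a.
    by apply: (bigOM A unit 2 1) => //; exact: bigO_Gam_r.
  apply: (bigOM A unit 0 2); first exact: bigO_cst.
  apply: bigOD; last by apply: (bigOM A unit 2 0) => //; exact: O0.
  apply: (bigOM A unit 1 1); last exact: bigO_Gam_r.
  by apply: (bigOM A unit 0 1) => //; exact: bigO_Gam_r.
have OT : bigO A unit 2 (fun=> T).
  apply: bigOB; first by apply: (bigOM A unit 2 0) => //; exact: O0.
  apply: (bigOM A unit 0 2); first exact: bigO_cst.
  apply: (bigOW _ _ 3) => //.
  by apply: (bigOM A unit 2 1) => //; exact: bigO_Gam_z.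
have OdT : bigO A unit 2 (fun=> dT).
  apply: bigOB.
    apply: bigOD; last by apply: (bigOM A unit 2 0) => //; exact: O0.
    apply: (bigOM A unit 2 0); last exact: O0.
    apply: (bigOW _ _ 3) => //.
    by apply: (bigOM A unit 2 1) => //; exact: bigO_Gam_z.
  apply: (bigOM A unit 0 2); first exact: bigO_cst.
  apply: bigOD; last by apply: (bigOM A unit 2 0) => //; exact: O0.
  apply: (bigOM A unit 1 1); last exact: bigO_Gam_z.
  by apply: (bigOM A unit 0 1) => //; exact: bigO_Gam_z.
have OP : bigO A unit 3 (fun=> P) by apply: (bigOM A unit 0 3) => //; exact: O0.
have OdP : bigO A unit 2 (fun=> dP).
  apply: bigOD; last by apply: (bigOM A unit 0 2) => //; exact: O0.
  apply: (bigOW _ _ 3) => //; apply: (bigOM A unit 0 3) => //; apply: O0.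
  by continuous2_tac.
have OdQ : bigO A unit 2 (fun=> dQ).
  apply: bigOD; last by apply: (bigOM A unit 0 2) => //; exact: O0.
  apply: (bigOM A unit 0 2) => //; apply: O0.
  by continuous2_tac.
(* The radial derivative of [P / r]. Order 3 of [P] and order 2 of [dP] give order 2 for [P / r] and
   order 1 for [V], as [nuG_integral_dr] demands. *)
pose V r z := dP r z / r - P r z / r / r.
have OV : bigO A unit 1 (fun=> V).
  by apply: bigOB; apply: bigO_div => //; exact: bigO_div.
have suppP r z : 0 < r -> ~ box A (r, z) -> P r z = 0 /\ dP r z = 0.
  by move=> r0 nb; rewrite /P /dP !e0// expr0n/= !mul0r mulr0 !mul0r addr0.
have suppQ r z : 0 < r -> ~ box A (r, z) -> Q r z = 0 /\ dQ r z = 0.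
  by move=> r0 nb; rewrite /Q /dQ !e0// expr0n/= !mul0r mulr0 !mul0r addr0.
have domV : exists C', dominated A C' (fun r z => r * V r z).
  have [||C' HC'] := bigO_dominated A unit (fun _ r z => r * V r z); first last.
  - by exists C'; exact: (HC' tt).
  - move=> _ r z r0 V0; apply: contrapT => /(suppP r z r0)[P0 dP0].
    by move: V0; rewrite /V P0 dP0 !mul0r subr0 mulr0 eqxx.
  - by apply: (bigOW _ _ 2) => //; apply: (bigOM A unit 1 1) => //; exact: bigO_r.
have domQ : exists C', dominated A C' (fun r z => r * (dQ r z / r)).
  have [||C' HC'] := bigO_dominated A unit (fun _ r z => r * (dQ r z / r)); first last.
  - by exists C'; exact: (HC' tt).
  - move=> _ r z r0 V0; apply: contrapT => /(suppQ r z r0)[_ dQ0].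
    by move: V0; rewrite dQ0 mul0r mulr0 eqxx.
  - apply: (bigOW _ _ 2) => //; apply: (bigOM A unit 1 1); first exact: bigO_r.
    exact: bigO_div.
have mdiv f : continuous2 f -> hp_measurable (fun r z => f r z / r).
  by move=> cf; apply: hp_measurable_div; exact: hp_measurable_continuous.
have mV : hp_measurable (fun r z => r * V r z).
  apply: (eq_hp_measurable (fun r z => dP r z - P r z / r)).
    by move=> r z r0; rewrite /V; field; rewrite gt_eqF.
  by apply: hp_measurableB; [exact: hp_measurable_continuous|exact: mdiv].
have mQ : hp_measurable (fun r z => r * (dQ r z / r)).
  apply: (eq_hp_measurable dQ); last exact: hp_measurable_continuous.
  by move=> r z r0; field; rewrite gt_eqF.
have [CV HV] := domV; have [CQ HQ] := domQ.
have outside r z : 0 < r -> A < r \/ A < `|z| -> ~ box A (r, z).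
  move=> r0 H [/=]; rewrite !in_itv/= -ler_norml => /andP[_ H1] H2; case: H; lra.
have IV : nuG_integral (fun r z => r * V r z) = 0.
  have [D1 D10 HD1] := bigO_div _ _ _ _ OP; have [D2 D20 HD2] := OV.
  apply: (nuG_integral_dr (fun r z => P r z / r) V A CV (D1 + D2)) => //.
  - move=> r z r0; have r0' : r != 0 by rewrite gt_eqF.
    have := derM _ _ _ _ _ (dPE r z) (derV _ r0').
    by rewrite (_ : dP r z / r + P r z * - r ^- 2 = V r z)// /V; field.
  - move=> r z r0; have r0' : r != 0 by rewrite gt_eqF.
    have cinv := inv_continuous r0'.
    apply: cvgB; first by apply: cvgM => //; exact: (continuous2_r _ _ cdP).
    by apply: cvgM => //; apply: cvgM => //; exact: (continuous2_r _ _ cP).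
  - move=> r z r0 Ar; have [-> _] := suppP r z r0 (outside r z r0 (or_introl Ar)).
    by rewrite mul0r.
  - move=> r z r0; have [bx|nb] := pselect (box A (r, z)).
      split; [have := HD1 tt r z r0 bx|have := HD2 tt r z r0 bx] => /le_trans; apply.
        by rewrite ler_wpM2r ?exprn_ge0 ?(ltW r0)// lerDl.
      by rewrite expr1 ler_wpM2r ?(ltW r0)// lerDr.
    have [-> Z] := suppP r z r0 nb.
    rewrite /V Z (suppP r z r0 nb).1 !mul0r subr0 normr0.
    by rewrite !mulr_ge0 ?addr_ge0 ?exprn_ge0 ?(ltW r0).
have IQ : nuG_integral (fun r z => r * (dQ r z / r)) = 0.
  apply: (nuG_integral_dz (fun r z => Q r z / r) (fun r z => dQ r z / r) A CQ) => //.
  - move=> r z r0; have := derM _ _ _ _ _ (dQE r z) (der_cst z r^-1).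
    by rewrite mulr0 addr0.
  - by move=> r r0 z; apply: cvgM; [exact: (continuous2_z _ _ cdQ)|exact: cvg_cst].
  - move=> r z r0 Az; have [-> _] := suppQ r z r0 (outside r z r0 (or_intror Az)).
    by rewrite mul0r.
transitivity (nuG_integral (fun r z => r * V r z + r * (dQ r z / r))); last first.
  rewrite nuG_integralD ?IV ?IQ ?addr0//.
    exact: (dominated_integrable A CV).
  exact: (dominated_integrable A CQ).
apply: eq_nuG_integral => r z r0; have r0' : r != 0 by rewrite gt_eqF.
have Hdiv := mf_div flow r z r0; have Hpde := mf_pde flow r z r0.
(* With [Gam_t] and [ar] eliminated, the integrands agree identically. The term [K(Gam) a / r]
   occurs twice, once from the divergence of [(a, c)] and once from the derivative of [1/r]; since
   [K] stands for [w^2 / 2], the coefficient of [U w^2] becomes 1. *)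
have -> : Gam_t r z = nu * (Gam_rr r z - Gam_r r z / r + Gam_zz r z) -
    a r z * Gam_r r z - c r z * Gam_z r z.
  by rewrite /Gam_t /Gam_rr /Gam_r /Gam_zz /Gam_z -Hpde; ring.
have Ear : ar r z = - (a r z / r) - cz r z by move: Hdiv; lra.
rewrite /V /dP /P /dQ /dS /S /dT /T Ear; field.
exact: r0'.
Qed.

End RegularizedIdentity.

(** * Passage to the limit *)

(** With unequal orders allowed, the order of an expression can be synthesized from those of its
    parts. *)
Lemma bigOD_min {R : realType} (A : R) I n m (f g : I -> R -> R -> R) :
  bigO A I n f -> bigO A I m g ->
  bigO A I (minn n m) (fun i r z => f i r z + g i r z).
Proof.
move=> Of Og; apply: bigOD.
  by apply: bigOW Of; exact: geq_minl.
by apply: bigOW Og; exact: geq_minr.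
Qed.

Lemma bigOB_min {R : realType} (A : R) I n m (f g : I -> R -> R -> R) :
  bigO A I n f -> bigO A I m g ->
  bigO A I (minn n m) (fun i r z => f i r z - g i r z).
Proof.
move=> Of Og; apply: bigOB.
  by apply: bigOW Of; exact: geq_minl.
by apply: bigOW Og; exact: geq_minr.
Qed.

(** The order is left as an existential variable and found bottom up; [bigO_tac] then compares it
    with the order asked for by computation. *)
Ltac bigO_exact := lazymatch goal with
  | |- bigO ?A ?I _ (fun i r z => @?f i r z - @?g i r z) =>
      eapply (bigOB_min A I _ _ f g); bigO_exact
  | |- bigO ?A ?I _ (fun i r z => @?f i r z + @?g i r z) =>
      eapply (bigOD_min A I _ _ f g); bigO_exact
  | |- bigO ?A ?I _ (fun i r z => @?f i r z / r) =>
      eapply (bigO_div A I _ f); bigO_exact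
  | |- bigO ?A ?I _ (fun i r z => @?f i r z * @?g i r z) =>
      eapply (bigOM A I _ _ f g); bigO_exact
  | |- bigO ?A ?I _ (fun i r z => @?f i r z ^+ 2) =>
      eapply (bigOM A I _ _ f f); bigO_exact
  | |- bigO ?A ?I _ (fun i r z => _) => first [eassumption | eapply bigO_cst | idtac]
  | |- bigO ?A ?I _ _ => first [eassumption | idtac]
  end.

Ltac bigO_tac := eapply bigOW; [|bigO_exact]; done.

Ltac hp_measurable_tac := lazymatch goal with
  | |- hp_measurable (fun r z => @?f r z - @?g r z) =>
      apply (hp_measurableB f g); hp_measurable_tac
  | |- hp_measurable (fun r z => @?f r z + @?g r z) =>
      apply (hp_measurableD f g); hp_measurable_tac
  | |- hp_measurable (fun r z => @?f r z / r) =>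
      apply (hp_measurable_div f); hp_measurable_tac
  | |- hp_measurable (fun r z => @?f r z * @?g r z) =>
      apply (hp_measurableM f g); hp_measurable_tac
  | |- hp_measurable (fun r z => @?f r z ^+ 2) =>
      apply (hp_measurableM f f); hp_measurable_tac
  | |- _ => first [eassumption |
      exact (hp_measurable_continuous _ (continuous2_cst _)) | idtac]
  end.

Section EnergyBalance.
Context {R : realType} {nu A : R} {b br bz brr bzz bt a ar c cz e er ez : R -> R -> R}.
Hypothesis flow : meridian_flow nu A b br bz brr bzz bt a ar c cz e er ez.
Variables (phi : R -> R) (L : R).
Hypotheses (L_gt0 : 0 < L)
  (phi_lip : forall x y : R, `|phi x - phi y| <= L * `|x - y|)
  (phi0 : phi 0 = 0)
  (phi_convex : convex_function (setT : set (convex_lmodType R^o)) phi).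
Implicit Types (r z s : R).

Local Notation leb := (@lebesgue_measure R).
Local Notation leb2 := (leb \x leb)%E.
Local Notation G := (@Gam R b).
Local Notation Gr := (@Gam_r R b br).
Local Notation Gz := (@Gam_z R bz).
Local Notation Gt := (@Gam_t R bt).

Definition kinks : set R := [set s | ~ derivable phi s 1].

(** The last two sets catch the points where a first derivative of [Gam] vanishes but the second
    derivative in the same direction does not. *)
Definition critical_kinks : set (R * R) :=
  (transversal kinks G Gr `|` transversal kinks G Gz) `|`
  (transversal [set 0] Gr (@Gam_rr R br brr) `|` transversal [set 0] Gz (@Gam_zz R bzz)).

Lemma critical_kinks_null : measurable critical_kinks /\ leb2 critical_kinks = 0%E.
Proof.
have cD := countable_kinks phi phi_convex.
have c0 : countable [set (0 : R)] by exact: finite_set_countable.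
have [cG cGr cGz [cGrr cGzz _]] := continuous2_Gam flow.
have mt X f g : countable X -> continuous2 f -> continuous2 g ->
    measurable (transversal X f g).
  by move=> cX cf cg; apply: measurable_transversal => //; exact: hp_measurable_continuous.
have m := @hp_measurable_continuous R.
split; first by do 2 apply: measurableU; exact: mt.
have nU (B C : set (R * R)) : measurable B -> measurable C ->
    leb2 B = 0%E -> leb2 C = 0%E -> leb2 (B `|` C) = 0%E.
  by move=> mB mC B0 C0; apply: null_set_setU.
have mN1 := mt _ _ _ _ cD cG cGr; have mN2 := mt _ _ _ _ cD cG cGz.
have mN3 := mt _ _ _ _ c0 cGr cGrr; have mN4 := mt _ _ _ _ c0 cGz cGzz.
apply: (nU _ _ (measurableU _ _ mN1 mN2) (measurableU _ _ mN3 mN4)).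
  apply: (nU _ _ mN1 mN2).
    apply: transversal_r_null => //; [exact: m|exact: m|].
    by move=> r z _; exact: (is_derive_Gam_r flow).
  apply: transversal_z_null => //; [exact: m|exact: m|].
  by move=> r z _; exact: (is_derive_Gam_z flow).
apply: (nU _ _ mN3 mN4).
  apply: transversal_r_null => //; [exact: m|exact: m|].
  by move=> r z _; exact: (is_derive_Gam_rr flow).
apply: transversal_z_null => //; [exact: m|exact: m|].
by move=> r z _; exact: (is_derive_Gam_zz flow).
Qed.

(* Where [Gam] is at a kink, its first derivatives vanish off a null set; where
   these vanish, so do the second derivatives off a null set, and then the
   equation gives [Gam_t = 0]. *)
Lemma kink_stationary r z : 0 < r -> ~ critical_kinks (r, z) ->
  ~ derivable phi (G r z) 1 -> [/\ Gr r z = 0, Gz r z = 0 & Gt r z = 0].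
Proof.
move=> r0 nN nd.
have H (X : set R) f g : X (f r z) -> ~ transversal X f g (r, z) -> g r z = 0.
  by move=> Xf nT; apply/eqP; apply: contra_notT nT => g0; split.
have Gr0 : Gr r z = 0 by apply: (H kinks G) => // T; apply: nN; left; left.
have Gz0 : Gz r z = 0 by apply: (H kinks G) => // T; apply: nN; left; right.
have Grr0 : @Gam_rr R br brr r z = 0.
  by apply: (H [set 0] Gr) => // T; apply: nN; right; left.
have Gzz0 : @Gam_zz R bzz r z = 0.
  by apply: (H [set 0] Gz) => // T; apply: nN; right; right.
split => //; have := mf_pde flow r z r0.
move: Gr0 Gz0 Grr0 Gzz0; rewrite /Gam_r /Gam_z /Gam_rr /Gam_zz /Gam_t => -> -> -> ->.
by rewrite !mulr0 !addr0 mul0r subrr mulr0.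
Qed.

Local Notation psi := (derive1 phi).

Lemma psi_le s : `|psi s| <= L.
Proof.
have [d|nd] := pselect (derivable phi s 1).
  apply: (truncation_derive_le phi L phi_lip s); split => //.
  by rewrite derive1E.
by rewrite derive1_nderivable// normr0 ltW.
Qed.

(** The five densities have the derivatives of [w] in chain rule form, with [psi = 0] at kinks. This
    one, [eta^2 w w_t], comes from differentiating the energy in time. *)
Definition time_density r z := e r z ^+ 2 * phi (G r z) * (psi (G r z) * Gt r z).
Definition grad_density r z :=
  e r z ^+ 2 * ((psi (G r z) * Gr r z) ^+ 2 + (psi (G r z) * Gz r z) ^+ 2).
Definition diff_density r z := e r z * phi (G r z) *
  (er r z * (psi (G r z) * Gr r z) + ez r z * (psi (G r z) * Gz r z)).
Definition trans_density r z :=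
  e r z * phi (G r z) ^+ 2 * (a r z * er r z + c r z * ez r z).
Definition rad_density r z := (a r z / r) * e r z ^+ 2 * phi (G r z) ^+ 2.

Definition tame f := hp_measurable f /\ exists C, dominated A C f.

Lemma tame_integrable f : tame f -> nuG_integrable f.
Proof. by move=> [mf [C HC]]; exact: dominated_integrable mf HC. Qed.

Lemma tame_bigO f n : hp_measurable f -> bigO A unit n.+1 (fun=> f) ->
  (forall r z, e r z = 0 -> f r z = 0) -> tame f.
Proof.
move=> mf Of f0; split => //.
have [||C HC] := bigO_dominated A unit (fun=> f); last by exists C; exact: (HC tt).
  exact: bigOW Of.
move=> _ r z r0 fn0; apply: (mf_supp flow) => //.
by apply: contra_neq fn0; exact: f0.
Qed.

Lemma densities_tame : [/\ tame time_density, tame grad_density &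
  [/\ tame diff_density, tame trans_density & tame rad_density]].
Proof.
have [_ [_ ca _ cc _] [ce cer cez]] := mf_cont flow.
have [cG cGr cGz [_ _ cGt]] := continuous2_Gam flow.
have m := @hp_measurable_continuous R.
have mG := m _ cG; have mGr := m _ cGr; have mGz := m _ cGz; have mGt := m _ cGt.
have me := m _ ce; have mer := m _ cer; have mez := m _ cez.
have ma := m _ ca; have mc := m _ cc.
have mphi : hp_measurable (fun r z => phi (G r z)).
  apply: hp_measurable_comp mG; apply: continuous_measurable_fun.
  exact: truncation_continuous L_gt0 phi_lip.
have mpsi : hp_measurable (fun r z => psi (G r z)).
  apply: hp_measurable_comp mG; apply: measurable_derive_truncation L_gt0 phi_lip _.
  exact: countable_kinks.
have O0 f : continuous2 f -> bigO A unit 0 (fun=> f) by exact: bigO_continuous.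
have Oe := O0 _ ce; have Oer := O0 _ cer; have Oez := O0 _ cez; have Oc := O0 _ cc.
have Oa := bigO_a flow unit; have OGr := bigO_Gam_r flow unit.
have OGz := bigO_Gam_z flow unit; have OGt := bigO_Gam_t flow unit.
have [M M0 GM] := Gam_bounded flow.
have Ophi : bigO A unit 2 (fun _ r z => phi (G r z)).
  apply: (bigO_comp_Gam flow _ M (fun=> phi) L) => // _ s _.
  exact: truncation_le.
have Opsi : bigO A unit 0 (fun _ r z => psi (G r z)).
  by apply: (bigO0_comp_Gam _ M (fun=> psi) L) => // _ s _; exact: psi_le.
split; [| |split].
(* Orders at the axis: 2 for [phi(Gam)], 1 for the first derivatives of [Gam] and for [a], 0 for the
   remaining factors. The densities thus have orders 3, 2, 3, 4, 4; the argument is one less. *)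
- apply: (tame_bigO _ 2) => [||r z e0]; rewrite /time_density.
  + by hp_measurable_tac.
  + by bigO_tac.
  + by rewrite e0 expr0n/= !mul0r.
- apply: (tame_bigO _ 1) => [||r z e0]; rewrite /grad_density.
  + by hp_measurable_tac.
  + by bigO_tac.
  + by rewrite e0 expr0n/= !mul0r.
- apply: (tame_bigO _ 2) => [||r z e0]; rewrite /diff_density.
  + by hp_measurable_tac.
  + by bigO_tac.
  + by rewrite e0 !mul0r.
- apply: (tame_bigO _ 3) => [||r z e0]; rewrite /trans_density.
  + by hp_measurable_tac.
  + by bigO_tac.
  + by rewrite e0 !mul0r.
- apply: (tame_bigO _ 3) => [||r z e0]; rewrite /rad_density.
  + by hp_measurable_tac.
  + by bigO_tac.
  + by rewrite e0 expr0n/= mulr0 !mul0r.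
Qed.

(** Right side minus left side of the energy identity, after the term with [eta eta_t w^2] has
    cancelled against its counterpart in the time derivative of the energy. *)
Definition balance_defect : R :=
  - 2 * nu * nuG_integral diff_density + nuG_integral trans_density
  - nuG_integral rad_density
  - (nuG_integral time_density + nu * nuG_integral grad_density).

Lemma nuG_tame_sum (f g h k l : R -> R -> R) (x : R) :
  tame f -> tame g -> tame h -> tame k -> tame l ->
  nuG_integral (fun r z => x * f r z + g r z + -1 * h r z + -1 * k r z + x / 2 * l r z) =
  x * nuG_integral f + nuG_integral g - nuG_integral h - nuG_integral k + x / 2 * nuG_integral l.
Proof.
move=> /tame_integrable If /tame_integrable Ig /tame_integrable Ih
  /tame_integrable Ik /tame_integrable Il.
have I1 := nuG_integrableZ x f If; have I2 := nuG_integrableZ (-1) h Ih.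
have I3 := nuG_integrableZ (-1) k Ik; have I4 := nuG_integrableZ (x / 2) l Il.
have I5 := nuG_integrableD _ _ I1 Ig; have I6 := nuG_integrableD _ _ I5 I2.
have I7 := nuG_integrableD _ _ I6 I3.
by rewrite !nuG_integralD// !nuG_integralZ// !mulN1r.
Qed.

(** The regularized identity equates the integrals of [Tn] and [Un], where [Un] carries the kinks.
    Since the integrals of [Tn] tend to the defect, so do those of [Un]: they tend to 0 in the
    affine case and are nonnegative if [phi] is. *)
Lemma energy_balance : 0 <= nu ->
  (affine_where_active phi -> balance_defect = 0) /\
  ((forall s, 0 <= phi s) -> 0 <= balance_defect).
Proof.
move=> nu0; have [tame_t tame_g [tame_d tame_tr tame_r]] := densities_tame.
pose T r z := - 2 * nu * diff_density r z + trans_density r z + -1 * rad_density r z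
  + -1 * time_density r z + - 2 * nu / 2 * grad_density r z.
have IT : nuG_integral T = balance_defect.
  rewrite /T nuG_tame_sum// /balance_defect.
  by rewrite (_ : - 2 * nu / 2 = - nu); [ring|field].
have [M M0 GM] := Gam_bounded flow.
have [K [K1 [[dK dK1 KK0] [[C bndK] bndk cvK cvK1]]]] :=
  regularized_half_sqr phi L L_gt0 phi_lip phi0 M M0.
(* A sequence in []0, 1]], the range of the uniform bounds, since dominated convergence concerns
   sequences. *)
pose h (n : nat) : R := n.+1%:R^-1.
have h0 n : 0 < h n by rewrite invr_gt0.
have h1 n : h n <= 1 by rewrite invf_le1// ler1n.
have hn0 n : h n != 0 by rewrite gt_eqF.
have [_ [_ ca _ cc _] [ce cer cez]] := mf_cont flow.
have [cG cGr cGz [_ _ cGt]] := continuous2_Gam flow.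
have cphi : continuous phi by exact: truncation_continuous L_gt0 phi_lip.
pose Q n r z := quot_part phi (h n) (G r z).
pose E n r z := kink_part phi (h n) (G r z).
(* The integrand of the regularized identity, in which only the part [quot_part] of the second
   derivative is kept; the part [kink_part] goes to [Un]. *)
pose Tn n r z := 2 * e r z * (er r z * a r z + ez r z * c r z) * K (h n) (G r z)
    - 2 * nu * (e r z * K1 (h n) (G r z) * (er r z * Gr r z + ez r z * Gz r z))
    - 2 * e r z ^+ 2 * K (h n) (G r z) * (a r z / r)
    - e r z ^+ 2 * K1 (h n) (G r z) * Gt r z
    - nu * (e r z ^+ 2 * Q n r z * (Gr r z ^+ 2 + Gz r z ^+ 2)).
pose Un n r z := nu * (e r z ^+ 2 * E n r z * (Gr r z ^+ 2 + Gz r z ^+ 2)).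
have m := @hp_measurable_continuous R.
have mG := m _ cG; have mGr := m _ cGr; have mGz := m _ cGz; have mGt := m _ cGt.
have me := m _ ce; have mer := m _ cer; have mez := m _ cez.
have ma := m _ ca; have mc := m _ cc.
have mKn n : hp_measurable (fun r z => K (h n) (G r z)).
  apply: m; apply: continuous2_comp cG => s.
  exact: is_derive_continuous.
have mK1n n : hp_measurable (fun r z => K1 (h n) (G r z)).
  apply: m; apply: continuous2_comp cG => s.
  exact: is_derive_continuous.
have cshift (f : R -> R) (u : R) : continuous f -> continuous (fun s : R => f (s + u)).
  move=> cf q; apply: (@continuous_comp _ _ _ (fun s : R => s + u) f); last exact: cf.
  by apply: cvgD => //; exact: cvg_cst.
have mphi : hp_measurable (fun r z => phi (G r z)).
  exact: hp_measurable_comp (continuous_measurable_fun cphi) mG.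
have mshift (u : R) : hp_measurable (fun r z => phi (G r z + u)).
  exact: hp_measurable_comp (continuous_measurable_fun (cshift phi u cphi)) mG.
have mQ n : hp_measurable (Q n).
  rewrite /Q /quot_part /diff_quot.
  apply: (eq_hp_measurable (fun r z => (((phi (G r z + h n) - phi (G r z)) / h n) ^+ 2 +
    ((phi (G r z) - phi (G r z - h n)) / h n) ^+ 2) / 2)) => [r z _|].
    by rewrite subrK.
  by have := mshift (h n); have := mshift (- h n) => ? ?; hp_measurable_tac.
have mE n : hp_measurable (E n).
  rewrite /E /kink_part /second_diff.
  by have := mshift (h n); have := mshift (- h n) => ? ?; hp_measurable_tac.
have mT n : hp_measurable (Tn n).
  by rewrite /Tn; have := mKn n; have := mK1n n; have := mQ n => ? ? ?; hp_measurable_tac.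
have mU n : hp_measurable (Un n).
  by rewrite /Un; have := mE n => ?; hp_measurable_tac.
have OKn : bigO A nat 2 (fun n r z => K (h n) (G r z)).
  apply: (bigO_comp_Gam flow _ M (fun n => K (h n)) C) => // n s sM.
  by have [|_ ->] := bndK (h n) s _ sM => //; rewrite h0 h1.
have OK1n : bigO A nat 0 (fun n r z => K1 (h n) (G r z)).
  apply: (bigO0_comp_Gam _ M (fun n => K1 (h n)) C) => // n s sM.
  by have [|-> _] := bndK (h n) s _ sM => //; rewrite h0 h1.
have OQ : bigO A nat 0 Q.
  exists (L ^+ 2); first exact: sqr_ge0.
  move=> n r z _ _; rewrite expr0 mulr1 ger0_norm ?quot_part_ge0//.
  exact: quot_part_le L_gt0 phi_lip _ _ (hn0 n).
have O0 I f : continuous2 f -> bigO A I 0 (fun=> f) by exact: bigO_continuous.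
have suppe f : (forall r z, e r z = 0 -> f r z = 0) ->
    forall r z, 0 < r -> f r z != 0 -> box A (r, z).
  move=> f0 r z r0 fn0; apply: (mf_supp flow) => //.
  by apply: contra_neq fn0; exact: f0.
have [CT domT] : exists CT, forall n, dominated A CT (Tn n).
  apply: bigO_dominated.
    have Oe := O0 nat _ ce; have Oer := O0 nat _ cer; have Oez := O0 nat _ cez.
    have Oc := O0 nat _ cc.
    have Oa := bigO_a flow nat; have OGr := bigO_Gam_r flow nat.
    have OGz := bigO_Gam_z flow nat; have OGt := bigO_Gam_t flow nat.
    by rewrite /Tn; bigO_tac.
  move=> n; apply: suppe => r z e0; rewrite /Tn e0.
  by rewrite expr0n/= !(mul0r, mulr0) !subr0.
have OU (I : Type) (j : I -> nat) : bigO A I 0 (fun i => E (j i)) ->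
    bigO A I 1 (fun i => Un (j i)).
  move=> OE; have Oe := O0 I _ ce; have OGr := bigO_Gam_r flow I.
  have OGz := bigO_Gam_z flow I.
  by rewrite /Un; bigO_tac.
have Usupp n : forall r z, 0 < r -> Un n r z != 0 -> box A (r, z).
  by apply: suppe => r z e0; rewrite /Un e0 expr0n/= !(mul0r, mulr0).
(* The bound depends on [n]: it comes from writing [kink_part] as second derivative minus
   [quot_part]. It serves to split the integral in the identity for a fixed [n]. *)
have tame_U n : tame (Un n).
  split => //; have [C1 HC1] := bndk (h n) (h0 n).
  have [|D HD] := bigO_dominated A unit (fun=> Un n) _ (fun=> Usupp n);
    last by exists D; exact: (HD tt).
  apply: (OU unit (fun=> n)).
  apply: (bigO0_comp_Gam _ M (fun=> kink_part phi (h n)) (C1 + L ^+ 2)) => // _ s sM.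
  have [+ _] := HC1 s sM; rewrite second_diff_half_sqr//.
  have := quot_part_le phi L L_gt0 phi_lip _ s (hn0 n).
  have := quot_part_ge0 phi (h n) s.
  by rewrite !ler_norml => ? ? /andP[? ?]; apply/andP; split; lra.
have IdT n : nuG_integral (Tn n) = nuG_integral (Un n).
  have [C1 HC1] := bndk (h n) (h0 n).
  have H := regularized_identity flow (K (h n)) (K1 (h n))
    (fun s => second_diff (half_sqr phi) (h n) s / h n ^+ 2) M (Num.max C C1) GM
    (dK (h n)) (dK1 (h n)).
  have ck : continuous (fun s => second_diff (half_sqr phi) (h n) s / h n ^+ 2).
    have chs := half_sqr_continuous phi L L_gt0 phi_lip.
    move=> s; apply: cvgM; last exact: cvg_cst.
    apply: cvgD; last exact: (cshift _ (- h n) chs).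
    apply: cvgB; first exact: (cshift _ (h n) chs).
    by apply: cvgM; [exact: cvg_cst|exact: chs].
  have {H} := H ck; rewrite (_ : nuG_integral _ = nuG_integral (Tn n) - nuG_integral (Un n)).
    move=> H; apply/eqP; rewrite -subr_eq0; apply/eqP; apply: H => s sM.
    have [k1 k2] := HC1 s sM; have [|_ k3] := bndK (h n) s _ sM; first by rewrite h0 h1.
    split.
    - by apply: le_trans k3 _; rewrite ler_wpM2r// le_max lexx.
    - by apply: le_trans k2 _; rewrite ler_wpM2r// le_max lexx orbT.
    - by apply: le_trans k1 _; rewrite le_max lexx orbT.
  have IU := nuG_integrableZ (-1) _ (tame_integrable _ (tame_U n)).
  have IT' := dominated_integrable _ _ _ (mT n) (domT n).
  rewrite -mulN1r -(nuG_integralZ _ _ (tame_integrable _ (tame_U n))) -nuG_integralD//.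
  apply: eq_nuG_integral => r z r0; rewrite /Tn /Un /Q /E second_diff_half_sqr//.
  ring.
have [mN N0] := critical_kinks_null.
have mTlim : hp_measurable T.
  have := tame_d.1; have := tame_tr.1; have := tame_r.1; have := tame_t.1.
  by have := tame_g.1 => ? ? ? ? ?; rewrite /T; hp_measurable_tac.
have cvT : nuG_integral (Tn n) @[n --> \oo] --> balance_defect.
  rewrite -IT; apply: (dominated_cvg A CT Tn T critical_kinks) => // r z r0 nN.
  have cvKn : K (h n) (G r z) @[n --> \oo] --> half_sqr phi (G r z).
    exact: (cvg_at_right0_seq (fun h => K h (G r z)) _ (cvK (G r z))).
  have dpsi : derivable phi (G r z) 1 -> is_derive (G r z) 1 phi (psi (G r z)).
    by move=> d; split => //; rewrite derive1E.
  have cvX x : (~ derivable phi (G r z) 1 -> x = 0) ->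
      K1 (h n) (G r z) * x @[n --> \oo] --> phi (G r z) * psi (G r z) * x.
    move=> x0; have [d|nd] := pselect (derivable phi (G r z) 1).
      apply: cvgM; last exact: cvg_cst.
      exact: (cvg_at_right0_seq (fun h => K1 h (G r z)) _ (cvK1 _ _ (dpsi d))).
    by rewrite x0// mulr0; under eq_fun do rewrite mulr0; exact: cvg_cst.
  have cvQ x : (~ derivable phi (G r z) 1 -> x = 0) ->
      Q n r z * x @[n --> \oo] --> psi (G r z) ^+ 2 * x.
    move=> x0; have [d|nd] := pselect (derivable phi (G r z) 1).
      apply: cvgM; last exact: cvg_cst.
      exact: (cvg_at_right0_seq (fun h => quot_part phi h (G r z)) _
        (cvg_quot_part phi _ _ (dpsi d))).
    by rewrite x0// mulr0; under eq_fun do rewrite mulr0; exact: cvg_cst.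
  have st := kink_stationary r z r0 nN.
  pose k1 := 2 * e r z * (er r z * a r z + ez r z * c r z) - 2 * e r z ^+ 2 * (a r z / r).
  pose x1 := - 2 * nu * (e r z * (er r z * Gr r z + ez r z * Gz r z)) - e r z ^+ 2 * Gt r z.
  pose x2 := - nu * (e r z ^+ 2 * (Gr r z ^+ 2 + Gz r z ^+ 2)).
  rewrite (_ : (fun n => Tn n r z) = fun n => k1 * K (h n) (G r z) + K1 (h n) (G r z) * x1 + Q n r z * x2).
    rewrite (_ : T r z = k1 * half_sqr phi (G r z) + phi (G r z) * psi (G r z) * x1 +
       psi (G r z) ^+ 2 * x2).
      apply: cvgD; last first.
        by apply: cvQ => /st[Gr0 Gz0 _]; rewrite /x2 Gr0 Gz0 expr0n/= addr0 !mulr0.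
      apply: cvgD; first by apply: cvgM => //; exact: cvg_cst.
      by apply: cvX => /st[Gr0 Gz0 Gt0]; rewrite /x1 Gr0 Gz0 Gt0 !(mulr0, addr0) subr0.
    rewrite /T /x1 /x2 /k1 /diff_density /trans_density /rad_density /time_density.
    rewrite /grad_density /half_sqr; field.
    by rewrite gt_eqF.
  by apply/funext => n; rewrite /Tn /x1 /x2 /k1; ring.
have cvU : nuG_integral (Un n) @[n --> \oo] --> balance_defect.
  by under eq_fun do rewrite -IdT.
split => [aff|pos].
  have z0 : nuG_integral (fun _ _ : R => 0 : R) = 0.
    rewrite -[RHS](mul0r (nuG_integral (Un 0%N))) -nuG_integralZ.
      by apply: eq_nuG_integral => r z _; rewrite mul0r.
    exact: tame_integrable.
  (* In the affine case the kink terms are at most [2 L^2] uniformly in [n], so their pointwise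
     limit 0 passes to the integrals. *)
  have [|CU domU] := bigO_dominated A nat Un _ Usupp.
    apply: (OU nat id); exists (2 * L ^+ 2); first by rewrite mulr_ge0// sqr_ge0.
    move=> n r z _ _; rewrite expr0 mulr1.
    exact: kink_part_le L_gt0 phi_lip _ _ aff (h0 n).
  have cvU0 : nuG_integral (Un n) @[n --> \oo] --> (0 : R).
    rewrite -z0; apply: (dominated_cvg A CU Un _ critical_kinks) => //.
      exact: hp_measurable_continuous (continuous2_cst _).
    move=> r z r0 _.
    have cE := cvg_at_right0_seq (fun h => kink_part phi h (G r z)) _
      (cvg_kink_part phi L L_gt0 phi_lip (G r z) aff).
    rewrite (_ : (fun n => Un n r z) = fun n => nu * (e r z ^+ 2 *
      (Gr r z ^+ 2 + Gz r z ^+ 2)) * E n r z); last first.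
      by apply/funext => n; rewrite /Un; ring.
    rewrite -[X in _ --> X](mulr0 (nu * (e r z ^+ 2 * (Gr r z ^+ 2 + Gz r z ^+ 2)))).
    by apply: cvgM; [exact: cvg_cst|exact: cE].
  exact: (cvg_unique _ cvU cvU0).
apply: (ler_cvg_to (cvg_cst (0 : R)) cvU); apply: nearW => n.
apply: nuG_integral_ge0 => r z _; rewrite /Un mulr_ge0// mulr_ge0 ?addr_ge0 ?sqr_ge0//.
rewrite mulr_ge0 ?sqr_ge0//.
exact: (kink_part_ge0 phi phi_convex (h n) _ (h0 n) pos).
Qed.

End EnergyBalance.

(** * Time derivative of the energy *)

Lemma derivable_is_derive {R : realType} (f : R -> R) (x : R) :
  derivable f x 1 -> is_derive x 1 f (derive1 f x).
Proof. by move=> df; apply: DeriveDef; [exact: df|rewrite derive1E]. Qed.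

Section TruncationChainRule.
Context {R : realType}.
Variables (phi : R -> R) (L : R).
Hypotheses (L_gt0 : 0 < L)
  (phi_lip : forall x y : R, `|phi x - phi y| <= L * `|x - y|).

(** At a kink the hypothesis gives [g' = 0], and a Lipschitz function of [g] then still has
    derivative 0. *)
Lemma is_derive_truncation_comp (g : R -> R) (x c : R) :
  is_derive x 1 g c -> (~ derivable phi (g x) 1 -> c = 0) ->
  is_derive x 1 (fun y => phi (g y)) (derive1 phi (g x) * c).
Proof.
move=> dg c0; have [d|nd] := pselect (derivable phi (g x) 1).
  exact: der_comp (derivable_is_derive _ _ d) dg.
move: dg; rewrite c0// mulr0 => /is_derive_epsP dg; apply/is_derive_epsP => e e0.
have [d d0 Hd] := dg _ (divr_gt0 e0 L_gt0); exists d => // h /Hd.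
rewrite (mul0r h) (subr0 (g _ - _)) (subr0 (phi _ - _)) => H; apply: le_trans (phi_lip _ _) _.
by rewrite -ler_pdivlMl// mulrA (mulrC L^-1).
Qed.

(** In the remaining case, a kink with [c != 0], differentiability of [phi \o g] would give that of
    [phi] by [is_derive_outer]; hence both sides have the default value 0. *)
Lemma derive1_truncation_comp (g : R -> R) (x c : R) :
  {near x, continuous g} -> is_derive x 1 g c ->
  derive1 (fun y => phi (g y)) x = derive1 phi (g x) * c.
Proof.
move=> cg dg; have [dc|ndc] := pselect (derivable phi (g x) 1 \/ c = 0).
  have [|_ <-] := is_derive_truncation_comp g x c dg; last by rewrite derive1E.
  by case: dc => [d /(_ d)|].
have nd : ~ derivable phi (g x) 1 by move=> d; apply: ndc; left.
have c0 : c != 0 by apply/eqP => c0; apply: ndc; right.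
have nw : ~ derivable (phi \o g) x 1.
  move=> /derivable_is_derive dw'.
  by have [] := is_derive_outer phi g x c _ cg dg c0 dw'.
rewrite (derive1_nderivable _ _ nd) mul0r.
exact: (derive1_nderivable (phi \o g)).
Qed.

Lemma is_derive_seq (F : R -> R) (t l : R) (v : nat -> R) :
  is_derive t 1 F l -> (forall n, v n != 0) -> v n @[n --> \oo] --> (0 : R) ->
  (F (v n + t) - F t) / v n @[n --> \oo] --> l.
Proof.
move=> [dF <-] v0 cv.
have := iffLR (cvgr_dnbhsP _ _ _) dF v (conj v0 cv).
by apply: cvg_trans; apply: near_eq_cvg; near=> n; rewrite /= /GRing.scale/= mulr1 mulrC.
Unshelve. all: by end_near. Qed.

(** Reduces a derivative to sequences of difference quotients, in the form required by dominated
    convergence. *)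
Lemma is_derive_of_seq (F : R -> R) (t l : R) (d : R) : 0 < d ->
  (forall v : nat -> R, (forall n, v n != 0) -> (forall n, `|v n| < d) ->
    v n @[n --> \oo] --> (0 : R) -> (F (v n + t) - F t) / v n @[n --> \oo] --> l) ->
  is_derive t 1 F l.
Proof.
move=> d0 H.
have cF : h^-1 *: (F (h *: 1 + t) - F t) @[h --> 0^'] --> l.
  apply/cvgr_dnbhsP => u [u0 cu].
  (* Equal to [u] eventually, but nonzero and smaller than [d] for every [n]. *)
  pose v n := if `|u n| < d then u n else d / 2.
  have uv : \forall n \near \oo, v n = u n.
    move/cvgrPdist_lt : cu => /(_ d d0); apply: filterS => n.
    by rewrite sub0r normrN /v => ->.
  have A1 n : v n != 0 by rewrite /v; case: ifP => // _; rewrite gt_eqF//; lra.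
  have A2 n : `|v n| < d by rewrite /v; case: ifP => // _; rewrite gtr0_norm; lra.
  have A3 : v n @[n --> \oo] --> (0 : R).
    by apply: cvg_trans cu; apply: near_eq_cvg; apply: filterS uv => n ->.
  apply: cvg_trans (H v A1 A2 A3); apply: near_eq_cvg; apply: filterS uv => n ->.
  by rewrite /GRing.scale/= mulr1 mulrC.
split; first by apply/cvg_ex; exists l.
exact: cvg_lim cF.
Qed.

End TruncationChainRule.

Section EnergyDerivative.
Context {R : realType}.
Variables (phi : R -> R) (L A t d : R) (b bt e et : R -> R -> R -> R) (N : set (R * R)).
Hypotheses (L_gt0 : 0 < L)
  (phi_lip : forall x y : R, `|phi x - phi y| <= L * `|x - y|)
  (phi0 : phi 0 = 0)
  (psi_meas : measurable_fun setT (derive1 phi)) (d_gt0 : 0 < d).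
Implicit Types (r z s : R).
Local Notation leb2 := (@lebesgue_measure R \x @lebesgue_measure R)%E.
Hypotheses
  (b_s : forall r z s, `|s - t| < d -> is_derive s 1 (b r z) (bt r z s))
  (e_s : forall r z s, `|s - t| < d -> is_derive s 1 (e r z) (et r z s))
  (bounds : exists2 C : R, 0 <= C & forall r z s, box A (r, z) -> `|s - t| < d ->
     [/\ `|b r z s| <= C, `|bt r z s| <= C, `|e r z s| <= C & `|et r z s| <= C])
  (e_supp : forall r z s, 0 < r -> `|s - t| < d -> e r z s != 0 -> box A (r, z))
  (cont : forall s, `|s - t| < d ->
     continuous2 (fun r z => b r z s) /\ continuous2 (fun r z => e r z s))
  (cont_t : continuous2 (fun r z => bt r z t) /\ continuous2 (fun r z => et r z t))
  (mN : measurable N) (N0 : leb2 N = 0%E)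
  (N_kinks : forall r z, 0 < r -> ~ N (r, z) ->
     ~ derivable phi (r * b r z t) 1 -> r * bt r z t = 0).

Let w r z s := phi (r * b r z s).
Let E s := nuG_integral (energy_density e w s).
Let f1 r z := e r z t * et r z t * w r z t ^+ 2.
Let f2 r z := e r z t ^+ 2 * w r z t * (derive1 phi (r * b r z t) * (r * bt r z t)).

Lemma difference_quotient_bound (g dg : R -> R) (C u : R) : u != 0 -> `|u| < d ->
  (forall s, `|s - t| < d -> is_derive s 1 g (dg s)) ->
  (forall s, `|s - t| < d -> `|dg s| <= C) -> `|(g (u + t) - g t) / u| <= C.
Proof.
move=> u0 ud dgE gC.
have u0' : 0 < `|u| by rewrite normr_gt0.
rewrite normrM normfV ler_pdivrMr//.
have C0 : 0 <= C by apply: le_trans (gC t _); rewrite ?subrr ?normr0.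
have cont_g x y : (forall s, x <= s <= y -> `|s - t| < d) -> {within `[x, y], continuous g}.
  move=> xy; apply: continuous_in_subspaceT => s; rewrite inE/= in_itv/= => /xy sd.
  exact: is_derive_continuous (dgE _ sd).
move: ud u0'; have [up|un|u00] := ltgtP 0 u; last by move: u0; rewrite -u00 eqxx.
  rewrite (gtr0_norm up) => ud _.
  have near_t s : t <= s <= u + t -> `|s - t| < d.
    by move=> ?; rewrite ltr_distl; apply/andP; split; lra.
  have tu : t <= u + t by lra.
  have dg1 x : x \in `]t, (u + t)[ -> is_derive x 1 g (dg x).
    by rewrite in_itv/= => /andP[x1 x2]; apply: dgE; apply: near_t; rewrite !ltW.
  have [s] := MVT_segment tu dg1 (cont_g _ _ near_t).
  rewrite in_itv/= => /near_t sd ->; rewrite addrK normrM (gtr0_norm up).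
  by rewrite ler_wpM2r ?(ltW up)// gC.
rewrite (ltr0_norm un) => ud _.
have near_t s : u + t <= s <= t -> `|s - t| < d.
  by move=> ?; rewrite ltr_distl; apply/andP; split; lra.
have tu : u + t <= t by lra.
have dg1 x : x \in `](u + t), t[ -> is_derive x 1 g (dg x).
  by rewrite in_itv/= => /andP[x1 x2]; apply: dgE; apply: near_t; rewrite !ltW.
have [s] := MVT_segment tu dg1 (cont_g _ _ near_t).
rewrite in_itv/= => /near_t sd /(congr1 Num.norm); rewrite distrC => ->.
rewrite (_ : t - (u + t) = - u); last by ring.
by rewrite normrM normrN (ltr0_norm un) ler_wpM2r ?oppr_ge0 ?(ltW un)// gC.
Qed.

(** Differentiation under the integral sign. The quotients of [eta] are bounded by the mean value
    theorem, and those of [w] by the Lipschitz bound together with the mean value theorem for [b].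
    Off [N] the chain rule holds even at kinks, where the time derivative of the circulation is
    0. *)
Lemma is_derive_energy : nuG_integrable f1 -> nuG_integrable f2 ->
  is_derive t 1 E (2 * nuG_integral f1 + 2 * nuG_integral f2).
Proof.
move=> If1 If2; apply: (is_derive_of_seq _ _ _ _ d_gt0) => v v0 vd cv.
have td : `|t - t| < d by rewrite subrr normr0.
have vtd n : `|v n + t - t| < d by rewrite addrK.
have [C C0 HC] := bounds.
have cphi : continuous phi by exact: truncation_continuous L_gt0 phi_lip.
have m := @hp_measurable_continuous R.
have mb s : `|s - t| < d -> hp_measurable (fun r z => b r z s).
  by move=> sd; apply: m; exact: (cont s sd).1.
have me s : `|s - t| < d -> hp_measurable (fun r z => e r z s).
  by move=> sd; apply: m; exact: (cont s sd).2.
have mr := m _ (@continuous2_fst R).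
have mw s : `|s - t| < d -> hp_measurable (fun r z => w r z s).
  move=> sd; apply: hp_measurable_comp; first exact: continuous_measurable_fun.
  by have := mb s sd => ?; hp_measurable_tac.
have Oe I (s : I -> R) : (forall i, `|s i - t| < d) ->
    bigO A I 0 (fun i r z => e r z (s i)).
  move=> sd; exists C => // i r z _ bx; rewrite expr0 mulr1.
  by have [] := HC r z (s i) bx (sd i).
have Ow I (s : I -> R) : (forall i, `|s i - t| < d) ->
    bigO A I 1 (fun i r z => w r z (s i)).
  move=> sd; exists (L * C); first by rewrite mulr_ge0// ltW.
  move=> i r z r0 bx; rewrite expr1 -mulrA; have [bC _ _ _] := HC r z (s i) bx (sd i).
  apply: le_trans (truncation_le _ _ phi_lip phi0 _) _; rewrite ler_pM2l//.
  by rewrite normrM (gtr0_norm r0) mulrC ler_wpM2r// ltW.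
pose qe n r z := (e r z (v n + t) - e r z t) / v n.
pose qw n r z := (w r z (v n + t) - w r z t) / v n.
have Oqe : bigO A nat 0 qe.
  exists C => // n r z _ bx; rewrite expr0 mulr1.
  apply: (difference_quotient_bound (e r z) (et r z)) => // s sd.
  by have [] := HC r z s bx sd.
have Oqw : bigO A nat 1 qw.
  exists (L * C); first by rewrite mulr_ge0// ltW.
  move=> n r z r0 bx; rewrite expr1 /qw /w normrM normfV ler_pdivrMr ?normr_gt0//.
  apply: le_trans (phi_lip _ _) _; rewrite -!mulrA ler_pM2l// -mulrBr normrM.
  rewrite (gtr0_norm r0) mulrCA ler_pM2l//.
  have H : `|(b r z (v n + t) - b r z t) / v n| <= C.
    apply: (difference_quotient_bound (b r z) (bt r z)) => // s sd.
    by have [] := HC r z s bx sd.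
  by move: H; rewrite normrM normfV ler_pdivrMr ?normr_gt0.
(* Discrete product rule for [eta^2 w^2], which reduces its quotient to the bounded quotients [qe]
   and [qw]. *)
pose q n r z := (e r z (v n + t) + e r z t) * qe n r z * w r z (v n + t) ^+ 2 +
  e r z t ^+ 2 * (w r z (v n + t) + w r z t) * qw n r z.
have qE n r z : q n r z = (energy_density e w (v n + t) r z - energy_density e w t r z) / v n.
  by rewrite /q /qe /qw /energy_density; field.
have mq n : hp_measurable (q n).
  have := me _ td; have := me _ (vtd n); have := mw _ td; have := mw _ (vtd n) => ? ? ? ?.
  by rewrite /q /qe /qw; hp_measurable_tac.
have [||D HD] := bigO_dominated A nat q.
- have := Oe nat _ vtd; have := Oe nat _ (fun=> td).
  have := Ow nat _ vtd; have := Ow nat _ (fun=> td) => ? ? ? ?.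
  by rewrite /q; bigO_tac.
- move=> n r z r0; have [e0|e0] := eqVneq (e r z t) 0; last by move=> _; exact: e_supp e0.
  have [e1|e1] := eqVneq (e r z (v n + t)) 0; last by move=> _; exact: e_supp (vtd n) e1.
  by rewrite /q /qe e0 e1 addr0 expr0n/= !mul0r addr0 eqxx.
have int_energy s : `|s - t| < d -> nuG_integrable (energy_density e w s).
  move=> sd; have mes := me _ sd; have mws := mw _ sd.
  have [||D' HD'] := bigO_dominated A unit (fun _ => energy_density e w s).
  - have := Oe unit _ (fun=> sd); have := Ow unit _ (fun=> sd) => ? ?.
    by rewrite /energy_density; bigO_tac.
  - move=> _ r z r0 H; apply: (e_supp r z s) => //; apply: contra_neq H => H.
    by rewrite /energy_density H expr0n/= mul0r.
  - apply: (dominated_integrable A D') (HD' tt).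
    by rewrite /energy_density; hp_measurable_tac.
have EE n : (E (v n + t) - E t) / v n = nuG_integral (q n).
  have I1 := int_energy _ (vtd n); have I2 := int_energy _ td.
  have I3 := nuG_integrableZ (-1) _ I2; have I4 := nuG_integrableD _ _ I1 I3.
  rewrite /E mulrC -mulN1r -nuG_integralZ// -nuG_integralD// -nuG_integralZ//.
  by apply: eq_nuG_integral => r z _; rewrite qE mulN1r mulrC.
under eq_fun do rewrite EE.
have If1' := nuG_integrableZ 2 _ If1; have If2' := nuG_integrableZ 2 _ If2.
rewrite -!nuG_integralZ// -nuG_integralD//.
have [cbt cet] := cont_t.
have mpsi : hp_measurable (fun r z => derive1 phi (r * b r z t)).
  by apply: hp_measurable_comp psi_meas _; have := mb _ td => ?; hp_measurable_tac.
apply: (dominated_cvg A D q _ N) => //.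
  rewrite /f1 /f2; have := me _ td; have := mw _ td; have := m _ cbt; have := m _ cet.
  by move=> ? ? ? ?; hp_measurable_tac.
move=> r z r0 nN.
pose F s := energy_density e w s r z.
suff dF : is_derive t 1 F (2 * f1 r z + 2 * f2 r z).
  rewrite (_ : (fun n => q n r z) = fun n => (F (v n + t) - F t) / v n).
    exact: is_derive_seq.
  by apply/funext => n; rewrite qE.
have dg : is_derive t 1 (fun s => r * b r z s) (r * bt r z t).
  by have := derM _ _ _ _ _ (der_cst t r) (b_s r z t td); rewrite mul0r add0r.
have dw := is_derive_truncation_comp phi L L_gt0 phi_lip _ _ _ dg (N_kinks r z r0 nN).
have := derM _ _ _ _ _ (der_sqr _ _ _ (e_s r z t td)) (der_sqr _ _ _ dw).
rewrite (_ : 2 * e r z t * et r z t * phi (r * b r z t) ^+ 2 + e r z t ^+ 2 *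
  (2 * phi (r * b r z t) * (derive1 phi (r * b r z t) * (r * bt r z t))) =
  2 * f1 r z + 2 * f2 r z)//.
by rewrite /f1 /f2 /w; ring.
Qed.

End EnergyDerivative.

(** * The equation of the circulation *)

Section PlaneChainRule.
Context {R : realType}.
Variables (g gx gy : R -> R -> R).
Hypotheses (dgx : forall x y : R, is_derive x 1 (g^~ y) (gx x y))
  (dgy : forall x y : R, is_derive y 1 (g x) (gy x y))
  (cgx : continuous2 gx).

(** The increment is split at [(al s, be q)]: the second part is a one-variable chain rule, the
    first is treated by the mean value theorem and the continuity of [gx]. *)
Lemma is_derive_plane_curve (al be : R -> R) (s da db : R) :
  is_derive s 1 al da -> is_derive s 1 be db ->
  is_derive s 1 (fun q => g (al q) (be q))
    (gx (al s) (be s) * da + gy (al s) (be s) * db).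
Proof.
move=> dal dbe.
pose f1 q := g (al q) (be q) - g (al s) (be q).
have d2 : is_derive s 1 (fun q => g (al s) (be q)) (gy (al s) (be s) * db).
  exact: der_comp.
suff d1 : is_derive s 1 f1 (gx (al s) (be s) * da).
  have := derD _ _ _ _ _ d1 d2.
  by rewrite (_ : (fun q => f1 q + _) = fun q => g (al q) (be q))//;
    apply/funext => q; rewrite /f1 subrK.
apply/is_derive_epsP => e e0.
have K0 : 0 < `|da| + 1 by have := normr_ge0 da; lra.
have C0 : 0 < `|gx (al s) (be s)| + 1 by have := normr_ge0 (gx (al s) (be s)); lra.
(* [e1] and [e2] make each of the two error terms at most [e |h| / 2]; the 1 in the minimum yields
   [|D| <= (|da| + 1) |h|]. *)
have e1 : 0 < e / 2 / (`|da| + 1) by rewrite !divr_gt0.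
have e2 : 0 < Num.min 1 (e / 2 / (`|gx (al s) (be s)| + 1)).
  by rewrite lt_min ltr01/= !divr_gt0.
have /cvgrPdist_le/(_ _ e1)/nbhs_ballP[r /= r0 Hr] := cgx (al s, be s).
have [d1 d10 Hd1] := iffLR (is_derive_epsP _ _ _) dal _ e2.
have cal := is_derive_continuous _ _ _ dal; have cbe := is_derive_continuous _ _ _ dbe.
have /cvgrPdist_lt/(_ _ r0)/nbhs_ballP[da' /= da0 Hda] := cal.
have /cvgrPdist_lt/(_ _ r0)/nbhs_ballP[db' /= db0 Hdb] := cbe.
exists (Num.min d1 (Num.min da' db')); first by rewrite !lt_min d10 da0 db0.
move=> h; rewrite !lt_min => /and3P[hd1 hda hdb].
have bh x : `|h| < x -> ball s x (h + s).
  by rewrite /ball/= opprD addrCA subrr addr0 normrN.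
have {}Hda := Hda _ (bh _ hda); have {}Hdb := Hdb _ (bh _ hdb).
have {}Hd1 := Hd1 _ hd1.
rewrite {2}/f1 subrr subr0 /f1.
have [xi xiH ->] : exists2 xi : R, `|al s - xi| < r &
    g (al (h + s)) (be (h + s)) - g (al s) (be (h + s)) =
    gx xi (be (h + s)) * (al (h + s) - al s).
  have cont x y : {within `[x, y], continuous (g^~ (be (h + s)))}.
    by apply: continuous_subspaceT => z; exact: is_derive_continuous.
  have [le|lt] := leP (al s) (al (h + s)).
    have [xi] := MVT_segment le (fun x _ => dgx x _) (cont _ _).
    rewrite in_itv/= => xis ->; exists xi => //.
    apply: le_lt_trans Hda; move: le xis; clear => le xis.
    by rewrite distrC (distrC (al s)) !ger0_norm; lra.
  have [xi] := MVT_segment (ltW lt) (fun x _ => dgx x _) (cont _ _).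
  rewrite in_itv/= => xis E; exists xi; last by rewrite -opprB E -mulrN opprB.
  by apply: le_lt_trans Hda; move: lt xis; clear => lt xis; rewrite !ger0_norm; lra.
have Hg : `|gx (al s) (be s) - gx xi (be (h + s))| <= e / 2 / (`|da| + 1).
  by apply: (Hr (xi, be (h + s))); split.
set D := al (h + s) - al s in Hd1 *.
have -> : gx xi (be (h + s)) * D - gx (al s) (be s) * da * h =
  gx (al s) (be s) * (D - da * h) - (gx (al s) (be s) - gx xi (be (h + s))) * D by ring.
apply: le_trans (ler_normB _ _) _; rewrite !normrM.
have D1 : `|D - da * h| <= `|h|.
  by apply: le_trans Hd1 _; rewrite ler_piMl// ge_min lexx.
have D2 : `|D - da * h| <= e / 2 / (`|gx (al s) (be s)| + 1) * `|h|.
  by apply: le_trans Hd1 _; rewrite ler_wpM2r// ge_min lexx orbT.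
have D3 : `|D| <= (`|da| + 1) * `|h|.
  rewrite -[D](subrK (da * h)) (le_trans (ler_normD _ _))// normrM mulrDl mul1r addrC.
  by rewrite lerD2l.
have T1 : `|gx (al s) (be s)| * `|D - da * h| <= e / 2 * `|h|.
  have : `|gx (al s) (be s)| * `|D - da * h| <=
    (`|gx (al s) (be s)| + 1) * (e / 2 / (`|gx (al s) (be s)| + 1) * `|h|).
    by apply: ler_pM => //; rewrite lerDl.
  by rewrite mulrA (mulrC (_ + 1)) divfK ?gt_eqF.
have T2 : `|gx (al s) (be s) - gx xi (be (h + s))| * `|D| <= e / 2 * `|h|.
  have : `|gx (al s) (be s) - gx xi (be (h + s))| * `|D| <=
    e / 2 / (`|da| + 1) * ((`|da| + 1) * `|h|) by apply: ler_pM.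
  by rewrite mulrA divfK ?gt_eqF.
by move: T1 T2; clear; lra.
Qed.

End PlaneChainRule.

(** * The distance to the axis *)

Section Radius.
Context {R : realType}.
Implicit Types (x y : R).

Definition radius x y := Num.sqrt (x ^+ 2 + y ^+ 2).

Lemma radiusC x y : radius x y = radius y x.
Proof. by rewrite /radius addrC. Qed.

Lemma radius_sqr x y : radius x y ^+ 2 = x ^+ 2 + y ^+ 2.
Proof. by rewrite sqr_sqrtr// addr_ge0// sqr_ge0. Qed.

Lemma radius_ge0 x y : 0 <= radius x y. Proof. exact: sqrtr_ge0. Qed.

Lemma radius_eq0 x y : radius x y = 0 -> x = 0 /\ y = 0.
Proof.
move=> r0; have := radius_sqr x y; rewrite r0 expr0n/= => /esym/eqP.
by rewrite paddr_eq0 ?sqr_ge0// !sqrf_eq0 => /andP[/eqP-> /eqP->].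
Qed.

Lemma radius0 x : 0 <= x -> radius x 0 = x.
Proof. by move=> x0; rewrite /radius expr0n/= addr0 sqrtr_sqr ger0_norm. Qed.

Lemma radius_near x y x' : `|x' - x| < radius x y -> 0 < radius x' y.
Proof.
move=> H; rewrite lt_neqAle radius_ge0 andbT eq_sym; apply/eqP => /radius_eq0[x0 y0].
by move: H; rewrite x0 y0 sub0r normrN /radius expr0n/= addr0 sqrtr_sqr ltxx.
Qed.

Lemma is_derive_radius x y : 0 < radius x y ->
  is_derive x 1 (radius^~ y) (x / radius x y).
Proof.
move=> r0; have s0 : 0 < x ^+ 2 + y ^+ 2 by rewrite -radius_sqr exprn_gt0.
have := der_comp _ (fun x => x ^+ 2 + y ^+ 2) _ _ _ (is_derive1_sqrt s0)
  (derD _ _ _ _ _ (der_sqr _ _ _ (der_id x)) (der_cst x (y ^+ 2))).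
rewrite addr0 mulr1 (_ : (2 * _)^-1 * (2 * x) = x / radius x y)//.
rewrite -/(radius x y); field; by rewrite gt_eqF.
Qed.

Lemma is_derive_unique (f : R -> R) x (l l' : R) :
  is_derive x 1 f l -> is_derive x 1 f l' -> l = l'.
Proof. by move=> [_ <-] [_ <-]. Qed.

End Radius.

(** * Angular momentum in Cartesian coordinates *)

Section SwirlEquation.
Context {R : realType}.
Implicit Types (x y z r : R).
Variables (nu : R) (b br bz brr bzz bt a ar c : R -> R -> R).
Hypotheses
  (b_r : forall r z, is_derive r 1 (b^~ z) (br r z))
  (b_z : forall r z, is_derive z 1 (b r) (bz r z))
  (br_r : forall r z, is_derive r 1 (br^~ z) (brr r z))
  (bz_z : forall r z, is_derive z 1 (bz r) (bzz r z))
  (a_r : forall r z, is_derive r 1 (a^~ z) (ar r z)).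
Variables (U V W Ux Uy Uz Vx Vy Vz Uxx Uyy Uzz Vxx Vyy Vzz Ut Vt P Px Py :
  R -> R -> R -> R).
Hypotheses
  (dUx : forall x y z, is_derive x 1 (fun x => U x y z) (Ux x y z))
  (dUy : forall x y z, is_derive y 1 (fun y => U x y z) (Uy x y z))
  (dUz : forall x y z, is_derive z 1 (fun z => U x y z) (Uz x y z))
  (dVx : forall x y z, is_derive x 1 (fun x => V x y z) (Vx x y z))
  (dVy : forall x y z, is_derive y 1 (fun y => V x y z) (Vy x y z))
  (dVz : forall x y z, is_derive z 1 (fun z => V x y z) (Vz x y z))
  (dUxx : forall x y z, is_derive x 1 (fun x => Ux x y z) (Uxx x y z))
  (dUyy : forall x y z, is_derive y 1 (fun y => Uy x y z) (Uyy x y z))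
  (dUzz : forall x y z, is_derive z 1 (fun z => Uz x y z) (Uzz x y z))
  (dVxx : forall x y z, is_derive x 1 (fun x => Vx x y z) (Vxx x y z))
  (dVyy : forall x y z, is_derive y 1 (fun y => Vy x y z) (Vyy x y z))
  (dVzz : forall x y z, is_derive z 1 (fun z => Vz x y z) (Vzz x y z))
  (dPx : forall x y z, is_derive x 1 (fun x => P x y z) (Px x y z))
  (dPy : forall x y z, is_derive y 1 (fun y => P x y z) (Py x y z))
  (cPx : forall z, continuous2 (fun x y => Px x y z))
  (NSx : forall x y z,
     Ut x y z + (U x y z * Ux x y z + V x y z * Uy x y z + W x y z * Uz x y z) =
     - Px x y z + nu * (Uxx x y z + Uyy x y z + Uzz x y z))
  (NSy : forall x y z,
     Vt x y z + (U x y z * Vx x y z + V x y z * Vy x y z + W x y z * Vz x y z) =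
     - Py x y z + nu * (Vxx x y z + Vyy x y z + Vzz x y z))
  (UE : forall x y z, U x y z = a (radius x y) z * (x / radius x y) -
     b (radius x y) z * (y / radius x y))
  (VE : forall x y z, V x y z = a (radius x y) z * (y / radius x y) +
     b (radius x y) z * (x / radius x y))
  (WE : forall x y z, W x y z = c (radius x y) z)
  (tE : forall x y z, x * Vt x y z - y * Ut x y z = radius x y * bt (radius x y) z).

Let G r z := r * b r z.
Let Gr r z := b r z + r * br r z.
Let Grr r z := 2 * br r z + r * brr r z.

Let dG r z : is_derive r 1 (G^~ z) (Gr r z).
Proof. by have := derM _ _ _ _ _ (der_id r) (b_r r z); rewrite mul1r. Qed.

Let dGr r z : is_derive r 1 (Gr^~ z) (Grr r z).
Proof.
have := derD _ _ _ _ _ (b_r r z) (derM _ _ _ _ _ (der_id r) (br_r r z)).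
by rewrite mul1r addrA /Grr mulr_natl mulr2n.
Qed.

Let moment x y z := x * V x y z - y * U x y z.

Lemma momentE x y z : moment x y z = G (radius x y) z.
Proof.
rewrite /moment UE VE /G; have [r0|r0] := eqVneq (radius x y) 0.
  by rewrite r0; have [-> ->] := radius_eq0 _ _ r0; rewrite !mul0r subr0.
have -> : radius x y * b (radius x y) z = radius x y ^+ 2 / radius x y * b (radius x y) z.
  by field.
by rewrite radius_sqr; field.
Qed.

Lemma is_derive_of_radius (f df : R -> R) x y :
  (forall r, is_derive r 1 f (df r)) -> 0 < radius x y ->
  is_derive x 1 (fun x => f (radius x y)) (df (radius x y) * (x / radius x y)).
Proof. by move=> dfE r0; apply: der_comp; exact: is_derive_radius. Qed.

(** [y^2 / r^3] is the derivative of [x / r] with respect to [x]. *)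
Lemma is_derive2_of_radius (df ddf : R -> R) x y :
  (forall r, is_derive r 1 df (ddf r)) -> 0 < radius x y ->
  is_derive x 1 (fun x => df (radius x y) * (x / radius x y))
    (ddf (radius x y) * (x / radius x y) ^+ 2 +
     df (radius x y) * (y ^+ 2 / radius x y ^+ 3)).
Proof.
move=> ddfE r0; have rn0 : radius x y != 0 by rewrite gt_eqF.
have := derM _ _ _ _ _ (is_derive_of_radius df ddf x y ddfE r0)
  (derM _ _ _ _ _ (der_id x) (der_comp _ (radius^~ y) _ _ _ (derV _ rn0)
    (is_derive_radius x y r0))).
set l := (X in is_derive _ _ _ X -> _); set l' := (X in _ -> is_derive _ _ _ X).
suff -> : l = l' by [].
rewrite /l /l'.
have -> : y ^+ 2 = radius x y ^+ 2 - x ^+ 2 by rewrite radius_sqr; ring.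
by field.
Qed.

(** The formula for the first derivative holds on a neighbourhood that avoids the axis, hence can be
    differentiated again; the [y]-derivatives follow by exchanging the coordinates in [radius]. *)
Lemma radial_laplacian (f df ddf : R -> R) (g gx gy gxx gyy : R -> R -> R) x y :
  (forall r, is_derive r 1 f (df r)) -> (forall r, is_derive r 1 df (ddf r)) ->
  (forall x y, g x y = f (radius x y)) ->
  (forall x y, is_derive x 1 (g^~ y) (gx x y)) ->
  (forall x y, is_derive y 1 (g x) (gy x y)) ->
  (forall x y, is_derive x 1 (gx^~ y) (gxx x y)) ->
  (forall x y, is_derive y 1 (gy x) (gyy x y)) ->
  0 < radius x y ->
  [/\ gx x y = df (radius x y) * (x / radius x y),
      gy x y = df (radius x y) * (y / radius x y) &
      gxx x y + gyy x y = ddf (radius x y) + df (radius x y) / radius x y].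
Proof.
move=> dfE ddfE gE dgx dgy dgxx dgyy r0.
have gxE x' y' : 0 < radius x' y' -> gx x' y' = df (radius x' y') * (x' / radius x' y').
  move=> r0'; apply: is_derive_unique (dgx x' y') _.
  rewrite (_ : g^~ y' = fun x => f (radius x y')); last by apply/funext => q; rewrite gE.
  exact: is_derive_of_radius.
have gyE x' y' : 0 < radius x' y' -> gy x' y' = df (radius x' y') * (y' / radius x' y').
  move=> r0'; apply: is_derive_unique (dgy x' y') _.
  rewrite (_ : g x' = fun y => f (radius y x')); last first.
    by apply/funext => q; rewrite gE radiusC.
  by rewrite radiusC; apply: is_derive_of_radius; rewrite // radiusC.
split; [exact: gxE|exact: gyE|].
have -> : gxx x y = ddf (radius x y) * (x / radius x y) ^+ 2 +
    df (radius x y) * (y ^+ 2 / radius x y ^+ 3).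
  apply: is_derive_unique (dgxx x y) _.
  apply: is_derive_local r0 _ (is_derive2_of_radius df ddf x y ddfE r0) => x' /radius_near.
  exact: gxE.
have -> : gyy x y = ddf (radius x y) * (y / radius x y) ^+ 2 +
    df (radius x y) * (x ^+ 2 / radius x y ^+ 3).
  apply: is_derive_unique (dgyy x y) _.
  have r0' : 0 < radius y x by rewrite radiusC.
  rewrite radiusC.
  apply: is_derive_local r0' _ (is_derive2_of_radius df ddf y x ddfE r0') => y' /radius_near.
  by rewrite radiusC => /gyE ->; rewrite radiusC.
have rn0 : radius x y != 0 by rewrite gt_eqF.
transitivity (ddf (radius x y) * ((x ^+ 2 + y ^+ 2) / radius x y ^+ 2) +
    df (radius x y) * ((x ^+ 2 + y ^+ 2) / radius x y ^+ 3)); first by field.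
by rewrite -radius_sqr; field.
Qed.

Lemma is_derive_div_radius (f df : R -> R -> R) x y z : 0 < radius x y ->
  (forall r z, is_derive r 1 (f^~ z) (df r z)) ->
  is_derive x 1 (fun x => f (radius x y) z / radius x y)
    ((df (radius x y) z / radius x y - f (radius x y) z / radius x y ^+ 2) *
     (x / radius x y)).
Proof.
move=> r0 dfE; have rn0 : radius x y != 0 by rewrite gt_eqF.
apply: (der_comp (fun r => f r z / r)); last exact: is_derive_radius.
by have := derM _ _ _ _ _ (dfE (radius x y) z) (derV _ rn0); rewrite mulrN.
Qed.

(** On the plane [y = 0] this turns the Cartesian divergence into the cylindrical one. *)
Lemma transverse_derivative r z : 0 < r -> Vy r 0 z = a r z / r.
Proof.
move=> r0; have R0 : radius 0 r = r by rewrite radiusC radius0// ltW.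
have r0' : 0 < radius 0 r by rewrite R0.
apply: is_derive_unique (dVy r 0 z) _.
rewrite (_ : (fun y => V r y z) = fun y => a (radius y r) z / radius y r * y +
  b (radius y r) z / radius y r * r); last first.
  by apply/funext => q; rewrite VE radiusC; ring.
have := derD _ _ _ _ _ (derM _ _ _ _ _ (is_derive_div_radius a ar 0 r z r0' a_r) (der_id 0))
  (derM _ _ _ _ _ (is_derive_div_radius b br 0 r z r0' b_r) (der_cst 0 r)).
by rewrite R0 !(mul0r, mulr0, mulr1, add0r, addr0).
Qed.

(** The axial vorticity, which enters as the cross term in the Laplacian of the angular momentum. *)
Lemma vorticityE x y z : 0 < radius x y ->
  Vx x y z - Uy x y z = Gr (radius x y) z / radius x y.
Proof.
move=> r0; have rn0 : radius x y != 0 by rewrite gt_eqF.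
have r0' : 0 < radius y x by rewrite radiusC.
have VxE : Vx x y z = (ar (radius x y) z / radius x y - a (radius x y) z / radius x y ^+ 2) *
      (x / radius x y) * y + ((br (radius x y) z / radius x y -
        b (radius x y) z / radius x y ^+ 2) * (x / radius x y) * x + b (radius x y) z / radius x y).
  apply: is_derive_unique (dVx x y z) _.
  rewrite (_ : (fun x => V x y z) = fun x => a (radius x y) z / radius x y * y +
    b (radius x y) z / radius x y * x); last by apply/funext => q; rewrite VE; ring.
  have := derD _ _ _ _ _ (derM _ _ _ _ _ (is_derive_div_radius a ar x y z r0 a_r) (der_cst x y))
    (derM _ _ _ _ _ (is_derive_div_radius b br x y z r0 b_r) (der_id x)).
  by rewrite mulr0 addr0 mulr1.
have UyE : Uy x y z = (ar (radius x y) z / radius x y - a (radius x y) z / radius x y ^+ 2) *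
      (y / radius x y) * x - ((br (radius x y) z / radius x y -
        b (radius x y) z / radius x y ^+ 2) * (y / radius x y) * y + b (radius x y) z / radius x y).
  apply: is_derive_unique (dUy x y z) _.
  rewrite (_ : (fun y => U x y z) = fun y => a (radius y x) z / radius y x * x -
    b (radius y x) z / radius y x * y); last first.
    by apply/funext => q; rewrite UE radiusC; ring.
  have := derB _ _ _ _ _ (derM _ _ _ _ _ (is_derive_div_radius a ar y x z r0' a_r) (der_cst y x))
    (derM _ _ _ _ _ (is_derive_div_radius b br y x z r0' b_r) (der_id y)).
  by rewrite mulr0 addr0 mulr1 (radiusC y x).
rewrite VxE UyE /Gr.
have -> : (b (radius x y) z + radius x y * br (radius x y) z) / radius x y =
  2 * b (radius x y) z / radius x y + (br (radius x y) z / radius x y -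
  b (radius x y) z / radius x y ^+ 2) / radius x y * radius x y ^+ 2 by field.
by rewrite [X in _ = _ + _ * X]radius_sqr; field.
Qed.

Let defect r z := r * bt r z + a r z * Gr r z + c r z * (r * bz r z) -
  nu * (Grr r z - Gr r z / r + r * bzz r z).

(** Take [x] times the second momentum equation minus [y] times the first. Advection produces no
    extra term, as [U V - V U = 0]. The Laplacian of [x V - y U] exceeds the combination of
    Laplacians by twice the vorticity, that is [2 Gr / r], which turns the [+ Gr / r] of the planar
    Laplacian into [- Gr / r]. *)
Lemma pressure_momentE x y z : 0 < radius x y ->
  x * Py x y z - y * Px x y z = - defect (radius x y) z.
Proof.
move=> r0; have rn0 : radius x y != 0 by rewrite gt_eqF.
pose mx x y := V x y z + x * Vx x y z - y * Ux x y z.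
pose my x y := x * Vy x y z - (U x y z + y * Uy x y z).
pose mxx x y := 2 * Vx x y z + x * Vxx x y z - y * Uxx x y z.
pose myy x y := x * Vyy x y z - (2 * Uy x y z + y * Uyy x y z).
have dmx : forall x y : R, is_derive x 1 (fun x => moment x y z) (mx x y).
  move=> x' y'.
  have := derB _ _ _ _ _ (derM _ _ _ _ _ (der_id x') (dVx x' y' z))
    (derM _ _ _ _ _ (der_cst x' y') (dUx x' y' z)).
  by rewrite mul1r mul0r add0r.
have dmy : forall x y : R, is_derive y 1 (fun y => moment x y z) (my x y).
  move=> x' y'.
  have := derB _ _ _ _ _ (derM _ _ _ _ _ (der_cst y' x') (dVy x' y' z))
    (derM _ _ _ _ _ (der_id y') (dUy x' y' z)).
  by rewrite mul1r mul0r add0r.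
have dmxx : forall x y : R, is_derive x 1 (fun x => mx x y) (mxx x y).
  move=> x' y'.
  have := derB _ _ _ _ _ (derD _ _ _ _ _ (dVx x' y' z)
    (derM _ _ _ _ _ (der_id x') (dVxx x' y' z)))
    (derM _ _ _ _ _ (der_cst x' y') (dUxx x' y' z)).
  by rewrite mul1r mul0r add0r addrA (_ : Vx x' y' z + Vx x' y' z = 2 * Vx x' y' z); last by ring.
have dmyy : forall x y : R, is_derive y 1 (fun y => my x y) (myy x y).
  move=> x' y'.
  have := derB _ _ _ _ _ (derM _ _ _ _ _ (der_cst y' x') (dVyy x' y' z))
    (derD _ _ _ _ _ (dUy x' y' z) (derM _ _ _ _ _ (der_id y') (dUyy x' y' z))).
  by rewrite mul1r mul0r add0r addrA (_ : Uy x' y' z + Uy x' y' z = 2 * Uy x' y' z); last by ring.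
have [mxE myE lapE] := radial_laplacian (G^~ z) (Gr^~ z) (Grr^~ z)
  (fun x y => moment x y z) mx my mxx myy x y (fun r => dG r z) (fun r => dGr r z)
  (fun x y => momentE x y z) dmx dmy dmxx dmyy r0.
have mz q : x * Vz x y q - y * Uz x y q = radius x y * bz (radius x y) q.
  have D1 : is_derive q 1 (fun z => moment x y z) (x * Vz x y q - y * Uz x y q).
    have := derB _ _ _ _ _ (derM _ _ _ _ _ (der_cst q x) (dVz x y q))
      (derM _ _ _ _ _ (der_cst q y) (dUz x y q)).
    by rewrite !mul0r !add0r.
  apply: is_derive_unique D1 _.
  rewrite (_ : (fun z => moment x y z) = fun z => radius x y * b (radius x y) z); last first.
    by apply/funext => q'; rewrite momentE.
  by have := derM _ _ _ _ _ (der_cst q (radius x y)) (b_z (radius x y) q); rewrite mul0r add0r.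
have mzz : x * Vzz x y z - y * Uzz x y z = radius x y * bzz (radius x y) z.
  have D1 : is_derive z 1 (fun z => x * Vz x y z - y * Uz x y z)
      (x * Vzz x y z - y * Uzz x y z).
    have := derB _ _ _ _ _ (derM _ _ _ _ _ (der_cst z x) (dVzz x y z))
      (derM _ _ _ _ _ (der_cst z y) (dUzz x y z)).
    by rewrite !mul0r !add0r.
  apply: is_derive_unique D1 _.
  rewrite (_ : (fun z => _) = fun z => radius x y * bz (radius x y) z); last first.
    by apply/funext => q; rewrite mz.
  by have := derM _ _ _ _ _ (der_cst z (radius x y)) (bz_z (radius x y) z); rewrite mul0r add0r.
have vort := vorticityE x y z r0.
have radial : U x y z * x + V x y z * y = a (radius x y) z * radius x y.
  rewrite UE VE.
  have -> : a (radius x y) z * radius x y = a (radius x y) z * (radius x y ^+ 2 / radius x y).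
    by field.
  by rewrite radius_sqr; field.
have adv : U x y z * mx x y + V x y z * my x y = a (radius x y) z * Gr (radius x y) z.
  rewrite mxE myE.
  have -> : a (radius x y) z * Gr (radius x y) z =
    a (radius x y) z * radius x y * (Gr (radius x y) z / radius x y) by field.
  by rewrite -radial; field.
have -> : Py x y z = nu * (Vxx x y z + Vyy x y z + Vzz x y z) -
    (Vt x y z + (U x y z * Vx x y z + V x y z * Vy x y z + W x y z * Vz x y z)).
  by rewrite NSy; ring.
have -> : Px x y z = nu * (Uxx x y z + Uyy x y z + Uzz x y z) -
    (Ut x y z + (U x y z * Ux x y z + V x y z * Uy x y z + W x y z * Uz x y z)).
  by rewrite NSx; ring.
transitivity (nu * ((mxx x y + myy x y) - 2 * (Vx x y z - Uy x y z) +
     (x * Vzz x y z - y * Uzz x y z)) - (x * Vt x y z - y * Ut x y z) -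
   (U x y z * mx x y + V x y z * my x y + W x y z * (x * Vz x y z - y * Uz x y z))).
  by rewrite /mxx /myy /mx /my; ring.
by rewrite lapE vort mzz tE adv mz WE /defect; field.
Qed.

(* The angular derivative of the pressure is constant on a circle, hence zero
   because the pressure is periodic there. *)
Lemma swirl_equation r z : 0 < r ->
  r * bt r z + a r z * (b r z + r * br r z) + c r z * (r * bz r z) =
  nu * (2 * br r z + r * brr r z - (b r z + r * br r z) / r + r * bzz r z).
Proof.
move=> r0; suff : defect r z = 0 by rewrite /defect /Gr /Grr => /eqP; rewrite subr_eq0 => /eqP.
have circ (q : R) : radius (r * cos q) (r * sin q) = r.
  by rewrite /radius !exprMn -mulrDr cos2Dsin2 mulr1 sqrtr_sqr gtr0_norm.
pose f (q : R) : R := P (r * cos q) (r * sin q) z.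
have df (q : R) : is_derive q 1 f (- defect r z).
  have dc : is_derive q 1 (fun q => r * cos q) (- (r * sin q)).
    by have := derM _ _ _ _ _ (der_cst q r) (is_derive_cos q); rewrite mul0r add0r mulrN.
  have ds : is_derive q 1 (fun q => r * sin q) (r * cos q).
    by have := derM _ _ _ _ _ (der_cst q r) (is_derive_sin q); rewrite mul0r add0r.
  have := is_derive_plane_curve (fun x y => P x y z) (fun x y => Px x y z)
    (fun x y => Py x y z) (fun x y => dPx x y z) (fun x y => dPy x y z) (cPx z)
    _ _ q _ _ dc ds.
  rewrite (_ : _ + _ = - defect r z)//.
  have := pressure_momentE (r * cos q) (r * sin q) z; rewrite circ => /(_ r0) <-.
  by ring.
have cf x y : {within `[x, y], continuous f}.
  by apply: continuous_subspaceT => q; exact: is_derive_continuous.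
have pip : - pi < pi :> R by have := pi_gt0 R; lra.
have [q _] := MVT pip (fun x _ => df x) (cf _ _).
rewrite /f cosN sinN sinpi oppr0 subrr => /esym/eqP; rewrite mulf_eq0 oppr_eq0.
by case/orP => /eqP // p0; have := pi_gt0 R; lra.
Qed.

End SwirlEquation.

(** * Axisymmetric solutions of the Navier-Stokes equations *)

Section SmoothFunctions.
Context {R : realType} {V : normedModType R}.
Implicit Types (S : set V) (f : V -> R) (v : V).

Lemma smooth_on_continuous S f x : smooth_on S f -> S x -> {for x, continuous f}.
Proof. by move=> sf Sx; have [+ _] := sf 0%N; exact. Qed.

Lemma smooth_on_derivable S f v x : smooth_on S f -> S x -> derivable f x v.
Proof. by move=> sf Sx; have [_ /(_ v)[+ _]] := sf 1%N; exact. Qed.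

Lemma smooth_on_derive S f v : smooth_on S f -> smooth_on S ('D_v f).
Proof. by move=> sf k; have [_ /(_ v)[_]] := sf k.+1. Qed.

Lemma is_derive_line S f v (g : R -> V) (s : R) : smooth_on S f -> S (g s) ->
  (forall h : R, g (h + s) = h *: v + g s) ->
  is_derive s 1 (fun q => f (g q)) ('D_v f (g s)).
Proof.
move=> sf Sg gE; have df := smooth_on_derivable S f v _ sf Sg.
have qE : (fun h : R => h^-1 *: (((fun q => f (g q)) \o shift s) (h *: 1) - f (g s))) =
    (fun h : R => h^-1 *: ((f \o shift (g s)) (h *: v) - f (g s))).
  by apply/funext => h /=; rewrite /GRing.scale/= mulr1 gE.
by split; [rewrite /derivable qE|rewrite /derive qE].
Qed.

End SmoothFunctions.

Section CartesianPoints.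
Context {R : realType}.
Implicit Types (x y z r s t : R).

Definition point3 x y z : 'rV[R]_3 :=
  x *: delta_mx 0 0 + y *: delta_mx 0 1 + z *: delta_mx 0 2.

Lemma point3E x y z : [/\ point3 x y z 0 0 = x, point3 x y z 0 1 = y & point3 x y z 0 2 = z].
Proof.
by rewrite /point3 !mxE/= !mulr1 !mulr0 !addr0 !add0r.
Qed.

Lemma point3_0 x y z h : point3 (h + x) y z = h *: delta_mx 0 0 + point3 x y z.
Proof. by rewrite /point3 scalerDl -!addrA. Qed.

Lemma point3_1 x y z h : point3 x (h + y) z = h *: delta_mx 0 1 + point3 x y z.
Proof. by rewrite /point3 scalerDl addrCA !addrA. Qed.

Lemma point3_2 x y z h : point3 x y (h + z) = h *: delta_mx 0 2 + point3 x y z.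
Proof. by rewrite /point3 scalerDl addrCA. Qed.

Lemma continuous_pair_comp (T : topologicalType) (U W : normedModType R)
    (f : U * W -> R) (g : T -> U) (h : T -> W) (q : T) :
  {for q, continuous g} -> {for q, continuous h} ->
  {for (g q, h q), continuous f} -> {for q, continuous (fun q => f (g q, h q))}.
Proof.
move=> cg ch cf.
apply: (@continuous_comp _ _ _ (fun q => (g q, h q)) f) => //.
exact: (@cvg_pair _ _ _ (nbhs q) (nbhs (g q)) (nbhs (h q)) _ _ _ g h cg ch).
Qed.

Lemma continuous_point3 (T : topologicalType) (f g h : T -> R) (q : T) :
  {for q, continuous f} -> {for q, continuous g} -> {for q, continuous h} ->
  {for q, continuous (fun q => point3 (f q) (g q) (h q))}.
Proof.
move=> cf cg ch; apply: cvgD; first apply: cvgD.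
- by apply: cvgZr_tmp.
- by apply: cvgZr_tmp.
- by apply: cvgZr_tmp.
Qed.

Lemma axisym_fieldE (ur uth uz : R -> R -> R -> R) x y z t :
  [/\ axisym_field ur uth uz (point3 x y z) t 0 0 =
        ur (radius x y) z t * (x / radius x y) - uth (radius x y) z t * (y / radius x y),
      axisym_field ur uth uz (point3 x y z) t 0 1 =
        ur (radius x y) z t * (y / radius x y) + uth (radius x y) z t * (x / radius x y) &
      axisym_field ur uth uz (point3 x y z) t 0 2 = uz (radius x y) z t].
Proof.
have [p0 p1 p2] := point3E x y z.
have rE : rho (point3 x y z) = radius x y by rewrite /rho p0 p1.
rewrite /axisym_field /e_r /e_theta /e_z rE p0 p1 p2 !mxE/=.
by rewrite !(mulr0, mulr1, addr0, add0r) mulrN.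
Qed.

End CartesianPoints.

(** * Space-time derivatives of a solution along coordinate lines *)

Section FlowOfSolution.
Context {R : realType}.
Variables (nu : R) (J : set R) (ur uth uz : R -> R -> R -> R)
  (p : 'rV[R]_3 -> R -> R).
Hypothesis u_NS : smooth_NS_solution nu J (axisym_field ur uth uz) p.
Implicit Types (x y z r s h : R).

Definition space_time : set ('rV[R]_3 * R) := [set y | J y.2].

Definition velocity (i : 'I_3) (y : 'rV[R]_3 * R) : R := axisym_field ur uth uz y.1 y.2 0 i.

Definition dspace (j : 'I_3) (f : 'rV[R]_3 * R -> R) := 'D_((delta_mx 0 j, 0) : 'rV[R]_3 * R) f.

Definition dtime (f : 'rV[R]_3 * R -> R) := 'D_((0, 1) : 'rV[R]_3 * R) f.

(** Derivatives of a time slice become space-time derivatives, which are again smooth on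
    [space_time] and can be iterated. *)
Lemma partial_slice (f : 'rV[R]_3 * R -> R) (j : 'I_3) s :
  partial j (fun q => f (q, s)) = fun q => dspace j f (q, s).
Proof.
apply/funext => q; rewrite /partial /dspace /derive.
have -> // : (fun h : R => h^-1 *: (((fun q => f (q, s)) \o shift q) (h *: delta_mx 0 j) -
    f (q, s))) =
  (fun h : R => h^-1 *: ((f \o shift (q, s)) (h *: ((delta_mx 0 j, 0) : 'rV[R]_3 * R)) -
    f (q, s))).
apply/funext => h /=; congr (_ *: (f _ - _)).
transitivity ((h *: delta_mx 0 j + q, h *: 0 + s) : 'rV[R]_3 * R); last by [].
by rewrite scaler0 add0r.
Qed.

Section Lines.
Variable f : 'rV[R]_3 * R -> R.
Hypothesis sf : smooth_on space_time f.

Lemma is_derive_point3_0 x y z s : J s ->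
  is_derive x 1 (fun x => f (point3 x y z, s)) (dspace 0 f (point3 x y z, s)).
Proof.
move=> Js; apply: (is_derive_line _ _ _ (fun x => (point3 x y z, s)) x sf) => // h.
transitivity ((h *: delta_mx 0 0 + point3 x y z, h *: 0 + s) : 'rV[R]_3 * R); last by [].
by rewrite point3_0 scaler0 add0r.
Qed.

Lemma is_derive_point3_1 x y z s : J s ->
  is_derive y 1 (fun y => f (point3 x y z, s)) (dspace 1 f (point3 x y z, s)).
Proof.
move=> Js; apply: (is_derive_line _ _ _ (fun y => (point3 x y z, s)) y sf) => // h.
transitivity ((h *: delta_mx 0 1 + point3 x y z, h *: 0 + s) : 'rV[R]_3 * R); last by [].
by rewrite point3_1 scaler0 add0r.
Qed.

Lemma is_derive_point3_2 x y z s : J s ->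
  is_derive z 1 (fun z => f (point3 x y z, s)) (dspace 2 f (point3 x y z, s)).
Proof.
move=> Js; apply: (is_derive_line _ _ _ (fun z => (point3 x y z, s)) z sf) => // h.
transitivity ((h *: delta_mx 0 2 + point3 x y z, h *: 0 + s) : 'rV[R]_3 * R); last by [].
by rewrite point3_2 scaler0 add0r.
Qed.

Lemma is_derive_point3_t x y z s : J s ->
  is_derive s 1 (fun s => f (point3 x y z, s)) (dtime f (point3 x y z, s)).
Proof.
move=> Js; apply: (is_derive_line _ _ _ (fun s => (point3 x y z, s)) s sf) => // h.
transitivity ((h *: 0 + point3 x y z, h *: 1 + s) : 'rV[R]_3 * R); last by [].
by rewrite scaler0 add0r /GRing.scale/= mulr1.
Qed.

Lemma continuous_point3_comp (T : topologicalType) (g h k l : T -> R) (q : T) :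
  J (l q) -> {for q, continuous g} -> {for q, continuous h} ->
  {for q, continuous k} -> {for q, continuous l} ->
  {for q, continuous (fun q => f (point3 (g q) (h q) (k q), l q))}.
Proof.
move=> Jl cg ch ck cl; apply: continuous_pair_comp cl _; first exact: continuous_point3.
exact: smooth_on_continuous sf _.
Qed.

Lemma continuous2_meridian s : J s -> continuous2 (fun r z => f (point3 r 0 z, s)).
Proof.
move=> Js [r z].
have c1 : {for (r, z), continuous (@fst R R)} by exact: cvg_fst.
have c2 : {for (r, z), continuous (@snd R R)} by exact: cvg_snd.
have c3 x : {for (r, z), continuous (fun _ : R * R => x)} by exact: cvg_cst.
exact: (continuous_point3_comp _ _ _ _ (fun=> s) (r, z) Js c1 (c3 0) c2 (c3 s)).
Qed.

Lemma continuous2_horizontal z s : J s -> continuous2 (fun x y => f (point3 x y z, s)).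
Proof.
move=> Js [x y].
have c1 : {for (x, y), continuous (@fst R R)} by exact: cvg_fst.
have c2 : {for (x, y), continuous (@snd R R)} by exact: cvg_snd.
have c3 (u : R) : {for (x, y), continuous (fun _ : R * R => u)} by exact: cvg_cst.
exact: (continuous_point3_comp _ _ _ _ (fun=> s) (x, y) Js c1 c2 (c3 z) (c3 s)).
Qed.

End Lines.

Lemma smooth_dspace f j : smooth_on space_time f -> smooth_on space_time (dspace j f).
Proof. exact: smooth_on_derive. Qed.

Lemma smooth_dtime f : smooth_on space_time f -> smooth_on space_time (dtime f).
Proof. exact: smooth_on_derive. Qed.

Lemma smooth_velocity i : smooth_on space_time (velocity i).
Proof. by have [sv _ _ _] := u_NS; exact: sv. Qed.

Lemma sum_ord3 (F : 'I_3 -> R) : \sum_(j < 3) F j = F 0 + F 1 + F 2.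
Proof.
rewrite !big_ord_recl big_ord0 addr0 addrA; congr (F _ + F _ + F _); exact: val_inj.
Qed.

Lemma divergence_free (q : 'rV[R]_3) s : J s ->
  dspace 0 (velocity 0) (q, s) + dspace 1 (velocity 1) (q, s) +
  dspace 2 (velocity 2) (q, s) = 0.
Proof.
move=> Js; have [_ _ + _] := u_NS; move=> /(_ q s Js); rewrite sum_ord3.
by rewrite (partial_slice (velocity 0) 0) (partial_slice (velocity 1) 1)
  (partial_slice (velocity 2) 2).
Qed.

Lemma momentum_equation x y z s i : J s -> let q := (point3 x y z, s) in
  dtime (velocity i) q + (velocity 0 q * dspace 0 (velocity i) q +
    velocity 1 q * dspace 1 (velocity i) q + velocity 2 q * dspace 2 (velocity i) q) =
  - dspace i (fun q : 'rV[R]_3 * R => p q.1 q.2) q + nu * (dspace 0 (dspace 0 (velocity i)) q +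
    dspace 1 (dspace 1 (velocity i)) q + dspace 2 (dspace 2 (velocity i)) q).
Proof.
move=> Js q; have [_ _ _ /(_ (point3 x y z) s i Js)] := u_NS; rewrite !sum_ord3.
have Ti : derive1 (fun q => axisym_field ur uth uz (point3 x y z) q 0 i) s =
    dtime (velocity i) (point3 x y z, s).
  rewrite derive1E.
  by have [_ <-] := is_derive_point3_t _ (smooth_velocity i) x y z s Js.
rewrite Ti (partial_slice (fun q : 'rV[R]_3 * R => p q.1 q.2) i s) !(partial_slice (velocity i)).
by rewrite (partial_slice (dspace 0 (velocity i))) (partial_slice (dspace 1 (velocity i)))
  (partial_slice (dspace 2 (velocity i))).
Qed.

End FlowOfSolution.

(** * Restriction of a solution to the plane [y = 0] *)

Section MeridianFlowOfSolution.
Context {R : realType}.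
Variables (nu : R) (J : set R) (ur uth uz : R -> R -> R -> R)
  (p : 'rV[R]_3 -> R -> R) (eta : R -> R -> R -> R).
Hypotheses (u_NS : smooth_NS_solution nu J (axisym_field ur uth uz) p)
  (eta_smooth : smooth_on setT (fun y : R * R * R => eta y.1.1 y.1.2 y.2)).
Implicit Types (x y z r s : R).

Let vel i := velocity ur uth uz i.
Let press (q : 'rV[R]_3 * R) := p q.1 q.2.
Let smv i : smooth_on (space_time J) (vel i) := smooth_velocity nu J ur uth uz p u_NS i.
Let smd i j : smooth_on (space_time J) (dspace j (vel i)) := smooth_dspace J _ j (smv i).
Let smp : smooth_on (space_time J) press.
Proof. by have [_ sp _ _] := u_NS. Qed.

(** A substitute for [uth] that is defined for all real [r] and smooth across the axis; the two
    agree for [r > 0]. *)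
Definition swirl s r z : R := velocity ur uth uz 1 (point3 r 0 z, s).
Definition swirl_t s r z : R := dtime (velocity ur uth uz 1) (point3 r 0 z, s).

Lemma swirlE s r z : 0 < r -> swirl s r z = uth r z s.
Proof.
move=> r0; rewrite /swirl /velocity /=; have [_ -> _] := axisym_fieldE ur uth uz r 0 z s.
by rewrite radius0 ?ltW// mul0r mulr0 add0r divff ?gt_eqF// mulr1.
Qed.

Lemma velocity_axis s z : velocity ur uth uz 0 (point3 0 0 z, s) = 0 /\ swirl s 0 z = 0.
Proof.
have [v0 v1 _] := axisym_fieldE ur uth uz 0 0 z s.
by split; [rewrite [LHS]v0|rewrite [LHS]v1]; rewrite !mul0r !mulr0 ?subr0 ?addr0.
Qed.

Lemma radial_velocityE s r z : 0 < r ->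
  velocity ur uth uz 0 (point3 r 0 z, s) = ur r z s.
Proof.
move=> r0; rewrite /velocity /=; have [-> _ _] := axisym_fieldE ur uth uz r 0 z s.
by rewrite radius0 ?ltW// mul0r mulr0 subr0 divff ?gt_eqF// mulr1.
Qed.

Lemma axial_velocityE s r z : 0 <= r ->
  velocity ur uth uz 2 (point3 r 0 z, s) = uz r z s.
Proof.
by move=> r0; rewrite /velocity /=; have [_ _ ->] := axisym_fieldE ur uth uz r 0 z s; rewrite radius0.
Qed.

(** The axisymmetric representation again, now with coefficients that are smooth in [rh]; on the
    axis both sides agree by [a / 0 = 0]. *)
Lemma velocity_componentsE s x y z : let rh := radius x y in
  [/\ vel 0 (point3 x y z, s) = vel 0 (point3 rh 0 z, s) * (x / rh) - swirl s rh z * (y / rh),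
      vel 1 (point3 x y z, s) = vel 0 (point3 rh 0 z, s) * (y / rh) + swirl s rh z * (x / rh) &
      vel 2 (point3 x y z, s) = vel 2 (point3 rh 0 z, s)].
Proof.
move=> rh; rewrite {1 3 5}/vel {1 2 3}/velocity /=; have [-> -> ->] := axisym_fieldE ur uth uz x y z s.
have [r0|r0] := eqVneq rh 0; last first.
  have r0' : 0 < rh by rewrite lt0r r0 radius_ge0.
  by rewrite /vel radial_velocityE// swirlE// axial_velocityE// ltW.
by rewrite /vel axial_velocityE ?radius_ge0// -/rh r0 invr0 !mulr0.
Qed.

Lemma swirl_moment s x y z :
  x * vel 1 (point3 x y z, s) - y * vel 0 (point3 x y z, s) =
  radius x y * swirl s (radius x y) z.
Proof.
exact: (momentE (swirl s) (fun r z => vel 0 (point3 r 0 z, s))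
  (fun x y z => vel 0 (point3 x y z, s)) (fun x y z => vel 1 (point3 x y z, s))
  (fun x y z => let: And3 H _ _ := velocity_componentsE s x y z in H)
  (fun x y z => let: And3 _ H _ := velocity_componentsE s x y z in H) x y z).
Qed.

Lemma swirl_moment_t s x y z : J s ->
  x * dtime (vel 1) (point3 x y z, s) - y * dtime (vel 0) (point3 x y z, s) =
  radius x y * swirl_t s (radius x y) z.
Proof.
move=> Js.
have := derB _ _ _ _ _
  (derM _ _ _ _ _ (der_cst s x) (is_derive_point3_t J _ (smv 1) x y z s Js))
  (derM _ _ _ _ _ (der_cst s y) (is_derive_point3_t J _ (smv 0) x y z s Js)).
rewrite !mul0r !add0r => D1; apply: is_derive_unique D1 _.
rewrite (_ : (fun _ => _) = fun s => radius x y * swirl s (radius x y) z); last first.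
  by apply/funext => q; exact: swirl_moment.
have := derM _ _ _ _ _ (der_cst s (radius x y))
  (is_derive_point3_t J _ (smv 1) (radius x y) 0 z s Js).
by rewrite mul0r add0r.
Qed.

Definition cutoff_along (v : R * R * R) s r z : R :=
  'D_v (fun y : R * R * R => eta y.1.1 y.1.2 y.2) (r, z, s).

Lemma is_derive_cutoff_r r z s :
  is_derive r 1 (fun r => eta r z s) (cutoff_along (1, 0, 0) s r z).
Proof.
apply: (is_derive_line _ _ _ (fun r => (r, z, s) : R * R * R) r eta_smooth) => // h.
transitivity ((h *: 1 + r, h *: 0 + z, h *: 0 + s) : R * R * R); last by [].
by rewrite !scaler0 !add0r /GRing.scale/= mulr1.
Qed.

Lemma is_derive_cutoff_z r z s :
  is_derive z 1 (fun z => eta r z s) (cutoff_along (0, 1, 0) s r z).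
Proof.
apply: (is_derive_line _ _ _ (fun z => (r, z, s) : R * R * R) z eta_smooth) => // h.
transitivity ((h *: 0 + r, h *: 1 + z, h *: 0 + s) : R * R * R); last by [].
by rewrite !scaler0 !add0r /GRing.scale/= mulr1.
Qed.

Lemma is_derive_cutoff_t r z s :
  is_derive s 1 (fun s => eta r z s) (cutoff_along (0, 0, 1) s r z).
Proof.
apply: (is_derive_line _ _ _ (fun s => (r, z, s) : R * R * R) s eta_smooth) => // h.
transitivity ((h *: 0 + r, h *: 0 + z, h *: 1 + s) : R * R * R); last by [].
by rewrite !scaler0 !add0r /GRing.scale/= mulr1.
Qed.

Lemma continuous2_slice (f : R * R * R -> R) s : smooth_on setT f ->
  continuous2 (fun r z => f (r, z, s)).
Proof.
move=> sf y; rewrite (_ : (fun _ => _) = fun y : R * R => f (y, s)); last first.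
  by apply/funext => -[].
apply: continuous_pair_comp; [exact: cvg_id|exact: cvg_cst|].
exact: smooth_on_continuous sf _.
Qed.

Lemma continuous2_cutoff s : continuous2 (fun r z => eta r z s).
Proof. exact: (continuous2_slice _ s eta_smooth). Qed.

Lemma continuous2_cutoff_along v s : continuous2 (cutoff_along v s).
Proof. exact: (continuous2_slice _ s (smooth_on_derive _ _ v eta_smooth)). Qed.

Lemma flow_of_solution s A : J s ->
  (forall r z, 0 < r -> eta r z s != 0 -> box A (r, z)) ->
  let v i r z := vel i (point3 r 0 z, s) in
  let dv i j r z := dspace j (vel i) (point3 r 0 z, s) in
  meridian_flow nu A (swirl s) (dv 1 0) (dv 1 2)
    (fun r z => dspace 0 (dspace 0 (vel 1)) (point3 r 0 z, s))
    (fun r z => dspace 2 (dspace 2 (vel 1)) (point3 r 0 z, s))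
    (swirl_t s) (v 0) (dv 0 0) (v 2) (dv 2 2)
    (fun r z => eta r z s) (cutoff_along (1, 0, 0) s) (cutoff_along (0, 1, 0) s).
Proof.
move=> Js supp v dv.
have cJ f : smooth_on (space_time J) f -> continuous2 (fun r z => f (point3 r 0 z, s)).
  by move=> sf; exact: continuous2_meridian sf s Js.
split.
- split; split.
  + exact: cJ _ (smv 1).
  + exact: cJ _ (smd 1 0).
  + exact: cJ _ (smd 1 2).
  + exact: cJ _ (smooth_dspace J _ 0 (smd 1 0)).
  + exact: cJ _ (smooth_dspace J _ 2 (smd 1 2)).
  + exact: cJ _ (smooth_dtime J _ (smv 1)).
  + exact: cJ _ (smv 0).
  + exact: cJ _ (smd 0 0).
  + exact: cJ _ (smv 2).
  + exact: cJ _ (smd 2 2).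
  + exact: continuous2_cutoff.
  + exact: continuous2_cutoff_along.
  + exact: continuous2_cutoff_along.
- by move=> r z; exact: is_derive_point3_0 (smv 1) r 0 z s Js.
- by move=> r z; exact: is_derive_point3_2 (smv 1) r 0 z s Js.
- by move=> r z; exact: is_derive_point3_0 (smd 1 0) r 0 z s Js.
- by move=> r z; exact: is_derive_point3_2 (smd 1 2) r 0 z s Js.
- by move=> r z; exact: is_derive_point3_0 (smv 0) r 0 z s Js.
- by move=> r z; exact: is_derive_point3_2 (smv 2) r 0 z s Js.
- by move=> r z; exact: is_derive_cutoff_r.
- by move=> r z; exact: is_derive_cutoff_z.
- by move=> z; have [] := velocity_axis s z.
- by move=> z; have [] := velocity_axis s z.
- exact: supp.
- move=> r z r0.
  have := divergence_free nu J ur uth uz p u_NS (point3 r 0 z) s Js.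
  rewrite (transverse_derivative (swirl s) (dv 1 0) (v 0) (dv 0 0)
    (fun r z => is_derive_point3_0 J _ (smv 1) r 0 z s Js)
    (fun r z => is_derive_point3_0 J _ (smv 0) r 0 z s Js)
    (fun x y z => vel 1 (point3 x y z, s)) (fun x y z => dspace 1 (vel 1) (point3 x y z, s))
    (fun x y z => is_derive_point3_1 J _ (smv 1) x y z s Js)
    (fun x y z => let: And3 _ H _ := velocity_componentsE s x y z in H) r z r0).
  by [].
- move=> r z r0.
  apply: (swirl_equation nu (swirl s) (dv 1 0) (dv 1 2)
    (fun r z => dspace 0 (dspace 0 (vel 1)) (point3 r 0 z, s))
    (fun r z => dspace 2 (dspace 2 (vel 1)) (point3 r 0 z, s))
    (swirl_t s) (v 0) (dv 0 0) (v 2)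
    (fun r z => is_derive_point3_0 J _ (smv 1) r 0 z s Js)
    (fun r z => is_derive_point3_2 J _ (smv 1) r 0 z s Js)
    (fun r z => is_derive_point3_0 J _ (smd 1 0) r 0 z s Js)
    (fun r z => is_derive_point3_2 J _ (smd 1 2) r 0 z s Js)
    (fun r z => is_derive_point3_0 J _ (smv 0) r 0 z s Js)
    _ _ _ _ _ _ _ _ _ _ _ _ _ _ _
    (fun x y z => dtime (vel 0) (point3 x y z, s))
    (fun x y z => dtime (vel 1) (point3 x y z, s))
    (fun x y z => press (point3 x y z, s))
    (fun x y z => dspace 0 press (point3 x y z, s))
    (fun x y z => dspace 1 press (point3 x y z, s))
    (fun x y z => is_derive_point3_0 J _ (smv 0) x y z s Js)
    (fun x y z => is_derive_point3_1 J _ (smv 0) x y z s Js)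
    (fun x y z => is_derive_point3_2 J _ (smv 0) x y z s Js)
    (fun x y z => is_derive_point3_0 J _ (smv 1) x y z s Js)
    (fun x y z => is_derive_point3_1 J _ (smv 1) x y z s Js)
    (fun x y z => is_derive_point3_2 J _ (smv 1) x y z s Js)
    (fun x y z => is_derive_point3_0 J _ (smd 0 0) x y z s Js)
    (fun x y z => is_derive_point3_1 J _ (smd 0 1) x y z s Js)
    (fun x y z => is_derive_point3_2 J _ (smd 0 2) x y z s Js)
    (fun x y z => is_derive_point3_0 J _ (smd 1 0) x y z s Js)
    (fun x y z => is_derive_point3_1 J _ (smd 1 1) x y z s Js)
    (fun x y z => is_derive_point3_2 J _ (smd 1 2) x y z s Js)
    (fun x y z => is_derive_point3_0 J _ smp x y z s Js)
    (fun x y z => is_derive_point3_1 J _ smp x y z s Js)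
    (fun z => continuous2_horizontal J _ (smooth_dspace J _ 0 smp) z s Js)
    (fun x y z => momentum_equation nu J ur uth uz p u_NS x y z s 0 Js)
    (fun x y z => momentum_equation nu J ur uth uz p u_NS x y z s 1 Js)
    (fun x y z => let: And3 H _ _ := velocity_componentsE s x y z in H)
    (fun x y z => let: And3 _ H _ := velocity_componentsE s x y z in H)
    (fun x y z => let: And3 _ _ H := velocity_componentsE s x y z in H)
    (fun x y z => swirl_moment_t s x y z Js) r z r0).
Qed.

End MeridianFlowOfSolution.

(** * The energy identity *)

Section UniformBounds.
Context {R : realType}.
Implicit Types (A C d r s t z : R) (eta : R -> R -> R -> R).

Lemma smooth_cutoff_supp eta : smooth_cutoff eta -> exists A : R,
  forall r z s, 0 < r -> eta r z s != 0 -> box A (r, z).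
Proof.
move=> [_ /compact_bounded[M [_ HM]]]; exists (M + 1) => r z s r0 e0.
have : `|((r, z, s) : R * R * R)| <= M + 1.
  by apply: HM; [rewrite ltrDl|exact: subset_closure].
rewrite !prod_normE/= !ge_max => /andP[/andP[rM zM] _].
by split; rewrite /= in_itv/= -?ler_norml// (ltW r0) -(ger0_norm (ltW r0)).
Qed.

Lemma uniform_bound_on_box (f : R * R * R -> R) A t d :
  (forall q : R * R * R, `|q.2 - t| <= d -> {for q, continuous f}) ->
  exists2 C, 0 <= C & forall r z s, box A (r, z) -> `|s - t| <= d -> `|f (r, z, s)| <= C.
Proof.
move=> cf; pose K := box A `*` `[t - d, t + d]%classic.
have cK : compact K.
  by apply: compact_setX; [apply: compact_setX|]; exact: segment_compact.
have KP s : `[t - d, t + d]%classic s <-> `|s - t| <= d.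
  by rewrite ler_distl /= in_itv.
have cF : {within K, continuous (fun q => `|f q|)}.
  apply: continuous_in_subspaceT => q; rewrite inE => -[_ /KP qd].
  by apply: cvg_norm; exact: cf.
have [K0|K0] := eqVneq K set0.
  exists 0 => // r z s bx /KP sd; suff : K (r, z, s) by rewrite K0.
  by split.
have [q _ Hq] := compact_EVT_max (iffLR (set0P _) K0) cK cF.
exists `|f q| => // r z s bx /KP sd; apply: Hq; rewrite inE; by split.
Qed.

Lemma open_itv_sub (J : set R) t : open J -> J t ->
  exists2 d : R, 0 < d & forall s, `|s - t| <= d -> J s.
Proof.
move=> oJ Jt; have /nbhs_ballP[e /= e0 He] := oJ t Jt.
(* Half the radius, so that a closed time interval, which is compact, stays inside [J]. *)
exists (e / 2); first by rewrite divr_gt0.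
move=> s sd; apply: He; rewrite /ball/= distrC; apply: le_lt_trans sd _.
by rewrite ltr_pdivrMr// ltr_pMr// ltr1n.
Qed.

Lemma lipschitz_constant (phi : R -> R) : lipschitz phi ->
  exists2 L : R, 0 < L & forall x y : R, `|phi x - phi y| <= L * `|x - y|.
Proof.
move=> [M [_ HM]]; exists (`|M| + 1); first by rewrite ltr_wpDl.
move=> x y; have MM : M < `|M| + 1 by rewrite (le_lt_trans (ler_norm M)) ?ltrDl.
exact: (HM _ MM (x, y)).
Qed.

Lemma meridian_bound (J : set R) (f : 'rV[R]_3 * R -> R) A t d :
  smooth_on (space_time J) f -> (forall s, `|s - t| <= d -> J s) ->
  exists2 C, 0 <= C & forall r z s, box A (r, z) -> `|s - t| <= d ->
    `|f (point3 r 0 z, s)| <= C.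
Proof.
move=> sf dJ; pose g (q : R * R * R) := f (point3 q.1.1 0 q.1.2, q.2).
suff cg q : `|q.2 - t| <= d -> {for q, continuous g} by exact: (uniform_bound_on_box g A t d cg).
move=> /dJ Jq.
have c1 : {for q, continuous (fun q : R * R * R => q.1.1)}.
  by apply: (@continuous_comp _ _ _ fst fst); exact: cvg_fst.
have c2 : {for q, continuous (fun q : R * R * R => q.1.2)}.
  by apply: (@continuous_comp _ _ _ fst snd); [exact: cvg_fst|exact: cvg_snd].
have c3 : {for q, continuous (fun q : R * R * R => q.2)} by exact: cvg_snd.
have c0 : {for q, continuous (fun _ : R * R * R => 0 : R)} by exact: cvg_cst.
exact: (continuous_point3_comp J f sf _ _ _ _ _ q Jq c1 c0 c2 c3).
Qed.

End UniformBounds.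

(** * The densities of the theorem in terms of the flow *)

Section DensitiesOfFlow.
Context {R : realType} {nu A : R} {b br bz brr bzz bt a ar c cz e er ez : R -> R -> R}.
Hypothesis flow : meridian_flow nu A b br bz brr bzz bt a ar c cz e er ez.
Variables (phi : R -> R) (L : R) (ur uz eta w : R -> R -> R -> R) (t : R).
Hypotheses (L_gt0 : 0 < L)
  (phi_lip : forall x y : R, `|phi x - phi y| <= L * `|x - y|)
  (phi0 : phi 0 = 0)
  (wE : forall r z : R, 0 < r -> w r z t = phi (@Gam R b r z))
  (etaE : forall r z, eta r z t = e r z)
  (urE : forall r z : R, 0 < r -> ur r z t = a r z)
  (uzE : forall r z : R, 0 < r -> uz r z t = c r z).
Implicit Types (r z : R).
Local Notation G := (@Gam R b).
Local Notation Gr := (@Gam_r R b br).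
Local Notation Gz := (@Gam_z R bz).

Lemma d_r_truncation r z : 0 < r -> d_r w r z t = derive1 phi (G r z) * Gr r z.
Proof.
move=> r0; have [cG _ _ _] := continuous2_Gam flow.
have cGz : {near r, continuous (G^~ z)} by near=> x; exact: continuous2_r cG x.
have <- := derive1_truncation_comp phi L L_gt0 phi_lip _ r _ cGz (is_derive_Gam_r flow r z).
rewrite /d_r !derive1E; apply: near_eq_derive.
by near=> x; apply: wE; near: x; exact: lt_nbhsr.
Unshelve. all: by end_near. Qed.

Lemma d_z_truncation r z : 0 < r -> d_z w r z t = derive1 phi (G r z) * Gz r z.
Proof.
move=> r0; have [cG _ _ _] := continuous2_Gam flow.
have cGr : {near z, continuous (G r)} by near=> x; exact: continuous2_z cG x.
have <- := derive1_truncation_comp phi L L_gt0 phi_lip _ z _ cGr (is_derive_Gam_z flow r z).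
by congr (derive1 _ z); apply/funext => x; exact: wE.
Unshelve. all: by end_near. Qed.

Lemma d_r_cutoff r z : d_r eta r z t = er r z.
Proof.
rewrite /d_r (_ : (fun _ => _) = e^~ z); last by apply/funext => x; exact: etaE.
by rewrite derive1E; have [_ ->] := mf_e_r flow r z.
Qed.

Lemma d_z_cutoff r z : d_z eta r z t = ez r z.
Proof.
rewrite /d_z (_ : (fun _ => _) = e r); last by apply/funext => x; exact: etaE.
by rewrite derive1E; have [_ ->] := mf_e_z flow r z.
Qed.

Lemma dissipation_densityE r z : 0 < r ->
  dissipation_density eta w t r z = @grad_density R b br bz e phi r z.
Proof.
by move=> r0; rewrite /dissipation_density d_r_truncation// d_z_truncation// etaE.
Qed.

Lemma cutoff_diffusion_densityE r z : 0 < r ->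
  cutoff_diffusion_density eta w t r z = @diff_density R b br bz e er ez phi r z.
Proof.
move=> r0; rewrite /cutoff_diffusion_density d_r_truncation// d_z_truncation//.
by rewrite d_r_cutoff d_z_cutoff etaE wE.
Qed.

Lemma cutoff_transport_densityE r z : 0 < r ->
  cutoff_transport_density ur uz eta w t r z = @trans_density R b a c e er ez phi r z.
Proof.
by move=> r0; rewrite /cutoff_transport_density d_r_cutoff d_z_cutoff etaE wE// urE// uzE.
Qed.

Lemma radial_densityE r z : 0 < r ->
  radial_density ur eta w t r z = @rad_density R b a e phi r z.
Proof. by move=> r0; rewrite /radial_density etaE wE// urE. Qed.

(** With [f = eta] this is the energy density, with [f = eta_t] the cutoff time density. *)
Lemma energy_tame (f : R -> R -> R) : continuous2 f ->
  @tame R A (fun r z => e r z * f r z * phi (G r z) ^+ 2).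
Proof.
move=> cf; have [_ _ [ce _ _]] := mf_cont flow; have [cG _ _ _] := continuous2_Gam flow.
have m := @hp_measurable_continuous R; have me := m _ ce; have mf := m _ cf.
have mphi : hp_measurable (fun r z => phi (G r z)).
  apply: m; apply: continuous2_comp cG; exact: truncation_continuous L_gt0 phi_lip.
have Oe : bigO A unit 0 (fun=> e) by exact: bigO_continuous.
have Of : bigO A unit 0 (fun=> f) by exact: bigO_continuous.
have [M M0 GM] := Gam_bounded flow.
have Ophi : bigO A unit 2 (fun _ r z => phi (G r z)).
  apply: (bigO_comp_Gam flow _ M (fun=> phi) L) => // _ s _.
  exact: truncation_le.
apply: (tame_bigO flow _ 3) => [||r z e0].
- by hp_measurable_tac.
- by bigO_tac.
- by rewrite e0 !mul0r.
Qed.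

End DensitiesOfFlow.

Theorem proposition5p2 (R : realType) (nu : R) (J : set R)
    (ur uth uz : R -> R -> R -> R) (p : 'rV[R]_3 -> R -> R)
    (eta : R -> R -> R -> R) (phi : R -> R)
    (nu_gt0 : 0 < nu) (J_open : open J)
    (u_NS : smooth_NS_solution nu J (axisym_field ur uth uz) p)
    (eta_cutoff : smooth_cutoff eta)
    (phi_trunc : sign_safe_truncation phi) (t : R) (Jt : J t) :
  let w r z s := phi (circulation uth r z s) in
  let E s := nuG_integral (energy_density eta w s) in
  let lhs := 2^-1 * derive1 E t
             + nu * nuG_integral (dissipation_density eta w t) in
  let rhs := nuG_integral (cutoff_time_density eta w t)
             - 2 * nu * nuG_integral (cutoff_diffusion_density eta w t)
             + nuG_integral (cutoff_transport_density ur uz eta w t)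
             - nuG_integral (radial_density ur eta w t) in
  [/\ nuG_integrable (energy_density eta w t),
      nuG_integrable (dissipation_density eta w t)
    & nuG_integrable (cutoff_time_density eta w t)] /\
  [/\ nuG_integrable (cutoff_diffusion_density eta w t),
      nuG_integrable (cutoff_transport_density ur uz eta w t)
    & nuG_integrable (radial_density ur eta w t)] /\
  [/\ derivable E t 1,
      (affine_where_active phi -> lhs = rhs)
    & ((forall s, 0 <= phi s) -> lhs <= rhs)].
Proof.
move=> w E lhs rhs.
have [phi_convex /lipschitz_constant[L L_gt0 phi_lip] phi0] := phi_trunc.
have [eta_smooth _] := eta_cutoff.
have [A supp] := smooth_cutoff_supp eta eta_cutoff.
have [d d_gt0 dJ] := open_itv_sub J t J_open Jt.
have dJ' s : `|s - t| < d -> J s by move=> /ltW; exact: dJ.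
pose b r z s := swirl ur uth uz s r z.
pose bt r z s := swirl_t ur uth uz s r z.
pose et r z s := cutoff_along eta (0, 0, 1) s r z.
(* Agrees with [w] for [r > 0], at all times, but is built from functions regular across the axis at
   the times in [J]. *)
pose w' r z s := phi (r * b r z s).
have := flow_of_solution nu J ur uth uz p eta u_NS eta_smooth t A Jt (fun r z => supp r z t).
cbv zeta => flow.
have wE r z s : 0 < r -> w r z s = w' r z s.
  by move=> r0; rewrite /w' /b swirlE.
have urE r z : 0 < r -> ur r z t = velocity ur uth uz 0 (point3 r 0 z, t).
  by move=> r0; rewrite radial_velocityE.
have uzE r z : 0 < r -> uz r z t = velocity ur uth uz 2 (point3 r 0 z, t).
  by move=> r0; rewrite axial_velocityE ?ltW.
have wG r z : 0 < r -> w r z t = phi (@Gam R (swirl ur uth uz t) r z) by exact: wE.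
have etaE r z : eta r z t = eta r z t by [].
have gradE := dissipation_densityE flow phi L eta w t L_gt0 phi_lip wG etaE.
have diffE := cutoff_diffusion_densityE flow phi L eta w t L_gt0 phi_lip wG etaE.
have transE := cutoff_transport_densityE flow phi ur uz eta w t wG etaE urE uzE.
have radE r z (r0 : 0 < r) := radial_densityE phi ur eta w t wG etaE urE r z r0.
have [tame_t tame_g [tame_d tame_tr tame_r]] :=
  densities_tame flow phi L L_gt0 phi_lip phi0 phi_convex.
have ET := energy_tame flow phi L L_gt0 phi_lip phi0.
have timeE r z : 0 < r -> cutoff_time_density eta w t r z =
    eta r z t * et r z t * phi (Gam (b := swirl ur uth uz t) r z) ^+ 2.
  move=> r0; rewrite /cutoff_time_density (wE r z t r0) /d_t derive1E.
  by have [_ ->] := is_derive_cutoff_t eta eta_smooth r z t.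
have int f g : (forall r z, 0 < r -> f r z = g r z) -> @tame R A g -> nuG_integrable f.
  by move=> fg /tame_integrable; apply: eq_nuG_integrable => r z r0; rewrite fg.
have Iener : nuG_integrable (energy_density eta w t).
  apply: int (ET _ (continuous2_cutoff eta eta_smooth t)) => r z r0.
  by rewrite /energy_density wE// expr2.
have Tcut := ET _ (continuous2_cutoff_along eta eta_smooth (0, 0, 1) t).
have smv := smooth_velocity nu J ur uth uz p u_NS.
have bound_v f sf := meridian_bound J f A t d sf dJ.
have bound_e f (sf : smooth_on setT f) := uniform_bound_on_box f A t d
  (fun q _ => smooth_on_continuous _ _ q sf I).
have dE : is_derive t 1 E (2 * nuG_integral (cutoff_time_density eta w t) +
    2 * nuG_integral (@time_density R (swirl ur uth uz t) (swirl_t ur uth uz t)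
      (fun r z => eta r z t) phi)).
  have [mN N0] := critical_kinks_null flow phi phi_convex.
  have -> : E = fun s => nuG_integral (energy_density eta w' s).
    apply/funext => s; apply: eq_nuG_integral => r z r0.
    by rewrite /energy_density wE.
  have -> := eq_nuG_integral _ _ timeE.
  apply: (is_derive_energy phi L A t d b bt eta et _ L_gt0 phi_lip phi0 _ d_gt0
    _ _ _ _ _ _ mN N0).
  - exact: measurable_derive_truncation L_gt0 phi_lip (countable_kinks _ phi_convex).
  - by move=> r z s /dJ' Js; exact: is_derive_point3_t (smv 1) r 0 z s Js.
  - by move=> r z s _; exact: is_derive_cutoff_t.
  - have [C1 C10 H1] := bound_v _ (smv 1).
    have [C2 C20 H2] := bound_v _ (smooth_dtime J _ (smv 1)).
    have [C3 C30 H3] := bound_e _ eta_smooth.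
    have [C4 C40 H4] := bound_e _ (smooth_on_derive _ _ ((0, 0, 1) : R * R * R) eta_smooth).
    exists (C1 + C2 + C3 + C4); first by rewrite !addr_ge0.
    move=> r z s bx /ltW sd; split.
    + by apply: le_trans (H1 r z s bx sd) _; rewrite -!addrA lerDl !addr_ge0.
    + by apply: le_trans (H2 r z s bx sd) _; rewrite -!addrA addrCA lerDl !addr_ge0.
    + by apply: le_trans (H3 r z s bx sd) _; rewrite addrAC lerDr !addr_ge0.
    + by apply: le_trans (H4 r z s bx sd) _; rewrite lerDr !addr_ge0.
  - by move=> r z s r0 _; exact: supp.
  - move=> s /dJ' Js; split; last exact: continuous2_cutoff.
    exact: continuous2_meridian (smv 1) s Js.
  - split; last exact: continuous2_cutoff_along.
    exact: continuous2_meridian (smooth_dtime J _ (smv 1)) t Jt.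
  - by move=> r z r0 nN nd; have [] := kink_stationary flow phi r z r0 nN nd.
  - exact: tame_integrable Tcut.
  - exact: tame_integrable tame_t.
split; first split => //.
- exact: int gradE tame_g.
- exact: int timeE Tcut.
split; first split.
- exact: int diffE tame_d.
- exact: int transE tame_tr.
- exact: int radE tame_r.
have [bal0 bal_ge0] := energy_balance flow phi L L_gt0 phi_lip phi0 phi_convex (ltW nu_gt0).
set D := balance_defect phi in bal0 bal_ge0.
(* Half the derivative of the energy is the integral of [eta eta_t w^2] plus that of [time_density];
   the former also stands in [rhs] and cancels. *)
have defectE : rhs - lhs = D.
  rewrite /rhs /lhs /D /balance_defect derive1E; have [_ ->] := dE.
  rewrite (eq_nuG_integral _ _ gradE) (eq_nuG_integral _ _ diffE).
  rewrite (eq_nuG_integral _ _ transE) (eq_nuG_integral _ _ radE).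
  have -> (x y : R) : 2^-1 * (2 * x + 2 * y) = x + y by field.
  move: (nuG_integral _) (nuG_integral _) (nuG_integral _) (nuG_integral _) (nuG_integral _)
    (nuG_integral _) => x1 x2 x3 x4 x5 x6.
  clear; ring.
split; first by have [] := dE.
- by move=> /bal0; rewrite -defectE => /eqP; rewrite subr_eq0 => /eqP.
- by move=> /bal_ge0; rewrite -defectE subr_ge0.
Qed.
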